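(* Let $\mathcal{X},\mathcal{Y},\mathcal{Z}$ be standard Borel spaces, let $X,Y,Z$ be random variables (on a common probability space) with values in $\mathcal{X},\mathcal{Y},\mathcal{Z}$ respectively, and let $W:=(X,Z)$, an $\mathcal{X}\times\mathcal{Z}$-valued random variable. Fix Borel isomorphisms $\varphi$ of $\mathcal{X}$, $\psi$ of $\mathcal{Y}$ and $\delta$ of $\mathcal{X}\times\mathcal{Z}$, and let $(X_1,Y_1,Z_1),(X_2,Y_2,Z_2),\ldots$ be i.i.d. copies of $(X,Y,Z)$, $W_i=(X_i,Z_i)$. Define $\xi_n(X,Y):=\xi_n(\varphi(X),\psi(Y))$ computed from $(\varphi(X_i),\psi(Y_i))_{i\le n}$ and $\xi_n(W,Y):=\xi_n(\delta(W),\psi(Y))$ computed from $(\delta(W_i),\psi(Y_i))_{i\le n}$, and set $\xi_n(Z,Y\mid X):=\dfrac{\xi_n(W,Y)-\xi_n(X,Y)}{1-\xi_n(X,Y)}$ (undefined if the denominator is $0$). Suppose $Y$ is not almost surely equal to a measurable function of $X$. Then as $n\to\infty$, $\xi_n(Z,Y\mid X)$ converges almost surely to a deterministic limit $\xi(Z,Y\mid X)\in[0,1]$; moreover $\xi(Z,Y\mid X)=0$ if and only if $Y$ and $Z$ are conditionally independent given $X$, and $\xi(Z,Y\mid X)=1$ if and only if there is a measurable $g:\mathcal{X}\times\mathcal{Z}\to\mathcal{Y}$ with $Y=g(X,Z)$ almost surely.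
   Context: A standard Borel space is a measurable space isomorphic (via a measurable bijection with measurable inverse) to a Borel subset of a Polish space. A Borel isomorphism of a standard Borel space $\mathcal{X}$ is an injective measurable map $\varphi:\mathcal{X}\to\mathbb{R}$ with $\varphi(\mathcal{X})$ Borel and $\varphi^{-1}$ measurable on $\varphi(\mathcal{X})$. Definition of $\xi_n$ for real data: given real pairs $(X_1,Y_1),\ldots,(X_n,Y_n)$, $n\ge2$, rearrange them as $(X_{(1)},Y_{(1)}),\ldots,(X_{(n)},Y_{(n)})$ with $X_{(1)}\le\cdots\le X_{(n)}$, where $Y_{(i)}$ is the $Y$-value paired with $X_{(i)}$, ties among the $X_i$ being broken uniformly at random. Let $r_i=\#\{j: Y_{(j)}\le Y_{(i)}\}$ and $l_i=\#\{j:Y_{(j)}\ge Y_{(i)}\}$. Then $\xi_n=1-\dfrac{n\sum_{i=1}^{n-1}|r_{i+1}-r_i|}{2\sum_{i=1}^n l_i(n-l_i)}$. *)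

(* Defs.v *)
From HB Require Import structures.
From mathcomp Require Import all_boot all_order all_algebra.
From mathcomp Require Import all_classical all_reals all_analysis.
Set Implicit Arguments. Unset Strict Implicit. Unset Printing Implicit Defensive.
Import Order.TTheory GRing.Theory Num.Theory.
Local Open Scope classical_set_scope.
Local Open Scope ring_scope.

(* Borel isomorphism of a measurable space T into R (R with its Borel
   sigma-algebra): an injective measurable map whose image is Borel and whose
   inverse is measurable on the image, i.e. the preimage under the inverse of
   a measurable set A, namely f @` A, is measurable. *)
Definition borel_iso d (T : measurableType d) (R : realType) (f : T -> R) :=
  [/\ measurable_fun setT f, injective f, measurable (range f)
    & forall A : set T, measurable A -> measurable (f @` A)].

(* Chatterjee's xi_n for real data (x_i, y_i), i = 0..n-1.  Ties among the
   x_i are broken by the auxiliary keys u_i: indices are sorted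
   lexicographically by (x_i, u_i).  When the u_i are i.i.d. Uniform[0,1]
   independent of the data, this is uniform random tie-breaking. *)
Definition xi_n (R : realType) (n : nat) (x u y : nat -> R) : R :=
  let key_le i j := (x i < x j) || ((x i == x j) && (u i <= u j)) in
  let s := sort key_le (iota 0 n) in
  let r i := count (fun j => y j <= y i) (iota 0 n) in
  let l i := count (fun j => y j >= y i) (iota 0 n) in
  1 - (n%:R * \sum_(k < n.-1)
          `|(r (nth 0%N s k.+1))%:R - (r (nth 0%N s k))%:R|)
      / (2 * \sum_(i < n) ((l i) * (n - l i))%:R).

Definition mutual_indep d (Om : measurableType d) (R : realType)
  (P : probability Om R) dT (T : measurableType dT) (F : nat -> Om -> T) :=
  forall (s : seq nat) (A : nat -> set T), uniq s ->
    (forall i, measurable (A i)) ->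
    P (\bigcap_(i in [set` s]) (F i @^-1` A i)) =
    (\prod_(i <- s) P (F i @^-1` A i))%E.

(* f (composed with X) is a version of the conditional probability
   P(E | X) (Doob-Dynkin: sigma(X)-measurable functions are functions of X);
   we take versions with values in [0,1]. *)
Definition cond_prob_version d (Om : measurableType d) (R : realType)
  (P : probability Om R) dX (TX : measurableType dX) (X : Om -> TX)
  (E : set Om) (f : TX -> R) :=
  [/\ measurable_fun setT f, (forall x, 0 <= f x <= 1) &
    forall C : set TX, measurable C ->
      P (E `&` X @^-1` C) = (\int[P]_(w in X @^-1` C) (f (X w))%:E)%E].

Definition cond_indep d (Om : measurableType d) (R : realType)
  (P : probability Om R) dX (TX : measurableType dX)
  dY (TY : measurableType dY) dZ (TZ : measurableType dZ)
  (X : Om -> TX) (Y : Om -> TY) (Z : Om -> TZ) :=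
  forall (A : set TY) (B : set TZ), measurable A -> measurable B ->
    exists fA fB : TX -> R,
      [/\ cond_prob_version P X (Y @^-1` A) fA,
          cond_prob_version P X (Z @^-1` B) fB &
          cond_prob_version P X (Y @^-1` A `&` Z @^-1` B)
            (fun x => fA x * fB x)].

(* Main.v *)
Require Import Defs.
From HB Require Import structures.
From mathcomp Require Import all_boot all_order all_algebra.
From mathcomp Require Import all_classical all_reals all_analysis.
From mathcomp Require Import measurable_realfun.
From mathcomp Require Import ring lra zify.
Import Order.TTheory GRing.Theory Num.Theory numFieldNormedType.Exports.
Local Open Scope classical_set_scope.
Local Open Scope ring_scope.

Set Implicit Arguments.
Unset Strict Implicit.
Unset Printing Implicit Defensive.

(** In [xi_n] the factor [sum l_i (n - l_i)] cancels from the ratio, which is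
[1 - S_W / S_X] with [S = sum |r_(i+1) - r_i|].  By Glivenko-Cantelli,
[S / n^2] is close to [(1/n) sum |F (y_(i+1)) - F (y_(i))|], [F] being the
distribution function of [psi Y], and [|F a - F b|] is, within [2 / K], the
average over thresholds [v = j / K] of [|1_(F a >= v) - 1_(F b >= v)|].  For
one event [A], write [1_A = m (X) + eps] with [m] the conditional probability.
Products of residuals at consecutive ranks have mean zero unless the index
pairs agree, because the ranks depend only on the [x_i] and the tie-breaking
keys; their sum has second moment at most [n].  Since
[(1/n) sum |m (x_(i+1)) - m (x_(i))|] vanishes in the limit,
[(1/n) sum |1_A(i+1) - 1_A(i)|] tends to twice the mean conditional variance
of [1_A] given [X].  Second moments of order [n] give almost sure convergence
along the squares, and bounded increments fill the gaps.

Hence [S / n^2] tends to a limit [c] approximated by grid averages of mean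
conditional variances of the events [F (psi Y) >= v].  These only decrease
when [X] is replaced by [W = (X, Z)], so [0 <= c_W <= c_X] and
[L = 1 - c_W / c_X].  By left continuity in [v], [c = 0] forces every event
[F (psi Y) >= v] to be determined by [X], and [c_W = c_X] forces its
conditional probabilities given [X] and given [W] to agree; up to null sets
these events generate all events of [Y]. *)

(** * Expectation of bounded random variables *)

(** The conditional mean [m] is only measurable, so closeness of neighbouring values of [phi] says
    nothing about [m (x_(i+1)) - m (x_(i))] by continuity. The substitute is a class argument: the
    Borel sets whose preimage under [phi] has an indicator of vanishing oscillation along the
    ranking form a sigma-algebra that contains the half-lines, and since [phi] is injective with
    measurable images, every measurable set of predictors is reached. Conditioning enters only as
    orthogonality of a bounded variable to a pi-system, extended to the generated sigma-algebra; no
    regular conditional law is built. Thresholds act on [F (psi Y)] rather than on [psi Y] because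
    ranks divided by [n] estimate [F], and because equally spaced thresholds in [0, 1] then suffice.
    The samples with predictors [X] and [W] are instances of one limit theorem, and only their
    almost sure limits are combined. *)

Section Levels.
Variable R : realType.

(** The sum counts the integers of [1, n] not exceeding [t], so it is the minimum of [n] and the
    integer part of [t]. The saturated case is what closes the induction. *)
Lemma sum_count_levels (t : R) (n : nat) : 0 <= t ->
  (n%:R <= t -> \sum_(j < n) (j.+1%:R <= t)%R%:R = n%:R :> R) /\
  (t <= n%:R ->
   t - 1 <= \sum_(j < n) (j.+1%:R <= t)%R%:R :> R /\
   \sum_(j < n) (j.+1%:R <= t)%R%:R <= t :> R).
Proof.
move=> t0; elim: n => [|n [IH1 IH2]].
  by rewrite big_ord0; split => // t1; split; lra.
rewrite big_ord_recr /= -natr1; split => [nt|tn].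
  by rewrite IH1 ?nt ?mulr1n //; lra.
have [nt|nt] := leP (n%:R + 1) t.
  by rewrite IH1 ?mulr1n; lra.
rewrite mulr0n addr0.
have [nt'|nt'] := leP n%:R t; last by apply: IH2; lra.
by rewrite IH1 //; lra.
Qed.

(** For [a] in [0, 1] this is [a] rounded down to a multiple of [1 / K.+1]. Writing the rounding as
    an average of threshold indicators lets statements about events pass to functions. *)
Definition level (K : nat) (a : R) : R :=
  K.+1%:R^-1 * \sum_(j < K.+1) (j.+1%:R / K.+1%:R <= a)%R%:R.

Lemma level_approx (K : nat) (a : R) : 0 <= a <= 1 ->
  `|a - level K a| <= K.+1%:R^-1.
Proof.
move=> /andP[a0 a1]; rewrite /level.
have K0 : 0 < K.+1%:R :> R by rewrite ltr0n.
have [_] := @sum_count_levels (K.+1%:R * a) K.+1 (mulr_ge0 (ltW K0) a0).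
rewrite -[X in _ <= X -> _]mulr1 ler_pM2l // => /(_ a1).
under eq_bigr => j _ do
  rewrite mulrC -ler_pdivrMr //.
set s := (\sum_(_ < _) _ : R) => -[h1 h2].
rewrite -(ler_pM2l K0) divff ?gt_eqF // -(gtr0_norm K0) -normrM.
rewrite (gtr0_norm K0) mulrBr mulrA divff ?gt_eqF // mul1r ler_norml.
by apply/andP; split; lra.
Qed.

End Levels.

Section Expectation.
Context (R : realType) (d : measure_display) (Om : measurableType d).
Variable P : probability Om R.
Implicit Types f g h : Om -> R.

Definition bm f := measurable_fun setT f /\ exists M, forall w, `|f w| <= M.

Lemma bm_int f : bm f -> P.-integrable setT (EFin \o f).
Proof.
move=> [mf [M fM]]; apply: measurable_bounded_integrable => //.
  exact: le_lt_trans (probability_le1 P measurableT) (ltry _).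
exists M; split; first exact: num_real.
by move=> x Mx y _ /=; exact: le_trans (fM y) (ltW Mx).
Qed.
#[local] Hint Resolve bm_int : core.

Definition Ex f : R := \int[P]_w f w.

Lemma bm_cst (r : R) : bm (fun=> r).
Proof. by split; [exact: measurable_cst | exists `|r|]. Qed.

Lemma bmD f g : bm f -> bm g -> bm (fun w => f w + g w).
Proof.
move=> [mf [M fM]] [mg [N gN]]; split; first exact: measurable_funD.
by exists (M + N) => w; rewrite (le_trans (ler_normD _ _)) // lerD.
Qed.

Lemma bmM f g : bm f -> bm g -> bm (fun w => f w * g w).
Proof.
move=> [mf [M fM]] [mg [N gN]]; split; first exact: measurable_funM.
by exists (M * N) => w; rewrite normrM ler_pM.
Qed.

Lemma bmN f : bm f -> bm (fun w => - f w).
Proof.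
move=> [mf [M fM]]; split; first exact: measurable_funN.
by exists M => w; rewrite normrN.
Qed.

Lemma bmB f g : bm f -> bm g -> bm (fun w => f w - g w).
Proof. by move=> bf bg; apply: bmD => //; exact: bmN. Qed.

Lemma bmX f n : bm f -> bm (fun w => f w ^+ n).
Proof.
move=> bf; elim: n => [|n IH].
  by under eq_fun do rewrite expr0; exact: bm_cst.
by under eq_fun do rewrite exprS; exact: bmM.
Qed.

Lemma bm_sum (I : Type) (r : seq I) (F : I -> Om -> R) :
  (forall i, bm (F i)) -> bm (fun w => \sum_(i <- r) F i w).
Proof.
move=> bF; elim: r => [|i r IH].
  by under eq_fun do rewrite big_nil; exact: bm_cst.
by under eq_fun do rewrite big_cons; exact: bmD.
Qed.

Lemma bm_norm f : bm f -> bm (fun w => `|f w|).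
Proof.
move=> [mf [M fM]]; split; first exact: measurableT_comp.
by exists M => w; rewrite normr_id.
Qed.

Lemma bm_ind (A : set Om) : measurable A -> bm (\1_A).
Proof.
move=> mA; split; first exact: measurable_indic.
by exists 1 => w; rewrite indicE; case: (_ \in _); rewrite ?normr1 ?normr0.
Qed.

Lemma bm_bool (b : Om -> bool) : measurable [set w | b w] ->
  bm (fun w => (b w)%:R).
Proof.
move=> mb; have := bm_ind mb; congr bm; apply/funext => w.
by rewrite indicE; case: (boolP (b w)) => bw; [rewrite mem_set|rewrite memNset //; apply/negP].
Qed.

Lemma ExD f g : bm f -> bm g -> Ex (fun w => f w + g w) = Ex f + Ex g.
Proof. by move=> bf bg; rewrite /Ex RintegralD //; exact: bm_int. Qed.

Lemma ExB f g : bm f -> bm g -> Ex (fun w => f w - g w) = Ex f - Ex g.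
Proof. by move=> bf bg; rewrite /Ex RintegralB //; exact: bm_int. Qed.

Lemma ExZ r f : bm f -> Ex (fun w => r * f w) = r * Ex f.
Proof. by move=> bf; rewrite /Ex RintegralZl //; exact: bm_int. Qed.

Lemma probT : P setT = 1%E. Proof. exact: probability_setT. Qed.

Lemma Ex_cst r : Ex (fun=> r) = r.
Proof. 
rewrite /Ex (Rintegral_cst P measurableT) -[RHS]mulr1; congr (_ * _).
by rewrite -[RHS]/(fine 1%E); congr fine; exact: probT.
Qed.

Lemma Ex_sum (I : Type) (r : seq I) (F : I -> Om -> R) :
  (forall i, bm (F i)) ->
  Ex (fun w => \sum_(i <- r) F i w) = \sum_(i <- r) Ex (F i).
Proof.
move=> bF; elim: r => [|i r IH].
  by rewrite big_nil -[RHS](Ex_cst 0); congr Ex; apply/funext => w; rewrite big_nil.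
rewrite big_cons -IH -ExD //; last exact: bm_sum.
by congr Ex; apply/funext => w; rewrite big_cons.
Qed.

Lemma Ex_le f g : bm f -> bm g -> (forall w, f w <= g w) -> Ex f <= Ex g.
Proof. by move=> bf bg fg; apply: le_Rintegral => //; exact: bm_int. Qed.

Lemma Ex_ge0 f : (forall w, 0 <= f w) -> 0 <= Ex f.
Proof. by move=> f0; apply: Rintegral_ge0. Qed.

Lemma Ex_norm f : bm f -> `|Ex f| <= Ex (fun w => `|f w|).
Proof. by move=> bf; apply: le_normr_Rintegral => //; exact: bm_int. Qed.

Lemma Ex_ind (A : set Om) : measurable A -> Ex \1_A = fine (P A).
Proof. by move=> mA; rewrite /Ex /Rintegral integral_indic // setIT. Qed.

Lemma Ex_EFin f : bm f -> (Ex f)%:E = (\int[P]_w (f w)%:E)%E.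
Proof.
move=> bf; rewrite /Ex /Rintegral fineK //.
by apply: integrable_fin_num => //; exact: (bm_int bf).
Qed.

Lemma Ex_ae f g : bm f -> bm g -> {ae P, forall w, f w = g w} -> Ex f = Ex g.
Proof.
move=> bf bg fg; rewrite /Ex /Rintegral; congr fine.
apply: ae_eq_integral => //; try by apply/measurable_EFinP; case: bf; case: bg.
by apply: filterS fg => w /= -> _.
Qed.

Lemma Ex_eq0 f : bm f -> (forall w, 0 <= f w) -> Ex f = 0 ->
  {ae P, forall w, f w = 0}.
Proof.
move=> bf f0 Ef; have := Ex_EFin bf; rewrite Ef => /esym If.
have mf : measurable_fun setT (EFin \o f) by apply/measurable_EFinP; case: bf.
have : ae_eq P setT (EFin \o f) (cst 0%E).
  apply/ae_eq_integral_abs => //; rewrite -[RHS]If.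
  by apply: eq_integral => w _ /=; rewrite ger0_norm.
by apply: filterS => w /= /(_ I) [].
Qed.

End Expectation.

Arguments bm_ind {R d Om A}.
Arguments bm_bool {R d Om b}.
Arguments bm_cst {R d Om}.

(** * Orthogonality to a generated sigma-algebra *)

Section Orthogonality.
Context (R : realType) (d : measure_display) (Om : measurableType d).
Variable P : probability Om R.
Local Notation Ex := (Ex P).
Local Notation bm := (@bm R d Om).

Lemma Ex_restr (e : Om -> R) (A : set Om) : bm e -> measurable A ->
  (\int[P]_(w in A) (e w)%:E)%E = (Ex (fun w => e w * \1_A w))%:E.
Proof.
move=> be mA; rewrite Ex_EFin; last by apply: bmM => //; exact: bm_ind.
rewrite integral_mkcond; apply: eq_integral => w _.
by rewrite patchE indicE; case: ifP => _; rewrite ?mulr1 ?mulr0.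
Qed.

(** Pi-lambda argument: the measurable sets orthogonal to [e] form a Dynkin system, complements
    being handled through [G setT] and disjoint unions by countable additivity of the integral of
    [e]. *)
Lemma ortho_set (e : Om -> R) (G : set (set Om)) : bm e ->
  G `<=` measurable -> setI_closed G -> G setT ->
  (forall A, G A -> Ex (fun w => e w * \1_A w) = 0) ->
  forall A, <<s G >> A -> measurable A /\ Ex (fun w => e w * \1_A w) = 0.
Proof.
move=> be mG GI GT eG A.
rewrite -setI_closed_g_dynkin_g_sigma_algebra //.
apply: (smallest_sub _ (fun B GB => conj (mG B GB) (eG B GB))); split.
- by split => //; apply: eG.
- move=> B [mB eB]; split; first exact: measurableC.
  have bB := bm_ind mB.
  transitivity (Ex (fun w => e w * \1_setT w - e w * \1_B w)).
    congr Ex; apply/funext => w; rewrite !indicE in_setC in_setT.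
    by case: (w \in B) => /=; rewrite !(mulr1, mulr0, subrr, subr0).
  by rewrite ExB ?eB ?eG ?subrr //; apply: bmM => //; exact: bm_ind.
move=> F tF FP.
have mF k : measurable (F k) by have [] := FP k.
have mU : measurable (\bigcup_k F k) by exact: bigcup_measurable.
split => //; apply: EFin_inj; rewrite -Ex_restr // integral_bigcup //.
  by apply: eseries0 => k _ _; rewrite Ex_restr //; have [_ ->] := FP k.
by apply: (@integrableS _ _ _ P setT) => //; exact: bm_int.
Qed.

Lemma bm_level (f : Om -> R) K : measurable_fun setT f ->
  bm (fun w => level K (f w)).
Proof.
move=> mf; apply: bmM; first exact: bm_cst.
apply: bm_sum => j.
apply: bm_bool; rewrite (_ : [set _ | _] = f @^-1` `[j.+1%:R / K.+1%:R, +oo[).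
  by rewrite -[X in measurable X]setTI; exact: mf.
by apply/seteqP; split => w /=; rewrite in_itv /= andbT.
Qed.

Lemma le_invS_eq0 (r M : R) :
  (forall K : nat, `|r| <= M * K.+1%:R^-1) -> r = 0.
Proof.
move=> h; apply/eqP; rewrite -normr_eq0 eq_le normr_ge0 andbT.
have M0 : 0 <= M by have := h 0%N; rewrite invr1 mulr1; apply: le_trans.
apply/ler_addgt0Pl => e e0; rewrite addr0.
have [K /ltW hK] := ltr_add_invr (y:=0) (x:=e / (M + 1)) ltac:(rewrite divr_gt0 //; lra).
rewrite add0r in hK; apply: (le_trans (h K)).
apply: (@le_trans _ _ (M * (e / (M + 1)))); first exact: ler_wpM2l.
rewrite mulrA ler_pdivrMr; last by lra.
by rewrite mulrC mulrDr; nra.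
Qed.

(** [F] is within [1 / K.+1] of [level K F], a combination of indicators of sets [r <= F], and [e]
    is bounded. *)
Lemma ortho01 (e F : Om -> R) : bm e -> measurable_fun setT F ->
  (forall w, 0 <= F w <= 1) ->
  (forall r, Ex (fun w => e w * \1_[set w | r <= F w] w) = 0) ->
  Ex (fun w => e w * F w) = 0.
Proof.
move=> be mF F01 eF.
have bF : bm F.
  by split => //; exists 1 => w; have /andP[? ?] := F01 w; rewrite ger0_norm.
have [me [M eM]] := be.
apply: (@le_invS_eq0 _ M) => K.
have bL := bm_level K mF.
have -> : Ex (fun w => e w * F w) = Ex (fun w => e w * (F w - level K (F w))).
  have E0 : Ex (fun w => e w * level K (F w)) = 0.
    pose T (j : 'I_K.+1) w := e w * \1_[set w | j.+1%:R / K.+1%:R <= F w] w.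
    have bT j : bm (T j).
      apply: bmM => //; apply: bm_ind.
      rewrite (_ : [set _ | _] = F @^-1` `[j.+1%:R / K.+1%:R, +oo[).
        by rewrite -[X in measurable X]setTI; exact: mF.
      by apply/seteqP; split => w /=; rewrite in_itv /= andbT.
    transitivity (Ex (fun w => K.+1%:R^-1 * \sum_(j < K.+1) T j w)).
      congr Ex; apply/funext => w; rewrite /level mulrCA; congr (_ * _).
      rewrite mulr_sumr; apply: eq_bigr => j _; rewrite /T; congr (_ * _).
      rewrite indicE; case: (boolP (_ <= F w)) => h; first by rewrite mem_set.
      by rewrite memNset //=; apply/negP.
    rewrite ExZ; last exact: bm_sum.
    rewrite Ex_sum // big1 ?mulr0 // => j _; exact: eF.
  have -> : (fun w => e w * (F w - level K (F w))) =
            (fun w => e w * F w - e w * level K (F w)).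
    by apply/funext => w; rewrite mulrBr.
  by rewrite ExB ?E0 ?subr0 //; exact: bmM.
have bd : bm (fun w => e w * (F w - level K (F w))).
  by apply: bmM => //; exact: bmB.
apply: (le_trans (Ex_norm P bd)); rewrite -(Ex_cst P (M * _)).
apply: Ex_le => [||w]; [exact: bm_norm|exact: bm_cst|].
by rewrite normrM ler_pM // level_approx.
Qed.

(** In conditional terms, [e] has conditional mean zero given the sigma-algebra generated by [G].
    Later zero-mean claims thus reduce to checking a pi-system. *)
Lemma ortho (e : Om -> R) (G : set (set Om)) : bm e ->
  G `<=` measurable -> setI_closed G -> G setT ->
  (forall A, G A -> Ex (fun w => e w * \1_A w) = 0) ->
  forall F : Om -> R,
  measurable_fun setT (F : g_sigma_algebraType G -> R) ->
  (exists M, forall w, `|F w| <= M) ->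
  Ex (fun w => e w * F w) = 0.
Proof.
move=> be mG GI GT eG F mFG [M FM].
have eS := ortho_set be mG GI GT eG.
have mle r : <<s G >> [set w | r <= F w].
  have := mFG measurableT _ (measurable_itv `[r, +oo[%R).
  rewrite setTI; congr (<<s G >> _).
  by apply/seteqP; split => w /=; rewrite in_itv /= andbT.
have mF : measurable_fun setT F.
  apply: (measurability _ (RGenCInfty.measurableE R)) => //.
  move=> _ [_ [r ->] <-]; rewrite setTI; have [+ _] := eS _ (mle r).
  congr measurable.
  by apply/seteqP; split => w /=; rewrite in_itv /= andbT.
have M0 : 0 <= M by exact: le_trans (FM point).
(* [ortho01] asks for values in [0, 1]; [M + 1] keeps the denominator positive when [M = 0]. *)
pose F' w := (2 * (M + 1))^-1 * F w + 2^-1.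
have eF' : Ex (fun w => e w * F' w) = 0.
  apply: ortho01 => //.
  - by apply: measurable_funD => //; apply: measurable_funM.
  - move=> w; rewrite /F' invfM; have := FM w; rewrite ler_norml => /andP[h1 h2].
    have M1 : 0 < (M + 1)^-1 by rewrite invr_gt0; lra.
    have : (M + 1) * (M + 1)^-1 = 1 by rewrite divff // gt_eqF //; lra.
    set v := (M + 1)^-1 in M1 *; move=> vE.
    by apply/andP; split; nra.
  - move=> r; have [_] := eS _ (mle ((r - 2^-1) * (2 * (M + 1)))).
    congr (Ex _ = _); apply/funext => w; congr (_ * \1_ _ _).
    apply/funext => z /=; rewrite /F' -[in RHS]lerBlDr ler_pdivlMl ?[_ * (r - _)]mulrC //.
    by rewrite mulr_gt0 //; lra.
have bF : bm F by split => //; exists M.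
have e0 : Ex e = 0.
  by rewrite -[RHS](eG _ GT); congr Ex; apply/funext => w; rewrite indicT mulr1.
have : Ex (fun w => (2 * (M + 1)) * (e w * F' w) - (M + 1) * e w) = 0.
  have beF' : bm (fun w => e w * F' w).
    by apply: bmM => //; apply: bmD; [apply: bmM => //|]; exact: bm_cst.
  rewrite ExB; [|exact: bmM (bm_cst _) beF'|exact: bmM (bm_cst _) be].
  by rewrite !ExZ ?eF' ?e0 ?mulr0 ?subrr.
move=> <-; congr Ex; apply/funext => w; rewrite /F'.
by field; rewrite gt_eqF //; lra.
Qed.

Lemma Ex_cap0 (F : nat -> set Om) : (forall n, measurable (F n)) ->
  (forall n, F n.+1 `<=` F n) -> \bigcap_n F n = set0 ->
  forall e : R, 0 < e -> exists N, forall n, (N <= n)%N -> Ex \1_(F n) <= e.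
Proof.
move=> mF dF F0 e e0.
have : (P \o F) @ \oo --> P (\bigcap_n F n).
  apply: nonincreasing_cvg_mu => //.
  - by rewrite (le_lt_trans (probability_le1 P (mF 0%N))) // ltry.
  - by rewrite F0.
  - by apply/nonincreasing_seqP => n; apply/subsetPset.
rewrite F0 measure0 => /fine_cvgP[_ /cvgrPdist_le /(_ e e0) [N _ hN]].
exists N => n Nn; have := hN n Nn; rewrite /= sub0r normrN Ex_ind //.
exact: le_trans (ler_norm _).
Qed.

End Orthogonality.

(** * Versions of conditional probabilities and mean conditional variances *)

Section ConditionalProbability.
Context (R : realType) (d : measure_display) (Om : measurableType d).
Variable P : probability Om R.
Context (dX : measure_display) (TX : measurableType dX).
Variable X : Om -> TX.
Hypothesis mX : measurable_fun setT X.
Local Notation Ex := (Ex P).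
Local Notation bm := (@bm R d Om).

Lemma measurable_preim (C : set TX) : measurable C -> measurable (X @^-1` C).
Proof. by move=> mC; rewrite -[X in measurable X]setTI; exact: mX. Qed.
#[local] Hint Resolve measurable_preim : core.

Lemma bm_comp (g : TX -> R) : measurable_fun setT g ->
  (exists M, forall x, `|g x| <= M) -> bm (fun w => g (X w)).
Proof.
move=> mg [M gM]; split; first exact: (measurableT_comp mg mX).
by exists M => w.
Qed.

Lemma ortho_preim (e : Om -> R) : bm e ->
  (forall C, measurable C -> Ex (fun w => e w * \1_(X @^-1` C) w) = 0) ->
  forall g : TX -> R, measurable_fun setT g -> (exists M, forall x, `|g x| <= M) ->
  Ex (fun w => e w * g (X w)) = 0.
Proof.
move=> be eC g mg [M gM].
pose G := [set X @^-1` C | C in @measurable _ TX].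
apply: (ortho be (G := G)).
- by move=> _ [C mC <-]; exact: measurable_preim.
- by move=> _ _ [C mC <-] [D mD <-]; exists (C `&` D) => //; exact: measurableI.
- by exists setT.
- by move=> _ [C mC <-]; exact: eC.
- move=> _ B mB; rewrite setTI; apply: sub_sigma_algebra.
  by exists (g @^-1` B) => //; rewrite -[X in measurable X]setTI; exact: mg.
- by exists M => w.
Qed.

(** The measurability proofs are arguments so that the measure structure can be attached to the term
    itself. The measure serves twice: for Radon-Nikodym and for uniqueness of laws on a product. *)
Definition slice_law (E : set Om) & measurable_fun setT X & measurable E : set TX -> \bar R :=
  fun C => P (E `&` X @^-1` C).

Section Slice.
Variables (E : set Om) (mE : measurable E).
Local Notation nu := (slice_law mX mE).

Let nu0 : nu set0 = 0%E.
Proof. by rewrite /slice_law preimage_set0 setI0 measure0. Qed.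

Let nu_ge0 A : (0 <= nu A)%E. Proof. exact: measure_ge0. Qed.

Let nu_semi_sigma_additive : semi_sigma_additive nu.
Proof.
move=> F mF tF mUF; rewrite /slice_law preimage_bigcup setI_bigcupr.
apply: measure_semi_sigma_additive.
- by move=> n; apply: measurableI => //; exact: measurable_preim.
- apply/trivIsetP => /= i j _ _ ij; rewrite setIACA setIid -preimage_setI.
  by move/trivIsetP : tF => /(_ _ _ _ _ ij) ->//; rewrite preimage_set0 setI0.
- by apply: bigcup_measurable => n _; apply: measurableI => //; exact: measurable_preim.
Qed.

HB.instance Definition _ := isMeasure.Build _ _ _
  nu nu0 nu_ge0 nu_semi_sigma_additive.

Let nu_fin : fin_num_fun nu.
Proof.
move=> U mU; rewrite ge0_fin_numE ?measure_ge0//.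
apply: le_lt_trans (ltry 1); apply: probability_le1.
by apply: measurableI => //; exact: measurable_preim.
Qed.

HB.instance Definition _ := Measure_isFinite.Build _ _ _ nu nu_fin.

End Slice.

(** [cond_prob_version] recast as orthogonality of the residual to the events of [X], the form to
    which [ortho_preim] applies. *)
Definition is_ver (E : set Om) (p : TX -> R) :=
  [/\ measurable_fun setT p, (forall x, 0 <= p x <= 1) &
    forall C, measurable C ->
    Ex (fun w => (\1_E w - p (X w)) * \1_(X @^-1` C) w) = 0].

Lemma ver_bdd p : (forall x, 0 <= p x <= 1) -> exists M : R, forall x : TX, `|p x| <= M.
Proof. by move=> p01; exists 1 => x; have /andP[? ?] := p01 x; rewrite ger0_norm. Qed.

Lemma ver_bm E p : is_ver E p -> bm (fun w => p (X w)).
Proof. by move=> [mp p01 _]; apply: bm_comp => //; exact: ver_bdd. Qed.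

Lemma Ex_indI (A B : set Om) : measurable A -> measurable B ->
  (Ex (fun w => \1_A w * \1_B w))%:E = P (A `&` B).
Proof.
move=> mA mB; have mAB : measurable (A `&` B) by exact: measurableI.
have -> : (fun w => \1_A w * \1_B w) = \1_(A `&` B) :> (Om -> R).
  by rewrite indicI.
rewrite Ex_ind // fineK //; exact: fin_num_measure.
Qed.

Lemma is_verE E p : measurable E -> cond_prob_version P X E p <-> is_ver E p.
Proof.
move=> mE; split => [[mp p01 pC]|vp].
  have bp : bm (fun w => p (X w)) by apply: bm_comp => //; exact: ver_bdd.
  split => // C mC; have mXC := measurable_preim mC.
  have := pC C mC; rewrite Ex_restr // -Ex_indI // => h'.
  have h := EFin_inj h'.
  have -> : (fun w => (\1_E w - p (X w)) * \1_(X @^-1` C) w) =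
     (fun w => \1_E w * \1_(X @^-1` C) w - p (X w) * \1_(X @^-1` C) w).
    by apply/funext => w; rewrite mulrBl.
  by rewrite ExB ?h ?subrr //; apply: bmM => //; exact: bm_ind.
have bp := ver_bm vp; case: (vp) => mp p01 pC; split => // C mC.
have mXC := measurable_preim mC.
rewrite Ex_restr // -Ex_indI //; congr EFin; apply/eqP; rewrite -subr_eq0.
rewrite -ExB; try by apply: bmM => //; exact: bm_ind.
rewrite -[X in _ == X](pC C mC); apply/eqP; congr Ex.
by apply/funext => w; rewrite mulrBl.
Qed.

(** The version is the Radon-Nikodym density of [slice_law] with respect to the law of [X], cut at
    1. *)
Lemma ver_exists (E : set Om) : measurable E -> exists p, is_ver E p.
Proof.
move=> mE.
pose X' : {mfun Om >-> TX} := HB.pack X (isMeasurableFun.Build _ _ _ _ _ mX).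
pose mu := distribution P X'.
have numu : slice_law mX mE `<< mu.
  apply/null_content_dominatesP => C mC; rewrite /= /mu /distribution /pushforward => PC.
  apply/eqP; rewrite eq_le measure_ge0 andbT /slice_law -PC; apply: le_measure; rewrite ?inE.
  - by apply: measurableI => //; exact: measurable_preim.
  - exact: measurable_preim.
  - exact: subIsetr.
have [f [f0 ffin /integrableP[mf _] fE]] := radon_nikodym_sigma_finite numu.
pose q x := fine (f x).
have mq : measurable_fun setT q by exact: measurableT_comp.
have q0 x : 0 <= q x by rewrite fine_ge0.
have qE C : measurable C -> P (E `&` X @^-1` C) = (\int[P]_(w in X @^-1` C) (q (X w))%:E)%E.
  move=> mC; have := fE C mC; rewrite /= /slice_law => ->.
  rewrite ge0_integral_pushforward //; last exact: measurable_funTS.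
  by apply: eq_integral => w _ /=; rewrite fineK.
pose C1 := [set x | 1 < q x].
have mC1 : measurable C1.
  rewrite (_ : C1 = q @^-1` `]1, +oo[); first by rewrite -[X in measurable X]setTI; exact: mq.
  by apply/seteqP; split => x /=; rewrite in_itv /= andbT.
have mXC1 := measurable_preim mC1.
have mqX : measurable_fun setT (q \o X) by exact: measurableT_comp.
(* On [C1] the density exceeds 1, yet its integral there is at most the probability of [X] being in
   [C1]. Hence [q - 1], positive on [C1], has integral zero there, and the cut at 1 changes nothing
   almost surely. *)
have PC1 : P (X @^-1` C1) = 0%E.
  pose h w := (q (X w) - 1)%:E.
  have mh : measurable_fun setT h.
    by apply/measurable_EFinP; apply: measurable_funB.
  have h0 : forall w, (X @^-1` C1) w -> (0 <= h w)%E.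
    by move=> w; rewrite /= /C1 /= lee_fin subr_ge0 => /ltW.
  have Ih : (\int[P]_(w in X @^-1` C1) h w = 0)%E.
    apply/eqP; rewrite eq_le integral_ge0 // andbT.
    have : (\int[P]_(w in X @^-1` C1) (h w + 1%:E) <= P (X @^-1` C1))%E.
      have -> : (\int[P]_(w in X @^-1` C1) (h w + 1%:E))%E = P (E `&` X @^-1` C1).
        by rewrite qE //; apply: eq_integral => w _; rewrite /h -EFinD subrK.
      by apply: le_measure; rewrite ?inE //; exact: measurableI.
    rewrite ge0_integralD //; last exact: measurable_funTS.
    rewrite integral_cst // mul1e -[X in (_ <= X)%E]add0e leeD2rE //.
    exact: fin_num_measure.
  have : ae_eq P (X @^-1` C1) h (cst 0%E).
    apply/ae_eq_integral_abs => //; first exact: measurable_funTS.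
    by rewrite -[RHS]Ih; apply: eq_integral => w /[!inE] wC; rewrite gee0_abs // h0.
  move=> ae0; apply/negligibleP => //; move: ae0; apply: negligibleS => w wC /= hw.
  by have [] := hw wC; have : 1 < q (X w) := wC; lra.
exists (fun x => Num.min (q x) 1); apply/is_verE => //; split.
- exact: measurable_minr.
- by move=> x; rewrite le_min q0 ler01 /= ge_min lexx orbT.
move=> C mC; rewrite qE //; apply: ae_eq_integral => //.
- exact: measurable_preim.
- by apply: measurable_funTS; apply/measurable_EFinP.
- by apply: measurable_funTS; apply/measurable_EFinP; exact: measurable_minr.
exists (X @^-1` C1); split => // w /= /not_implyP[_ h].
by apply: contrapT => /negP; rewrite -leNgt => q1; apply: h; rewrite min_l.
Qed.

Lemma ver_ortho E p (g : TX -> R) : measurable E -> is_ver E p ->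
  measurable_fun setT g -> (exists M, forall x, `|g x| <= M) ->
  Ex (fun w => (\1_E w - p (X w)) * g (X w)) = 0.
Proof.
move=> mE vp; apply: ortho_preim; last by case: vp.
by apply: bmB; [exact: bm_ind|exact: ver_bm vp].
Qed.

Lemma ver_orthoE E p (g : TX -> R) : measurable E -> is_ver E p ->
  measurable_fun setT g -> (exists M, forall x, `|g x| <= M) ->
  Ex (fun w => \1_E w * g (X w)) = Ex (fun w => p (X w) * g (X w)).
Proof.
move=> mE vp mg Mg; apply/eqP; rewrite -subr_eq0 -ExB.
- rewrite -[X in _ == X](ver_ortho mE vp mg Mg); apply/eqP; congr Ex.
  by apply/funext => w; rewrite mulrBl.
- by apply: bmM; [exact: bm_ind|exact: bm_comp].
- by apply: bmM; [exact: ver_bm vp|exact: bm_comp].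
Qed.

(* For [p] a version of [P (E | X)], the mean conditional variance of [\1_E]. *)
Definition cvar (E : set Om) (p : TX -> R) := Ex (fun w => (\1_E w - p (X w)) ^+ 2).

Lemma cvarE E p : measurable E -> is_ver E p ->
  cvar E p = Ex \1_E - Ex (fun w => p (X w) ^+ 2).
Proof.
move=> mE vp; have bp := ver_bm vp; have bE := bm_ind mE.
have [mp p01 _] := vp.
have := ver_ortho mE vp mp (ver_bdd p01) => h0.
rewrite -ExB; [|exact: bm_ind|exact: bmX].
transitivity (Ex (fun w => (\1_E w - p (X w) ^+ 2) - 2 * ((\1_E w - p (X w)) * p (X w)))).
  congr Ex; apply/funext => w; rewrite indicE.
  by case: (w \in E) => /=; ring.
have bX : bm (fun w => (\1_E w - p (X w)) * p (X w)) by apply: bmM => //; exact: bmB.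
have b2 : bm (fun w => \1_E w - p (X w) ^+ 2) by apply: bmB => //; exact: bmX.
by rewrite (ExB P b2 (bmM (bm_cst 2) bX)) (ExZ P 2 bX) h0 mulr0 subr0.
Qed.

(** Both mean squares equal the mixed moment of [p (X)] and [p' (X)], found by testing each version
    against itself and against the other. *)
Lemma cvar_uniq E p p' : measurable E -> is_ver E p -> is_ver E p' ->
  cvar E p = cvar E p'.
Proof.
move=> mE vp vp'; rewrite !cvarE //; congr (_ - _).
have [mp p01 _] := vp; have [mp' p01' _] := vp'.
have h1 := ver_orthoE mE vp mp' (ver_bdd p01').
have h2 := ver_orthoE mE vp' mp (ver_bdd p01).
have h3 := ver_orthoE mE vp mp (ver_bdd p01).
have h4 := ver_orthoE mE vp' mp' (ver_bdd p01').
have c12 : Ex (fun w => p (X w) * p' (X w)) = Ex (fun w => p' (X w) * p (X w)).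
  by congr Ex; apply/funext => w; rewrite mulrC.
have e1 : Ex (fun w => p (X w) ^+ 2) = Ex (fun w => p (X w) * p (X w)).
  by congr Ex; apply/funext => w; rewrite expr2.
have e2 : Ex (fun w => p' (X w) ^+ 2) = Ex (fun w => p' (X w) * p' (X w)).
  by congr Ex; apply/funext => w; rewrite expr2.
by rewrite e1 e2 -h3 h2 -c12 -h1 h4.
Qed.

End ConditionalProbability.

(** * Almost sure convergence to zero *)

Section AlmostSure.
Context (R : realType) (d : measure_display) (Om : measurableType d).
Variable P : probability Om R.
Local Notation Ex := (Ex P).
Local Notation bm := (@bm R d Om).
Implicit Types u v : nat -> Om -> R.

(** The null set may depend on [e], so comparison and approximation work one [e] at a time;
    [as0_cvg] merges the null sets over [e = 1 / k.+1]. *)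
Definition as0 u := forall e : R, 0 < e ->
  {ae P, forall w, \forall n \near \oo, `|u n w| <= e}.

Lemma as0_le v u : (forall n w, `|u n w| <= `|v n w|) -> as0 v -> as0 u.
Proof.
move=> uv v0 e e0; apply: filterS (v0 e e0) => w; apply: filterS => n.
exact: le_trans.
Qed.

Lemma as0_approx u : (forall e : R, 0 < e -> exists2 v, as0 v &
  forall n w, `|u n w| <= `|v n w| + e) -> as0 u.
Proof.
move=> h e e0; have e2 : 0 < e / 2 by rewrite divr_gt0.
have [v v0 uv] := h _ e2; apply: filterS (v0 _ e2) => w; apply: filterS => n ve.
by apply: le_trans (uv n w) _; lra.
Qed.

Lemma as0D u v : as0 u -> as0 v -> as0 (fun n w => u n w + v n w).
Proof.
move=> u0 v0 e e0; have e2 : 0 < e / 2 by rewrite divr_gt0.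
apply: filterS2 (u0 _ e2) (v0 _ e2) => w; apply: filterS2 => n ue ve.
by apply: le_trans (ler_normD _ _) _; lra.
Qed.

Lemma as0_cst0 : as0 (fun _ _ => 0).
Proof. by move=> e e0; apply: aeW => w; apply: nearW => n; rewrite normr0 ltW. Qed.

Lemma as0Z (r : R) u : as0 u -> as0 (fun n w => r * u n w).
Proof.
move=> u0 e e0; have r1 : 0 < `|r| + 1 by have := normr_ge0 r; lra.
have e2 : 0 < e / (`|r| + 1) by rewrite divr_gt0.
apply: filterS (u0 _ e2) => w; apply: filterS => n; rewrite normrM ler_pdivlMr //.
by have := normr_ge0 (u n w); nra.
Qed.

Lemma as0_sum (I : Type) (r : seq I) (u : I -> nat -> Om -> R) :
  (forall i, as0 (u i)) -> as0 (fun n w => \sum_(i <- r) u i n w).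
Proof.
move=> u0; elim: r => [|i r IH].
  by apply: as0_le as0_cst0 => n w; rewrite big_nil.
by apply: as0_le (as0D (u0 i) IH) => n w; rewrite big_cons.
Qed.

Lemma as0_inv (C : R) : as0 (fun n _ => C / n%:R).
Proof.
move=> e e0; apply: aeW => w.
exists (Num.truncn (`|C| / e)).+1 => // n /= hn.
have Cn : `|C| / e < n%:R.
  apply: lt_le_trans (_ : (Num.truncn (`|C| / e)).+1%:R <= n%:R); last by rewrite ler_nat.
  by rewrite truncnS_gt.
have n0 : 0 < n%:R :> R by apply: le_lt_trans Cn; rewrite divr_ge0 // ltW.
rewrite normrM normfV [`|n%:R|]gtr0_norm // ler_pdivrMr //.
by move: Cn; rewrite ltr_pdivrMr // mulrC => /ltW.
Qed.

Lemma as0_cvg u : as0 u -> {ae P, forall w, u n w @[n --> \oo] --> (0 : R)}.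
Proof.
move=> u0.
have : {ae P, forall w, forall k : nat, \forall n \near \oo, `|u n w| <= k.+1%:R^-1}.
  by apply: ae_foralln => k; apply: u0.
apply: filterS => w h; apply/cvgrPdist_le => e e0.
have [k /ltW hk] := ltr_add_invr (y:=0) (x:=e) e0.
by apply: filterS (h k) => n; rewrite sub0r normrN => /le_trans; apply; rewrite add0r in hk.
Qed.

Lemma Ex_markov2 (f : Om -> R) (a : R) : bm f -> 0 < a ->
  (P [set w | (a <= `|f w|)%R] <= (a ^- 2 * Ex (fun w => f w ^+ 2))%:E)%E.
Proof.
move=> bf a0.
have mA : measurable [set w | a <= `|f w|].
  rewrite (_ : [set _ | _] = (fun w => `|f w|) @^-1` `[a, +oo[).
    by rewrite -[X in measurable X]setTI; apply: (bm_norm bf).1.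
  by apply/seteqP; split => w /=; rewrite in_itv /= andbT.
have -> : P [set w | (a <= `|f w|)%R] = (Ex \1_[set w | a <= `|f w|])%:E.
  by rewrite Ex_ind // fineK //; exact: fin_num_measure.
have b2 := bmX 2 bf.
rewrite lee_fin -(ExZ P (a ^- 2) b2); apply: Ex_le => [||w]; first exact: bm_ind.
  exact: bmM (bm_cst _) b2.
rewrite indicE; case: (boolP (w \in _)) => [|_].
  rewrite inE /= => h; rewrite mulr1n mulrC ler_pdivlMr ?exprn_gt0 // mul1r.
  by rewrite -[leRHS]real_normK ?num_real // ler_sqr ?nnegrE // ltW.
by rewrite mulr_ge0 ?sqr_ge0 // invr_ge0 sqr_ge0.
Qed.

Lemma Borel_Cantelli_as (F : nat -> set Om) (D : R) :
  (forall k, measurable (F k)) ->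
  (forall k, (P (F k) <= (D / (k.+1%:R ^+ 2))%:E)%E) ->
  {ae P, forall w, \forall k \near \oo, ~ F k w}.
Proof.
move=> mF PF.
have D0 : 0 <= D.
  by have := le_trans (measure_ge0 P _) (PF 0%N); rewrite lee_fin expr1n divr1.
(* Telescoping bound, from [1 / k ^ 2 <= 2 (1 / k - 1 / (k + 1))] for [k >= 1]. *)
have S n : (\sum_(0 <= k < n) P (F k) <= (D * 2 * (1 - n.+1%:R^-1))%:E)%E.
  elim: n => [|n IH]; first by rewrite big_geq // invr1 subrr mulr0.
  rewrite big_nat_recr //=; apply: le_trans (leeD IH (PF n)) _.
  rewrite -EFinD lee_fin -!mulrA -mulrDr ler_wpM2l //.
  have a0 : 0 < n.+1%:R^-1 :> R by rewrite invr_gt0 ltr0n.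
  have b0 : 0 < n.+2%:R^-1 :> R by rewrite invr_gt0 ltr0n.
  have : n.+2%:R^-1 * (n.+1%:R + 1) = 1 :> R by rewrite natr1 mulVf // pnatr_eq0.
  have : n.+1%:R^-1 * n.+1%:R = 1 :> R by rewrite mulVf // pnatr_eq0.
  have n1 : 1 <= n.+1%:R :> R by rewrite ler1n.
  rewrite -exprVn; move: a0 b0 n1; set x := (n.+1%:R^-1 : R); set y := (n.+2%:R^-1 : R).
  set t := (n.+1%:R : R) => x0 y0 t1 xt yt.
  have xy : x = y + x * y by rewrite -[in LHS](mulr1 x) -yt; nra.
  have x1 : x <= 1 by nra.
  have yx : y * x <= y * 1 by rewrite ler_wpM2l // ltW.
  have x2 : x <= 2 * y by lra.
  have : x * x <= x * (2 * y) by rewrite ler_wpM2l // ltW.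
  by rewrite expr2; nra.
have : P (lim_sup_set F) = 0%E.
  apply: lim_sup_set_cvg0 => //; apply: (@le_lt_trans _ _ (D * 2)%:E); last exact: ltry.
  apply: lime_le; first by apply: is_cvg_nneseries.
  apply: nearW => n; apply: le_trans (S n) _; rewrite lee_fin.
  have : 0 <= n.+1%:R^-1 :> R by rewrite invr_ge0 ler0n.
  by move=> ?; rewrite ler_piMr ?mulr_ge0 //; lra.
move=> P0; exists (lim_sup_set F); split => //.
  by apply: bigcap_measurable => // n _; apply: bigcup_measurable.
move=> w /= h n _; apply: contrapT => hn; apply: h; exists n => // k /= nk Fk.
by apply: hn; exists k.
Qed.

Lemma nat_sqrt_bounds n : exists k, (k ^ 2 <= n < k.+1 ^ 2)%N.
Proof.
elim: n => [|n [k /andP[h1 h2]]]; first by exists 0%N.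
have [h3|h3] := leqP (k.+1 ^ 2) n.+1; last first.
  by exists k; rewrite h3 andbT (leq_trans h1).
exists k.+1; rewrite h3 /=; apply: leq_ltn_trans h2 _.
by rewrite ltn_sqr.
Qed.

(* Along the squares the variance bound is summable; in between, [T] moves by
   at most [C] at each step. *)
Lemma as0_second_moment (T : nat -> Om -> R) (C : R) :
  (forall n, bm (T n)) ->
  (forall n, Ex (fun w => T n w ^+ 2) <= C * n%:R) ->
  (forall n w, `|T n.+1 w - T n w| <= C) ->
  as0 (fun n w => T n w / n%:R).
Proof.
move=> bT VT dT e e0.
have C0 : 0 <= C by exact: le_trans (dT 0%N point).
pose F k := [set w | e / 2 * k.+1%:R ^+ 2 <= `|T (k.+1 ^ 2)%N w|].
have k0 k : 0 < k.+1%:R :> R by rewrite ltr0n.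
have a0 k : 0 < e / 2 * k.+1%:R ^+ 2 by rewrite mulr_gt0 ?divr_gt0 ?exprn_gt0.
have mF k : measurable (F k).
  rewrite (_ : F k = (fun w => `|T (k.+1 ^ 2)%N w|) @^-1` `[e / 2 * k.+1%:R ^+ 2, +oo[).
    by rewrite -[X in measurable X]setTI; apply: (bm_norm (bT _)).1.
  by apply/seteqP; split => w /=; rewrite in_itv /= andbT.
(* Chebyshev at the square [k.+1 ^ 2]: the second moment is at most [C] times the square and the
   threshold is [e / 2] times it, which leaves a summable bound of order [1 / k.+1 ^ 2]. *)
have PF k : (P (F k) <= (C * 4 * e ^- 2 / (k.+1%:R ^+ 2))%:E)%E.
  apply: (le_trans (Ex_markov2 (bT _) (a0 k))); rewrite lee_fin.
  apply: (@le_trans _ _ ((e / 2 * k.+1%:R ^+ 2) ^- 2 * (C * (k.+1 ^ 2)%:R))).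
    by apply: ler_wpM2l (VT _); rewrite invr_ge0 sqr_ge0.
  rewrite natrX le_eqVlt; apply/orP; left; apply/eqP.
  by field; rewrite !gt_eqF // k0.
apply: filterS (Borel_Cantelli_as mF PF) => w [N _ hN].
(* From the square [k.+1 ^ 2] to [n] there are at most [3 k.+1] steps of size [C]; once
   [k.+1 > 6 C / e] they cost at most [e / 2] times the square, the other half of the tolerance. *)
have [K hK] : exists K : nat, 6 * C / e < K%:R.
  by exists (Num.truncn (6 * C / e)).+1; rewrite truncnS_gt.
exists ((maxn N K).+1 ^ 2)%N => // n /= hn.
have [k /andP[h1 h2]] := nat_sqrt_bounds n.
have kNK : (maxn N K < k)%N.
  have := leq_ltn_trans hn h2; rewrite ltn_sqr; exact.
case: k kNK h1 h2 => // k kNK h1 h2.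
have Nk : (N <= k)%N by move: kNK; rewrite ltnS geq_max => /andP[].
have Kk : (K <= k.+1)%N by apply: leqW; move: kNK; rewrite ltnS geq_max => /andP[].
have := hN k Nk; rewrite /F /= => /negP; rewrite -ltNge => hT.
have step m : `|T (k.+1 ^ 2 + m)%N w - T (k.+1 ^ 2)%N w| <= C * m%:R.
  elim: m => [|m IH]; first by rewrite addn0 subrr normr0 mulr0.
  rewrite addnS -natr1 mulrDr mulr1.
  have := dT (k.+1 ^ 2 + m)%N w.
  set x := T _.+1 w; set y := T (_ + m)%N w in IH *; set z := T (k.+1 ^ 2)%N w in IH *.
  move=> xy; have -> : x - z = (x - y) + (y - z) by ring.
  by apply: le_trans (ler_normD _ _) _; lra.
have := step (n - k.+1 ^ 2)%N; rewrite subnKC // => hs.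
have mk : (n - k.+1 ^ 2)%:R <= 3 * k.+1%:R :> R.
  rewrite -natrM ler_nat leq_subLR; apply: leq_trans (ltnW h2) _.
  rewrite -!mulnn; nia.
have nk : k.+1%:R ^+ 2 <= n%:R :> R by rewrite -natrX ler_nat.
have n0 : 0 < n%:R :> R by apply: lt_le_trans nk; rewrite exprn_gt0.
have Kk' : 6 * C / e < k.+1%:R by apply: lt_le_trans hK _; rewrite ler_nat.
rewrite normrM normfV [`|n%:R|]gtr0_norm // ler_pdivrMr //.
have -> : T n w = (T n w - T (k.+1 ^ 2)%N w) + T (k.+1 ^ 2)%N w by ring.
apply: le_trans (ler_normD _ _) _.
move: Kk'; rewrite ltr_pdivrMr // => Kk'.
have := k0 k; set kk := k.+1%:R in hT mk nk Kk' *; set nn := n%:R in nk n0 *.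
set A := `|_ - _| in hs *; set B := `|_| in hT *; set m := _%:R in hs mk => kk0.
have : A <= C * (3 * kk) by apply: le_trans hs _; apply: ler_wpM2l.
by nra.
Qed.

End AlmostSure.

(** * Sums over consecutive samples *)

Section Adjacent.
Variable R : realType.
Implicit Types (M r c : R) (f : nat -> nat -> R) (g x u : nat -> R) (s : seq nat).

Definition adj f s : R :=
  \sum_(k < (size s).-1) f (nth 0%N s k) (nth 0%N s k.+1).

Lemma adj_cons2 f (a b : nat) s : adj f (a :: b :: s) = f a b + adj f (b :: s).
Proof. by rewrite /adj /= big_ord_recl. Qed.

Lemma adj1 f a : adj f [:: a] = 0. Proof. by rewrite /adj big_ord0. Qed.

(** One insertion creates at most two adjacent pairs and destroys at most one. This provides the
    bounded increments in the sample size. *)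
Lemma adj_insert f M a i b : (forall j k, `|f j k| <= M) ->
  `|adj f (a ++ i :: b) - adj f (a ++ b)| <= 3 * M.
Proof.
move=> fM; have M0 : 0 <= M by exact: le_trans (fM 0%N 0%N).
elim: a => [|e [|e1 a] IH] /=.
- case: b => [|j b]; first by rewrite adj1 /adj big_ord0 subrr normr0 mulr_ge0.
  by rewrite adj_cons2 addrK; apply: le_trans (fM _ _) _; lra.
- case: b {IH} => [|j b].
    by rewrite adj_cons2 !adj1 addr0 subr0; apply: le_trans (fM _ _) _; lra.
  rewrite !adj_cons2.
  rewrite (_ : _ - _ = f e i + f i j - f e j); last by ring.
  apply: le_trans (ler_normB _ _) _; apply: le_trans (lerD (ler_normD _ _) (lexx _)) _.
  by have := fM e i; have := fM i j; have := fM e j; lra.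
- by rewrite !adj_cons2 opprD addrACA subrr add0r.
Qed.

Lemma le_adj f f' s : (forall i j, f i j <= f' i j) -> adj f s <= adj f' s.
Proof. by move=> ff'; apply: ler_sum. Qed.

Lemma eq_adj f f' s : (forall i j, f i j = f' i j) -> adj f s = adj f' s.
Proof. by move=> ff'; apply: eq_bigr. Qed.

Lemma adjD f f' s : adj (fun i j => f i j + f' i j) s = adj f s + adj f' s.
Proof. exact: big_split. Qed.

Lemma adjZ r f s : adj (fun i j => r * f i j) s = r * adj f s.
Proof. by rewrite /adj mulr_sumr. Qed.

Lemma adj_sum (I : Type) (r : seq I) (F : I -> nat -> nat -> R) s :
  adj (fun i j => \sum_(k <- r) F k i j) s = \sum_(k <- r) adj (F k) s.
Proof. by rewrite /adj exchange_big. Qed.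

Lemma adj_cst r s : 0 <= r -> adj (fun _ _ => r) s <= r * (size s)%:R.
Proof.
move=> r0; rewrite /adj sumr_const card_ord -[X in X <= _]mulr_natr.
by rewrite ler_wpM2l // ler_nat leq_pred.
Qed.

Lemma sum_seq_nth g s : \sum_(i <- s) g i = \sum_(k < size s) g (nth 0%N s k).
Proof. by rewrite (big_nth 0%N) big_mkord. Qed.

(** Each entry except the last is the left end of exactly one adjacent pair; the missing term is
    bounded by [M]. *)
Lemma adj_left g M s : (forall i, `|g i| <= M) ->
  `|adj (fun i _ => g i) s - \sum_(i <- s) g i| <= M.
Proof.
move=> gM; have M0 : 0 <= M by exact: le_trans (gM 0%N).
rewrite sum_seq_nth /adj; case: (size s) => [|n].
  by rewrite !big_ord0 subrr normr0.
by rewrite big_ord_recr /= opprD addrA subrr sub0r normrN.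
Qed.

Lemma adj_right g M s : (forall i, `|g i| <= M) ->
  `|adj (fun _ j => g j) s - \sum_(i <- s) g i| <= M.
Proof.
move=> gM; have M0 : 0 <= M by exact: le_trans (gM 0%N).
rewrite sum_seq_nth /adj; case: (size s) => [|n].
  by rewrite !big_ord0 subrr normr0.
by rewrite big_ord_recl /= [_ - _](_ : _ = - g (nth 0%N s 0)) ?normrN //; ring.
Qed.

(** The comparison written inside [xi_n], named so that [rank_seq] is convertible to the sorted list
    used there. *)
Definition key_le x u : rel nat :=
  fun i j => (x i < x j) || ((x i == x j) && (u i <= u j)).

Definition rank_seq x u n := sort (key_le x u) (iota 0 n).

Lemma key_le_total x u : total (key_le x u).
Proof. by move=> i j; rewrite /key_le; case: ltgtP => //= _; exact: le_total. Qed.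

Lemma key_le_trans x u : transitive (key_le x u).
Proof.
move=> j i k; rewrite /key_le => /orP[ij|/andP[/eqP <- ij]] /orP[jk|/andP[/eqP jk uk]].
- by rewrite (lt_trans ij jk).
- by rewrite -jk ij.
- by rewrite jk.
- by rewrite jk ltxx eqxx (le_trans ij uk).
Qed.

Lemma size_rank_seq x u n : size (rank_seq x u n) = n.
Proof. by rewrite size_sort size_iota. Qed.

Lemma rank_seq_uniq x u n : uniq (rank_seq x u n).
Proof. by rewrite sort_uniq iota_uniq. Qed.

Lemma mem_rank_seq x u n i : (i \in rank_seq x u n) = (i < n)%N.
Proof. by rewrite mem_sort mem_iota. Qed.

Lemma rank_seq_nth_lt x u n k : (k < n)%N -> (nth 0%N (rank_seq x u n) k < n)%N.
Proof. by move=> kn; rewrite -(mem_rank_seq x u) mem_nth // size_rank_seq. Qed.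

Lemma sum_rank_seq x u n g : \sum_(i <- rank_seq x u n) g i = \sum_(i < n) g i.
Proof.
rewrite (perm_big (iota 0 n)) /=; last by rewrite /rank_seq perm_sort.
by rewrite -(big_mkord xpredT) /index_iota subn0.
Qed.

(** Sorting by a total transitive relation commutes with filtering, so deleting [n] from the ranking
    of [n.+1] indices leaves the ranking of the first [n]. *)
Lemma rank_seqS x u n : exists a b,
  rank_seq x u n.+1 = a ++ n :: b /\ rank_seq x u n = a ++ b.
Proof.
have nin : n \in rank_seq x u n.+1 by rewrite mem_rank_seq.
have un := rank_seq_uniq x u n.+1.
have fs : [seq i <- rank_seq x u n.+1 | i != n] = rank_seq x u n.
  rewrite /rank_seq filter_sort; [|exact: key_le_total|exact: key_le_trans].
  congr sort; rewrite -addn1 iotaD filter_cat /= add0n eqxx /= cats0.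
  apply/all_filterP/allP => i; rewrite mem_iota add0n /= => ilt.
  by rewrite neq_ltn ilt.
move: fs un; case/splitPr: nin => a b fs; rewrite cat_uniq /= => /and4P[_ na nb _].
exists a, b; split => //; rewrite -fs filter_cat /= eqxx /=; congr (_ ++ _).
- apply/all_filterP/allP => i ia /=; apply: contraNneq na => <-.
  by rewrite ia.
- by apply/all_filterP/allP => i ib /=; apply: contraNneq nb => <-.
Qed.

Lemma adj_rank_seq_step x u n f M : (forall j k, `|f j k| <= M) ->
  `|adj f (rank_seq x u n.+1) - adj f (rank_seq x u n)| <= 3 * M.
Proof. by move=> fM; have [a [b [-> ->]]] := rank_seqS x u n; exact: adj_insert. Qed.

(* Along the sorted sample, a half-line indicator jumps at most once. *)
Lemma adj_half_line x u n c :
  adj (fun i j => `|(x i <= c)%R%:R - (x j <= c)%R%:R|) (rank_seq x u n) <= 1.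
Proof.
have /(sortedP 0%N) := sort_sorted (@key_le_total x u) (iota 0 n).
rewrite -/(rank_seq x u n); set s := rank_seq x u n => ss.
pose b k : R := (x (nth 0%N s k) <= c)%R%:R.
rewrite /adj.
have -> : \sum_(k < (size s).-1) `|(x (nth 0%N s k) <= c)%R%:R
     - (x (nth 0%N s k.+1) <= c)%R%:R| = \sum_(0 <= k < (size s).-1) (b k - b k.+1) :> R.
  rewrite big_mkord; apply: eq_bigr => k _; rewrite -/(b k) -/(b k.+1) ger0_norm //.
  have : (k.+1 < size s)%N by have := ltn_ord k; lia.
  move=> /ss; rewrite subr_ge0 /b /key_le => xx; rewrite ler_nat.
  have {}xx : x (nth 0%N s k) <= x (nth 0%N s k.+1).
    by case/orP: xx => [/ltW //|/andP[/eqP ->]].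
  by case: (leP (x (nth 0%N s k.+1)) c) => // h; rewrite (le_trans xx h).
rewrite -[X in X <= _]opprK -sumrN; under eq_bigr do rewrite opprB.
rewrite telescope_sumr // opprB /b.
by case: (_ <= c); case: (_ <= c) => //=; lra.
Qed.

Definition consecutive s i j := index j s == (index i s).+1.

(** Exchanges random positions for fixed index pairs with random 0-1 weights, each weight a function
    of the ranking alone; expectations can then be taken pair by pair. *)
Lemma adj_consecutive f x u n :
  adj f (rank_seq x u n) = \sum_(i < n) \sum_(j < n)
    (consecutive (rank_seq x u n) i j)%:R * f i j.
Proof.
set s := rank_seq x u n; have ss : size s = n by exact: size_rank_seq.
have us : uniq s by exact: rank_seq_uniq.
rewrite -(sum_rank_seq x u n (fun i => \sum_(j < n) (consecutive s i j)%:R * f i j)).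
rewrite -/s sum_seq_nth ss /adj ss.
under [RHS]eq_bigr => k _ do
  rewrite -(sum_rank_seq x u n (fun j => (consecutive s (nth 0%N s k) j)%:R * f _ j)) -/s sum_seq_nth ss.
case: n @s ss us => [|n] s ss us; first by rewrite !big_ord0.
rewrite [RHS]big_ord_recr /= [X in _ = _ + X]big1 ?addr0; last first.
  move=> l _; rewrite /consecutive !index_uniq ?ss //.
  by rewrite (ltn_eqF (ltn_ord l)) mul0r.
apply: eq_bigr => k _; rewrite (bigD1 (lift ord0 k)) //= big1 ?addr0.
  rewrite /consecutive !index_uniq ?ss //= ?ltnS ?(ltnW (ltn_ord k)) //.
  by rewrite eqxx mul1r.
move=> l lk; rewrite /consecutive !index_uniq ?ss //=; last first.
  exact: leq_trans (ltn_ord k) _.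
rewrite (_ : _ == _ = false) ?mul0r //; apply: contraNF lk => /eqP h.
by apply/eqP/val_inj; rewrite /= h.
Qed.

End Adjacent.

(** * Measurability of the ranking *)

Section RankSeqMeasurable.
Context (R : realType) (d : measure_display) (Om : measurableType d).

Lemma measurable_setb (b : Om -> bool) : measurable_fun setT b ->
  measurable [set w | b w].
Proof.
move=> mb; rewrite (_ : [set _ | _] = b @^-1` [set true]); last by apply/seteqP; split.
by rewrite -[X in measurable X]setTI; exact: mb.
Qed.

Lemma measurable_setbN (b : Om -> bool) : measurable_fun setT b ->
  measurable [set w | ~~ b w].
Proof.
move=> mb; rewrite (_ : [set _ | _] = ~` [set w | b w]); last first.
  by apply/seteqP; split => w /= /negP.
by apply: measurableC; exact: measurable_setb.
Qed.

Lemma measurable_key_le (x u : nat -> Om -> R) i j :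
  measurable_fun setT (x i) -> measurable_fun setT (x j) ->
  measurable_fun setT (u i) -> measurable_fun setT (u j) ->
  measurable_fun setT (fun w => key_le (x ^~ w) (u ^~ w) i j).
Proof.
move=> mxi mxj mui muj; rewrite /key_le.
apply: measurable_or; first exact: measurable_fun_ltr.
by apply: measurable_and; [exact: measurable_fun_eqr|exact: measurable_fun_ler].
Qed.

(** The ranking is a function [g] of the finite table of pairwise key comparisons, so the event is a
    finite union, over tables, of finite intersections of comparison events. [Om] may carry any
    sigma-algebra, in particular the one generated by [block_pi]. *)
Lemma measurable_rank_seq (x u : nat -> Om -> R) n (Q : seq nat -> bool) :
  (forall i, (i < n)%N -> measurable_fun setT (x i)) ->
  (forall i, (i < n)%N -> measurable_fun setT (u i)) ->
  measurable [set w | Q (rank_seq (x ^~ w) (u ^~ w) n)].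
Proof.
move=> mx mu.
pose key w : {ffun 'I_n * 'I_n -> bool} :=
  [ffun ij : 'I_n * 'I_n => key_le (x ^~ w) (u ^~ w) ij.1 ij.2].
pose g (K : {ffun 'I_n * 'I_n -> bool}) : seq nat :=
  map val (sort (fun i j => K (i, j)) (enum 'I_n)).
have gE w : rank_seq (x ^~ w) (u ^~ w) n = g (key w).
  rewrite /rank_seq -val_enum_ord sort_map /g; congr (map _ (sort _ _)).
  by apply/funext => i; apply/funext => j; rewrite ffunE.
have -> : [set w | Q (rank_seq (x ^~ w) (u ^~ w) n)] =
    \bigcup_(K in [set K | Q (g K)]) \bigcap_ij [set w | key w ij == K ij].
  apply/seteqP; split => w /=; rewrite gE; [move=> Qw|move=> [K QK wK]].
    by exists (key w) => // ij _ /=.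
  by rewrite (_ : key w = K) //; apply/ffunP => ij; exact/eqP/wK.
apply: fin_bigcup_measurable; first exact: finite_finset.
move=> K _; apply: fin_bigcap_measurable; first exact: finite_finset.
move=> -[i j] _.
have mk := measurable_key_le (mx i (ltn_ord i)) (mx j (ltn_ord j))
                             (mu i (ltn_ord i)) (mu j (ltn_ord j)).
case: (K (i, j)).
  rewrite (_ : [set _ | _] = [set w | key_le (x ^~ w) (u ^~ w) i j]).
    exact: measurable_setb mk.
  by apply/seteqP; split => w /=; rewrite ffunE /= eqb_id.
rewrite (_ : [set _ | _] = [set w | ~~ key_le (x ^~ w) (u ^~ w) i j]).
  exact: measurable_setbN mk.
by apply/seteqP; split => w /=; rewrite ffunE /= eqbF_neg.
Qed.

End RankSeqMeasurable.

(** * Residuals of the conditional expectation are orthogonal to the rest of the sample *)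

(** Interface met both by the predictor [X] with keys [U] and by the predictor [(X, Z)] with keys
    [V], so that the limit theorem is proved once for both. *)
Record sampling (R : realType) (d : measure_display) (Om : measurableType d)
    (P : probability Om R) (dX : measure_display) (TX : measurableType dX)
    (X : Om -> TX) (y : Om -> R)
    (xs : nat -> Om -> TX) (ys us : nat -> Om -> R) : Prop := Sampling {
  sampling_mX : measurable_fun setT X;
  sampling_my : measurable_fun setT y;
  sampling_mxs : forall i, measurable_fun setT (xs i);
  sampling_mys : forall i, measurable_fun setT (ys i);
  sampling_mus : forall i, measurable_fun setT (us i);
  sampling_indep : mutual_indep P (fun i w => (xs i w, (ys i w, us i w)));
  sampling_law : forall i (C : set TX) (B D : set R),
    measurable C -> measurable B -> measurable D ->
    P (xs i @^-1` C `&` ys i @^-1` B `&` us i @^-1` D) =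
    (P (X @^-1` C `&` y @^-1` B) * P (us i @^-1` D))%E }.

Section Sample.
Context (R : realType) (d : measure_display) (Om : measurableType d).
Variable P : probability Om R.
Context (dX : measure_display) (TX : measurableType dX).
Variables (X : Om -> TX) (y : Om -> R).
Variables (xs : nat -> Om -> TX) (ys us : nat -> Om -> R).
Hypothesis S : sampling P X y xs ys us.
Let mX := sampling_mX S.
Let my := sampling_my S.
Let mxs := sampling_mxs S.
Let mys := sampling_mys S.
Let mus := sampling_mus S.
Let indep := sampling_indep S.
Let law := sampling_law S.
Local Notation Ex := (Ex P).
Local Notation bm := (@bm R d Om).
Local Notation zs i := (fun w => (xs i w, (ys i w, us i w))).

Let mzs i : measurable_fun setT (zs i).
Proof. by apply: measurable_fun_pair => //; exact: measurable_fun_pair. Qed.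

Lemma Ex_indE A : measurable A -> P A = (Ex \1_A)%:E.
Proof. by move=> mA; rewrite Ex_ind // fineK //; exact: fin_num_measure. Qed.

(** Mutual independence for [a :: s], with the rectangle placed at index [a], splits off the block;
    the law of one observation then separates its key from its pair. *)
Lemma block_indep a s (A : nat -> set (TX * (R * R))) (C : set TX) (B D : set R) :
  uniq s -> a \notin s -> (forall i, measurable (A i)) ->
  measurable C -> measurable B -> measurable D ->
  P (xs a @^-1` C `&` ys a @^-1` B `&` us a @^-1` D `&`
     \bigcap_(i in [set` s]) (zs i @^-1` A i)) =
  (P (X @^-1` C `&` y @^-1` B) * (P (us a @^-1` D) *
   P (\bigcap_(i in [set` s]) (zs i @^-1` A i))))%E.
Proof.
move=> us_ as_ mA mC mB mD.
pose A' i := if i == a then C `*` (B `*` D) else A i.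
have mA' i : measurable (A' i).
  by rewrite /A'; case: ifP => // _; apply: measurableX => //; exact: measurableX.
have sA : \bigcap_(i in [set` s]) (zs i @^-1` A i) = \bigcap_(i in [set` s]) (zs i @^-1` A' i).
  apply: eq_bigcapr => i /= si; rewrite /A' ifF //.
  by apply: contraNF as_ => /eqP <-.
have := @indep (a :: s) A' _ mA'; rewrite /= as_ us_ => /(_ isT).
have -> : [set` a :: s] = a |` [set` s].
  apply/seteqP; split => i /=; first by rewrite inE => /predU1P[->|]; [left|right].
  by move=> [->|?]; rewrite inE ?eqxx //; apply/orP; right.
rewrite bigcap_setU1 big_cons -(indep us_ mA') -sA muleA -law //.
have -> : zs a @^-1` A' a = xs a @^-1` C `&` ys a @^-1` B `&` us a @^-1` D.
  rewrite /A' eqxx; apply/seteqP; split => w /=; first by move=> [? [? ?]].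
  by move=> [[? ?] ?].
by [].
Qed.

Lemma law_x i C : measurable C -> P (xs i @^-1` C) = P (X @^-1` C).
Proof.
move=> mC; have := @law i C setT setT mC measurableT measurableT.
by rewrite !preimage_setT !setIT probT mule1.
Qed.

Lemma law_y i B : measurable B -> P (ys i @^-1` B) = P (y @^-1` B).
Proof.
move=> mB; have := @law i setT B setT measurableT mB measurableT.
by rewrite !preimage_setT !setTI setIT probT mule1.
Qed.

Lemma Ex_same_law (g : TX -> R) i : measurable_fun setT g ->
  (exists M, forall x, `|g x| <= M) ->
  Ex (fun w => g (xs i w)) = Ex (fun w => g (X w)).
Proof.
move=> mg Mg; apply: EFin_inj.
have b1 := bm_comp (mxs i) mg Mg; have b2 := bm_comp mX mg Mg.
rewrite !Ex_EFin //.
have i1 := bm_int P b1; have i2 := bm_int P b2.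
have mEg : measurable_fun setT (EFin \o g) by exact/measurable_EFinP.
rewrite -(integral_pushforward (mxs i) mEg i1 measurableT).
rewrite -(integral_pushforward mX mEg i2 measurableT).
by apply: eq_measure_integral => C mC _; exact: law_x.
Qed.

Section Residual.
Variables (H : set R) (p : TX -> R).
Hypothesis mH : measurable H.
Hypothesis vp : is_ver P X (y @^-1` H) p.

Let mp : measurable_fun setT p. Proof. by case: vp. Qed.
Let p01 x : 0 <= p x <= 1. Proof. by case: vp. Qed.
Let bp := ver_bdd p01.

Definition resid i w : R := \1_(ys i @^-1` H) w - p (xs i w).

Lemma bm_resid i : bm (resid i).
Proof.
apply: bmB; last exact: bm_comp.
by apply: bm_ind; exact: measurable_preim.
Qed.

Lemma resid_le1 i w : `|resid i w| <= 1.
Proof.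
rewrite /resid indicE ler_norml; have /andP[? ?] := p01 (xs i w).
by case: (_ \in _) => /=; lra.
Qed.

Definition others (a n : nat) : seq nat := [seq i <- iota 0 n | i != a].

(** Pi-system for all that is known of the first [n] observations except [ys a]: predictor and key
    of [a], and the complete triples of the other indices. For [a < n] the ranking is measurable for
    it, and so are the other residuals. *)
Definition block_pi (a n : nat) : set (set Om) :=
  [set E | exists A C D, [/\ forall i, measurable (A i), measurable C, measurable D &
    E = xs a @^-1` C `&` us a @^-1` D `&`
        \bigcap_(i in [set` others a n]) (zs i @^-1` A i)]].

Lemma measurable_block a n : block_pi a n `<=` measurable.
Proof.
move=> _ [A [C [D [mA mC mD ->]]]]; apply: measurableI.
  by apply: measurableI; exact: measurable_preim.
by apply: fin_bigcap_measurable => // i _; exact: (measurable_preim (mzs i)).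
Qed.

Lemma block_setI a n : setI_closed (block_pi a n).
Proof.
move=> _ _ [A [C [D [mA mC mD ->]]]] [A' [C' [D' [mA' mC' mD' ->]]]].
exists (fun i => A i `&` A' i), (C `&` C'), (D `&` D'); split.
- by move=> i; exact: measurableI.
- exact: measurableI.
- exact: measurableI.
apply/seteqP; split => w /=.
  move=> [[[c e] h] [[c' e'] h']]; split => // i si; split; [exact: h|exact: h'].
by move=> [[[c c'] [e e']] h]; split; split => // i si; have [] := h i si.
Qed.

Lemma block_setT a n : block_pi a n setT.
Proof.
exists (fun=> setT), setT, setT; split => //.
by rewrite !preimage_setT !setTI bigcapT.
Qed.

(** On such an event the indicator of [ys a] in [H] and [p (xs a)] integrate to the same number: [k]
    times the mean of [p \1_C] at [X], where [k] multiplies the probabilities of the key event and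
    of the other blocks. *)
Lemma resid_block a n E : block_pi a n E -> Ex (fun w => resid a w * \1_E w) = 0.
Proof.
move=> bE; have mE := measurable_block bE.
case: bE => A [C [D [mA mC mD EE]]].
set J := \bigcap_(i in [set` others a n]) _ in EE.
have mJ : measurable J.
  by apply: fin_bigcap_measurable => // i _; exact: (measurable_preim (mzs i)).
have mDJ : measurable (us a @^-1` D `&` J).
  by apply: measurableI => //; exact: measurable_preim.
have uo : uniq (others a n) by rewrite filter_uniq // iota_uniq.
have ao : a \notin others a n by rewrite mem_filter eqxx.
pose k := Ex \1_(us a @^-1` D) * Ex \1_J.
have kE : (P (us a @^-1` D) * P J)%E = k%:E.
  by rewrite !Ex_indE //; exact: measurable_preim.
have mxa C' : measurable C' -> measurable (xs a @^-1` C') by exact: measurable_preim.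
have mya := measurable_preim (mys a) mH.
have myH := measurable_preim my mH.
(* The key of [a] and the other blocks are independent of [xs a]; [ortho_preim] extends this from
   indicators to the function [g] of [xs a]. *)
have xC C' : measurable C' ->
    Ex (fun w => (\1_(us a @^-1` D `&` J) w - k) * \1_(xs a @^-1` C') w) = 0.
  move=> mC'; have bD : bm (fun w => \1_(us a @^-1` D `&` J) w * \1_(xs a @^-1` C') w).
    by apply: bmM; apply: bm_ind => //; exact: mxa.
  have bk : bm (fun w => k * \1_(xs a @^-1` C') w).
    by apply: bmM; [exact: bm_cst|apply: bm_ind; exact: mxa].
  have -> : (fun w => (\1_(us a @^-1` D `&` J) w - k) * \1_(xs a @^-1` C') w) =
      (fun w => \1_(us a @^-1` D `&` J) w * \1_(xs a @^-1` C') w - k * \1_(xs a @^-1` C') w).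
    by apply/funext => w; rewrite mulrBl.
  rewrite ExB // ExZ; last by apply: bm_ind; exact: mxa.
  apply/eqP; rewrite subr_eq0; apply/eqP/EFin_inj.
  rewrite Ex_indI //; last exact: mxa.
  have -> : us a @^-1` D `&` J `&` xs a @^-1` C' =
            xs a @^-1` C' `&` ys a @^-1` setT `&` us a @^-1` D `&` J.
    by rewrite preimage_setT setIT setIC setIA.
  rewrite block_indep // preimage_setT setIT -/J kE -(law_x a) //.
  by rewrite [P (xs a @^-1` _)]Ex_indE ?EFinM 1?muleC //; exact: mxa.
pose g x := p x * \1_C x.
have mg : measurable_fun setT g by apply: measurable_funM => //; exact: measurable_indic.
have Mg : exists M, forall x, `|g x| <= M.
  exists 1 => x; rewrite /g normrM indicE; have /andP[p0 p1] := p01 x.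
  by rewrite ger0_norm //; case: (_ \in _); rewrite ?normr1 ?normr0 ?mulr1 ?mulr0.
have h2 : Ex (fun w => (\1_(us a @^-1` D `&` J) w - k) * g (xs a w)) = 0.
  apply: ortho_preim => //; apply: bmB; [exact: bm_ind|exact: bm_cst].
have bg : bm (fun w => g (xs a w)) by exact: bm_comp.
have bDJ := @bm_ind R _ _ _ mDJ.
have p2 : Ex (fun w => p (xs a w) * \1_E w) = k * Ex (fun w => g (X w)).
  rewrite -(Ex_same_law a mg Mg) -ExZ // -[LHS]subr0 -[in LHS]h2.
  apply/eqP; rewrite subr_eq -ExD; first last.
  - by apply: bmM => //; apply: bmB => //; exact: bm_cst.
  - by apply: bmM => //; exact: bm_cst.
  apply/eqP; congr Ex; apply/funext => w.
  rewrite EE -setIA indicI /g /=.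
  by rewrite (_ : \1_C (xs a w) = \1_(xs a @^-1` C) w) //; ring.
have p1 : Ex (fun w => \1_(ys a @^-1` H) w * \1_E w) = k * Ex (fun w => g (X w)).
  rewrite /g -(ver_orthoE mX myH vp (g := \1_C)).
  - apply: EFin_inj; rewrite Ex_indI // EFinM Ex_indI //; last exact: measurable_preim.
    rewrite -kE muleC [y @^-1` H `&` _]setIC -block_indep // EE.
    congr (P _); apply/seteqP; split => w /=; first by move=> [? [[? ?] ?]].
    by move=> [[[? ?] ?] ?].
  - exact: measurable_indic.
  - by exists 1 => x; rewrite indicE; case: (_ \in _); rewrite ?normr1 ?normr0.
have bE := @bm_ind R _ _ _ mE.
have -> : (fun w => resid a w * \1_E w) =
   (fun w => \1_(ys a @^-1` H) w * \1_E w - p (xs a w) * \1_E w).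
  by apply/funext => w; rewrite mulrBl.
rewrite ExB ?p1 ?p2 ?subrr //; apply: bmM => //; first exact: bm_ind.
exact: bm_comp.
Qed.

Lemma resid_ortho a n (F : Om -> R) :
  measurable_fun setT (F : g_sigma_algebraType (block_pi a n) -> R) ->
  (exists M, forall w, `|F w| <= M) ->
  Ex (fun w => resid a w * F w) = 0.
Proof.
apply: (ortho (bm_resid a)).
- exact: measurable_block.
- exact: block_setI.
- exact: block_setT.
- by move=> E; exact: resid_block.
Qed.

End Residual.
End Sample.

(** * The limit of the normalised oscillation of an indicator *)

Section Oscillation.
Context (R : realType) (d : measure_display) (Om : measurableType d).
Variable P : probability Om R.
Context (dX : measure_display) (TX : measurableType dX).
Variables (X : Om -> TX) (y : Om -> R).
Variables (xs : nat -> Om -> TX) (ys us : nat -> Om -> R).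
Hypothesis S : sampling P X y xs ys us.
Let mX := sampling_mX S.
Let my := sampling_my S.
Let mxs := sampling_mxs S.
Let mys := sampling_mys S.
Let mus := sampling_mus S.
Variable phi : TX -> R.
Hypothesis isophi : borel_iso phi.
Let mphi : measurable_fun setT phi. Proof. by case: isophi. Qed.
Local Notation Ex := (Ex P).
Local Notation bm := (@bm R d Om).
Local Notation as0 := (as0 P).
Local Notation zs i := (fun w => (xs i w, (ys i w, us i w))).
Local Notation block_pi := (block_pi xs ys us).

Let mzs i : measurable_fun setT (zs i).
Proof. by apply: measurable_fun_pair => //; exact: measurable_fun_pair. Qed.

(** Only the [n] diagonal terms survive in the second moment, each at most 1. *)
Lemma as0_uncorrelated (h : nat -> Om -> R) :
  (forall i, bm (h i)) -> (forall i w, `|h i w| <= 1) ->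
  (forall i j, i != j -> Ex (fun w => h i w * h j w) = 0) ->
  as0 (fun n w => (\sum_(i < n) h i w) / n%:R).
Proof.
move=> bh h1 hij.
have bhh i j : bm (fun w => h i w * h j w) by exact: bmM.
apply: (as0_second_moment (C := 1)) => [n|n|n w]; first exact: bm_sum.
  rewrite mul1r.
  rewrite [leLHS](_ : _ = Ex (fun w => \sum_(i < n) \sum_(j < n) h i w * h j w)).
    2: {
    congr Ex; apply/funext => w.
    by rewrite expr2 mulr_suml; apply: eq_bigr => i _; rewrite mulr_sumr. }
  rewrite Ex_sum; last by move=> i; exact: bm_sum.
  rewrite -[leRHS]mulr_natr mul1r -[leRHS]/(n%:R) -[X in _ <= X%:R]card_ord -sumr_const.
  apply: ler_sum => i _; rewrite Ex_sum // (bigD1 i) //= big1 ?addr0; last first.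
    by move=> j ji; apply: hij; rewrite eq_sym.
  rewrite -(Ex_cst P 1); apply: Ex_le => // [|w]; first exact: bm_cst.
  by rewrite -expr2 -real_normK ?num_real // expr_le1.
by rewrite big_ord_recr /= addrAC subrr add0r.
Qed.

(** Independence on sets makes the centred variables uncorrelated after two extensions from
    indicators to [f], one factor at a time ([step], then [c2]). *)
Lemma slln (f : TX * (R * R) -> R) (mu : R) : measurable_fun setT f ->
  (forall z, 0 <= f z <= 1) ->
  (forall i, Ex (fun w => f (zs i w)) = mu) ->
  as0 (fun n w => (\sum_(i < n) f (zs i w)) / n%:R - mu).
Proof.
move=> mf f01 Ef.
have Mf : exists M, forall z, `|f z| <= M.
  by exists 1 => z; have /andP[? ?] := f01 z; rewrite ger0_norm.
have bf i : bm (fun w => f (zs i w)) by exact: (bm_comp (mzs i)).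
have mz i A : measurable A -> measurable (zs i @^-1` A).
  by move=> mA; exact: (measurable_preim (mzs i) mA).
have bA i A : measurable A -> bm (\1_(zs i @^-1` A)) by move=> mA; apply: bm_ind; exact: mz.
have sets i j A B : i != j -> measurable A -> measurable B ->
    Ex (fun w => (\1_(zs i @^-1` A) w - Ex \1_(zs i @^-1` A)) * \1_(zs j @^-1` B) w) = 0.
  move=> ij mA mB.
  have := @sampling_indep _ _ _ _ _ _ _ _ _ _ _ S [:: i; j] (fun k => if k == i then A else B).
  rewrite /= inE ij => /(_ isT).
  have mAB k : measurable (if k == i then A else B) by case: ifP.
  move=> /(_ mAB); rewrite !big_cons big_nil mule1 eqxx [j == i]eq_sym (negbTE ij).
  have -> : \bigcap_(k in [set` [:: i; j]]) (zs k @^-1` (if k == i then A else B)) =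
            zs i @^-1` A `&` zs j @^-1` B.
    apply/seteqP; split => w /=.
      move=> h; have hi : i \in [:: i; j] by rewrite inE eqxx.
      have hj : j \in [:: i; j] by rewrite !inE eqxx orbT.
      have := h i hi; have := h j hj; rewrite /= eqxx [j == i]eq_sym (negbTE ij).
      by move=> ? ?; split.
    move=> [h1 h2] k /=; rewrite !inE => /orP[/eqP ->|/eqP ->]; first by rewrite eqxx.
    by rewrite eq_sym (negbTE ij).
  rewrite -Ex_indI; [|exact: mz|exact: mz].
  rewrite !(Ex_indE P (mz _ _ _)) // -EFinM => h.
  have {}h := EFin_inj h.
  have -> : (fun w => (\1_(zs i @^-1` A) w - Ex \1_(zs i @^-1` A)) * \1_(zs j @^-1` B) w) =
     (fun w => \1_(zs i @^-1` A) w * \1_(zs j @^-1` B) w - Ex \1_(zs i @^-1` A) * \1_(zs j @^-1` B) w).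
    by apply/funext => w; rewrite mulrBl.
  rewrite ExB; [|by apply: bmM; exact: bA|by apply: bmM; [exact: bm_cst|exact: bA]].
  by rewrite h (ExZ P _ (bA j B mB)) subrr.
have step i j A : i != j -> measurable A ->
    Ex (fun w => (f (zs j w) - mu) * \1_(zs i @^-1` A) w) = 0.
  move=> ij mA.
  have := ortho_preim (P := P) (mzs j)
    (bmB (bA i A mA) (bm_cst (Ex \1_(zs i @^-1` A)))) (fun B mB => sets i j A B ij mA mB) mf Mf.
  have -> : (fun w => (\1_(zs i @^-1` A) w - Ex \1_(zs i @^-1` A)) * f (zs j w)) =
     (fun w => f (zs j w) * \1_(zs i @^-1` A) w - Ex \1_(zs i @^-1` A) * f (zs j w)).
    by apply/funext => w; rewrite mulrBl mulrC.
  have -> : (fun w => (f (zs j w) - mu) * \1_(zs i @^-1` A) w) =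
     (fun w => f (zs j w) * \1_(zs i @^-1` A) w - mu * \1_(zs i @^-1` A) w).
    by apply/funext => w; rewrite mulrBl.
  rewrite !ExB; try by [apply: bmM; [exact: bf|exact: bA]|
    apply: bmM; [exact: bm_cst|exact: bf]|apply: bmM; [exact: bm_cst|exact: bA]].
  by rewrite (ExZ P _ (bf j)) (ExZ P _ (bA i A mA)) Ef mulrC.
have bc i : bm (fun w => f (zs i w) - mu) by apply: bmB => //; exact: bm_cst.
have mu01 : 0 <= mu <= 1.
  rewrite -(Ef 0%N) Ex_ge0 => [|w]; last by have /andP[] := f01 (zs 0%N w).
  rewrite -(Ex_cst P 1) Ex_le // => [|w]; first exact: bm_cst.
  by have /andP[] := f01 (zs 0%N w).
have := @as0_uncorrelated (fun i w => f (zs i w) - mu) bc.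
have c1 i w : `|f (zs i w) - mu| <= 1.
  have := f01 (zs i w); move: mu01 => /andP[? ?] /andP[? ?].
  by rewrite ler_norml; apply/andP; split; lra.
move=> /(_ c1); have c2 i j : i != j ->
    Ex (fun w => (f (zs i w) - mu) * (f (zs j w) - mu)) = 0.
  move=> ij; have ji : j != i by rewrite eq_sym.
  have := @ortho_preim _ _ _ P _ _ _ (mzs j) _ (bc i) (fun A mA => step j i A ji mA)
    (fun z => f z - mu).
  apply; first exact: measurable_funB.
  exists 1 => z; have := f01 z; move: mu01 => /andP[? ?] /andP[? ?].
  by rewrite ler_norml; apply/andP; split; lra.
move=> /(_ c2) h e e0; apply: filterS (h e e0) => w [N _ hN].
(* [n = 0] is excluded: there the quotient is 0 by convention and [mu] cannot be drawn into the
   sum. *)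
exists (maxn N 1) => // n /= hn.
have n0 : n%:R != 0 :> R by rewrite pnatr_eq0 -lt0n; apply: leq_trans hn; rewrite leq_max orbT.
have Nn : (N <= n)%N by move: hn; rewrite geq_max => /andP[].
have := hN n Nn; rewrite sumrB sumr_const card_ord mulrBl -[mu *+ n]mulr_natr mulfK //.
Qed.

Lemma slln_x (g : TX -> R) : measurable_fun setT g -> (forall x, 0 <= g x <= 1) ->
  as0 (fun n w => (\sum_(i < n) g (xs i w)) / n%:R - Ex (fun w => g (X w))).
Proof.
move=> mg g01; apply: (slln (f := fun z => g z.1)).
- exact: (measurableT_comp mg measurable_fst).
- by move=> z.
- by move=> i; apply: (Ex_same_law S) => //; exact: ver_bdd.
Qed.

Lemma slln_y (H : set R) : measurable H ->
  as0 (fun n w => (\sum_(i < n) \1_(ys i @^-1` H) w) / n%:R - Ex \1_(y @^-1` H)).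
Proof.
move=> mH; have := @slln (fun z => \1_H z.2.1) (Ex \1_(y @^-1` H)); apply.
- have mi : measurable_fun setT (\1_H : R -> R) by exact: measurable_indic.
  apply: (measurableT_comp mi).
  exact: (measurableT_comp measurable_fst measurable_snd).
- by move=> z; rewrite indicE; case: (_ \in _); rewrite ?lexx ?ler01.
move=> i; apply: EFin_inj.
rewrite -(Ex_indE P (measurable_preim my mH)) -(law_y S i mH).
by rewrite (Ex_indE P (measurable_preim (mys i) mH)).
Qed.

Definition ranks n w : seq nat := rank_seq (fun i => phi (xs i w)) (us ^~ w) n.

Section Residuals.
Variables (H : set R) (p : TX -> R).
Hypothesis mH : measurable H.
Hypothesis vp : is_ver P X (y @^-1` H) p.
Let mp : measurable_fun setT p. Proof. by case: vp. Qed.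
Let p01 x : 0 <= p x <= 1. Proof. by case: vp. Qed.
Local Notation eps := (resid xs ys H p).

Lemma block_measurable_x a n i : (i < n)%N ->
  measurable_fun setT (xs i : g_sigma_algebraType (block_pi a n) -> TX).
Proof.
move=> ilt _ C mC; rewrite setTI; apply: sub_sigma_algebra.
have [->|ia] := eqVneq i a.
  exists (fun=> setT), C, setT; split => //.
  by rewrite preimage_setT setIT bigcapT // setIT.
exists (fun k => if k == i then C `*` setT else setT), setT, setT; split => //.
  by move=> k; case: ifP => // _; exact: measurableX.
rewrite !preimage_setT !setTI; apply/seteqP; split => w /=.
  by move=> Cw k _ /=; case: eqVneq => [->|].
have io : i \in others a n by rewrite mem_filter ia mem_iota.
by move=> h; have := h i io; rewrite /= eqxx => -[].
Qed.

Lemma block_measurable_u a n i : (i < n)%N ->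
  measurable_fun setT (us i : g_sigma_algebraType (block_pi a n) -> R).
Proof.
move=> ilt _ C mC; rewrite setTI; apply: sub_sigma_algebra.
have [->|ia] := eqVneq i a.
  exists (fun=> setT), setT, C; split => //.
  by rewrite preimage_setT setTI bigcapT // setIT.
exists (fun k => if k == i then setT `*` (setT `*` C) else setT), setT, setT; split => //.
  by move=> k; case: ifP => // _; apply: measurableX => //; exact: measurableX.
rewrite !preimage_setT !setTI; apply/seteqP; split => w /=.
  by move=> Cw k _ /=; case: eqVneq => [->|].
have io : i \in others a n by rewrite mem_filter ia mem_iota.
by move=> h; have := h i io; rewrite /= eqxx => -[_ []].
Qed.

Arguments block_measurable_x a {n i}.
Arguments block_measurable_u a {n i}.

Lemma block_measurable_y a n i : (i < n)%N -> i != a ->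
  measurable_fun setT (ys i : g_sigma_algebraType (block_pi a n) -> R).
Proof.
move=> ilt ia _ C mC; rewrite setTI; apply: sub_sigma_algebra.
exists (fun k => if k == i then setT `*` (C `*` setT) else setT), setT, setT; split => //.
  by move=> k; case: ifP => // _; apply: measurableX => //; exact: measurableX.
rewrite !preimage_setT !setTI; apply/seteqP; split => w /=.
  by move=> Cw k _ /=; case: eqVneq => [->|].
have io : i \in others a n by rewrite mem_filter ia mem_iota.
by move=> h; have := h i io; rewrite /= eqxx => -[_ []].
Qed.

Lemma block_measurable_resid a n i : (i < n)%N -> i != a ->
  measurable_fun setT (eps i : g_sigma_algebraType (block_pi a n) -> R).
Proof.
move=> ilt ia; apply: measurable_funB.
  have mi : measurable_fun setT (\1_H : R -> R) by exact: measurable_indic.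
  exact: (measurableT_comp mi (block_measurable_y ilt ia)).
exact: (measurableT_comp mp (block_measurable_x a ilt)).
Qed.

(** The ranking reads predictors and keys but no response, and the residuals of [b], [i], [j] do not
    read [ys a]; the whole second factor is therefore measurable for the sigma-algebra of
    [block_pi a n]. *)
Lemma resid_ranks_ortho a b i j n (Q : seq nat -> bool) :
  (b < n)%N -> (i < n)%N -> (j < n)%N -> b != a -> i != a -> j != a ->
  Ex (fun w => eps a w * ((Q (ranks n w))%:R * (eps b w * (eps i w * eps j w)))) = 0.
Proof.
move=> bn iN jn ba ia ja; apply: (resid_ortho S mH vp (n := n)).
  apply: measurable_funM; last first.
    by do 2 (apply: measurable_funM; first exact: block_measurable_resid);
       exact: block_measurable_resid.
  have := @measurable_rank_seq R _ (g_sigma_algebraType (block_pi a n))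
     (fun i w => phi (xs i w)) us n Q.
  move=> /(_ (fun i il => measurableT_comp mphi (block_measurable_x a il))).
  move=> /(_ (fun i il => block_measurable_u a il)) mQ.
  by have [] := @bm_bool R _ _ _ mQ.
exists 1 => w; rewrite !normrM.
have := resid_le1 xs ys vp b w; have := resid_le1 xs ys vp i w; have := resid_le1 xs ys vp j w.
move: (normr_ge0 (eps b w)) (normr_ge0 (eps i w)) (normr_ge0 (eps j w)).
set x1 := `|eps b w|; set x2 := `|eps i w|; set x3 := `|eps j w| => a1 a2 a3 b3 b2 b1.
have h1 : x2 * x3 <= 1 by rewrite mulr_ile1.
have h2 : x1 * (x2 * x3) <= 1 by rewrite mulr_ile1 ?mulr_ge0.
by case: (Q _); rewrite ?normr0 ?mul0r ?normr1 ?mul1r.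
Qed.

Let bm_ranks n (Q : seq nat -> bool) : bm (fun w => (Q (ranks n w))%:R).
Proof.
apply: bm_bool; apply: (measurable_rank_seq (x := fun i w => phi (xs i w))) => [i _|i _] //.
exact: (measurableT_comp mphi (mxs i)).
Qed.

Let beps i : bm (eps i). Proof. exact: (bm_resid S mH vp). Qed.

Lemma resid_le1M i j w : `|eps i w * eps j w| <= 1.
Proof. by rewrite normrM mulr_ile1 // (resid_le1 xs ys vp). Qed.

(* Two distinct ordered pairs of consecutive ranks are never swapped, so one
   index occurs in exactly one of them and its residual integrates to zero. *)
Lemma as0_resid_adj :
  as0 (fun n w => adj (fun i j => eps i w * eps j w) (ranks n w) / n%:R).
Proof.
pose D n (q : 'I_n * 'I_n) w : R :=
  (consecutive (ranks n w) q.1 q.2)%:R * (eps q.1 w * eps q.2 w).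
have bD n q : bm (D n q).
  by apply: bmM; [exact: (bm_ranks n (fun s => consecutive s q.1 q.2))|exact: bmM].
have TE n w : adj (fun i j => eps i w * eps j w) (ranks n w) = \sum_(q : 'I_n * 'I_n) D n q w.
  by rewrite /ranks adj_consecutive pair_bigA.
have D0 n q q' : q != q' -> Ex (fun w => D n q w * D n q' w) = 0.
  case: q q' => [i j] [i' j'] qq'.
  have E0 (f : Om -> R) : (forall w, f w = 0) -> Ex f = 0.
    by move=> f0; rewrite -[RHS](Ex_cst P 0); congr Ex; apply/funext.
  have [ij|ij] := eqVneq (i : nat) j.
    apply: E0 => w; rewrite /D /= /consecutive ij.
    by rewrite (ltn_eqF (ltnSn _)) mul0r mul0r.
  have [ij'|ij'] := eqVneq (i' : nat) j'.
    apply: E0 => w; rewrite /D /= /consecutive ij'.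
    by rewrite (ltn_eqF (ltnSn _)) mul0r mulr0.
  have [/andP[/eqP i1 /eqP j1]|sw] := boolP ((i == j' :> nat) && (j == i' :> nat)).
    apply: E0 => w; rewrite /D /= /consecutive i1 j1.
    case: eqP => [h1|]; last by rewrite mul0r mul0r.
    by case: eqP => [h2|]; [exfalso; lia|rewrite [in X in _ * X]mul0r mulr0].
  have bi := bD n (i, j).
  have [/andP[ai aj]|] := boolP ((i != i' :> nat) && (i != j' :> nat)).
    rewrite -(@resid_ranks_ortho i j i' j' n
      (fun s => consecutive s i j && consecutive s i' j')) //; try by rewrite eq_sym.
    by congr Ex; apply/funext => w; rewrite /D /= -mulnb natrM; ring.
  (* Now [i] is one of [i'], [j']. As the pairs are neither equal nor swapped, [j] is neither of
     them, and [eps j] is the residual integrated out. *)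
  move=> hi.
  rewrite -(@resid_ranks_ortho j i i' j' n
      (fun s => consecutive s i j && consecutive s i' j')) //.
  - by congr Ex; apply/funext => w; rewrite /D /= -mulnb natrM; ring.
  - apply: contraNneq hi => ji'; apply/andP; split; first by rewrite ji'.
    by apply: contraNneq sw => ->; rewrite ji' !eqxx.
  - apply: contraNneq hi => jj'; apply/andP; split; last by rewrite jj'.
    apply: contraNneq qq' => ii'; apply/eqP; congr (_, _); apply/val_inj; [exact: ii'|exact/esym].
(* [3] is the increment bound of one insertion. The second moment is even at most [n]: its surviving
   terms are dominated by the indicators of consecutive pairs. *)
apply: (as0_second_moment (C := 3)) => [n|n|n w].
- rewrite (_ : (fun w => _) = (fun w => \sum_(q : 'I_n * 'I_n) D n q w)); first exact: bm_sum.
  by apply/funext => w; rewrite TE.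
- rewrite [leLHS](_ : _ = Ex (fun w =>
      \sum_(q : 'I_n * 'I_n) \sum_(q' : 'I_n * 'I_n) D n q w * D n q' w)).
    2: { congr Ex; apply/funext => w; rewrite TE expr2 mulr_suml.
         by apply: eq_bigr => q _; rewrite mulr_sumr. }
  rewrite Ex_sum; last by move=> q; apply: bm_sum => q'; exact: bmM.
  apply: (@le_trans _ _ (\sum_(q : 'I_n * 'I_n)
      Ex (fun w => (consecutive (ranks n w) q.1 q.2)%:R))).
    apply: ler_sum => q _; rewrite Ex_sum => [|q']; last exact: bmM.
    rewrite (bigD1 q) //= big1 ?addr0 => [|q' q'q]; last by rewrite D0 // eq_sym.
    apply: Ex_le => [||w]; [exact: bmM|exact: (bm_ranks n (fun s => consecutive s q.1 q.2))|].
    rewrite /D; case: (consecutive _ _ _); rewrite ?mul0r ?mul1r //.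
    rewrite -expr2 -real_normK ?num_real // expr_le1 //; exact: resid_le1M.
  rewrite -Ex_sum; last by move=> q; exact: (bm_ranks n (fun s => consecutive s q.1 q.2)).
  rewrite -[leRHS](Ex_cst P); apply: Ex_le; [|exact: bm_cst|move=> w].
    by apply: bm_sum => q; exact: (bm_ranks n (fun s => consecutive s q.1 q.2)).
  have := @adj_cst R 1 (ranks n w) ler01; rewrite {1}/ranks adj_consecutive pair_bigA /=.
  rewrite size_rank_seq mul1r; under eq_bigr do rewrite mulr1.
  by move=> h; apply: le_trans h _; rewrite ler_peMl //; lra.
- have := @adj_rank_seq_step R (fun i => phi (xs i w)) (us ^~ w) n
    (fun i j => eps i w * eps j w) 1 (fun i j => resid_le1M i j w).
  by rewrite mulr1.
Qed.

(** For distinct [i] and [j], [eps i] is integrated out, since [p (xs i)], [p (xs j)] and [eps j] do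
    not involve [ys i]. *)
Lemma as0_mean_resid :
  as0 (fun n w => (\sum_(i < n) p (xs i w) * eps i w) / n%:R).
Proof.
have bp i : bm (fun w => p (xs i w)) by apply: bm_comp => //; exact: ver_bdd.
apply: (@as0_uncorrelated (fun i w => p (xs i w) * eps i w)) => [i|i w|i j ij]; first exact: bmM.
  rewrite normrM mulr_ile1 // ?(resid_le1 xs ys vp) //.
  by have /andP[? ?] := p01 (xs i w); rewrite ger0_norm.
have bdd : exists M, forall w, `|p (xs i w) * (p (xs j w) * eps j w)| <= M.
  have [_ [M hM]] := bmM (bp i) (bmM (bp j) (beps j)); by exists M.
have ji : j != i by rewrite eq_sym.
rewrite -(resid_ortho S mH vp (a := i) (n := (maxn i j).+1) _ bdd).
  by congr Ex; apply/funext => w; ring.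
have il : (i < (maxn i j).+1)%N by rewrite ltnS leq_maxl.
have jl : (j < (maxn i j).+1)%N by rewrite ltnS leq_maxr.
apply: measurable_funM; first exact: (measurableT_comp mp (block_measurable_x i il)).
apply: measurable_funM; first exact: (measurableT_comp mp (block_measurable_x i jl)).
exact: (block_measurable_resid jl ji).
Qed.

End Residuals.

End Oscillation.

(** * Vanishing oscillation of functions of the predictor, and the limit for events of the
    response *)

Section IndicatorLimit.
Context (R : realType) (d : measure_display) (Om : measurableType d).
Variable P : probability Om R.
Context (dX : measure_display) (TX : measurableType dX).
Variables (X : Om -> TX) (y : Om -> R).
Variables (xs : nat -> Om -> TX) (ys us : nat -> Om -> R).
Hypothesis S : sampling P X y xs ys us.
Let mX := sampling_mX S.
Let my := sampling_my S.
Let mxs := sampling_mxs S.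
Let mys := sampling_mys S.
Let mus := sampling_mus S.
Variable phi : TX -> R.
Hypothesis isophi : borel_iso phi.
Let mphi : measurable_fun setT phi. Proof. by case: isophi. Qed.
Local Notation Ex := (Ex P).
Local Notation bm := (@bm R d Om).
Local Notation as0 := (as0 P).
Local Notation ranks := (ranks xs us phi).

Definition osc (g : nat -> Om -> R) n w : R :=
  adj (fun i j => `|g i w - g j w|) (ranks n w) / n%:R.

Lemma osc_ge0 g n w : 0 <= osc g n w.
Proof. by rewrite /osc divr_ge0 // /adj sumr_ge0. Qed.

Lemma osc_le (g f : nat -> Om -> R) n w :
  (forall i j, `|g i w - g j w| <= `|f i w - f j w|) -> osc g n w <= osc f n w.
Proof. by move=> gf; rewrite /osc ler_wpM2r ?invr_ge0 //; exact: le_adj. Qed.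

Let bool_setU (a b a' b' : bool) :
  `|(a || b)%:R - (a' || b')%:R| <= `|a%:R - a'%:R| + `|b%:R - b'%:R| :> R.
Proof.
by case: a; case: b; case: a'; case: b' => /=;
  rewrite !(subrr, subr0, sub0r, normrN, normr0, normr1) //; lra.
Qed.

Let bool_setD (g c g' c' : bool) : (g -> c) -> (g' -> c') ->
  `|c%:R - c'%:R| <= `|g%:R - g'%:R| + ((c && ~~ g)%:R + (c' && ~~ g')%:R) :> R.
Proof.
case: g => [/(_ isT) ->|_]; case: g' => [/(_ isT) ->|_]; case: c; case: c' => /=;
  rewrite !(subrr, subr0, sub0r, normrN, normr0, normr1); lra.
Qed.

Let ind (C : set TX) (i : nat) (w : Om) : R := \1_C (xs i w).

Lemma osc_setC C : as0 (osc (ind C)) -> as0 (osc (ind (~` C))).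
Proof.
apply: as0_le => n w; rewrite !ger0_norm ?osc_ge0 //; apply: osc_le => i j.
rewrite /ind !indicE !in_setC.
by case: (_ \in _); case: (_ \in _) => /=; rewrite ?subrr ?subr0 ?sub0r ?normrN.
Qed.

Lemma osc_setU C D : as0 (osc (ind C)) -> as0 (osc (ind D)) ->
  as0 (osc (ind (C `|` D))).
Proof.
move=> C0 D0; apply: as0_le (as0D C0 D0) => n w.
rewrite ger0_norm ?osc_ge0 // ger0_norm ?addr_ge0 ?osc_ge0 // /osc -mulrDl -adjD.
rewrite ler_wpM2r ?invr_ge0 //; apply: le_adj => i j; rewrite /ind !indicE !in_setU.
exact: bool_setU.
Qed.

(** The union differs from a finite one by a set [V] of small probability. An index with predictor
    in [V] spoils at most two adjacent pairs, so [V] adds at most twice its empirical frequency,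
    which the law of large numbers controls. *)
Lemma osc_bigcup (F : nat -> set TX) : (forall k, measurable (F k)) ->
  (forall k, as0 (osc (ind (F k)))) -> as0 (osc (ind (\bigcup_k F k))).
Proof.
move=> mF F0; set C := \bigcup_k F k.
have mC : measurable C by exact: bigcup_measurable.
pose G N := \big[setU/set0]_(k < N) F k.
have mG N : measurable (G N) by exact: bigsetU_measurable.
have GC N : G N `<=` C by exact: bigsetU_bigcup.
have G0 N : as0 (osc (ind (G N))).
  rewrite /G; elim: N => [|N IH]; last by rewrite big_ord_recr; exact: osc_setU.
  rewrite big_ord0; apply: as0_le (as0_cst0 P) => n w; rewrite /osc.
  rewrite (eq_adj (f' := fun _ _ => 0)) => [|i j]; last by rewrite /ind !indic0 subrr normr0.
  by rewrite /adj big1 // mul0r.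
have mXG N : measurable (X @^-1` (C `\` G N)).
  by apply: (measurable_preim mX); exact: measurableD.
apply: as0_approx => e e0; have e2 : 0 < e / 2 by rewrite divr_gt0.
have [] := @Ex_cap0 _ _ _ P (fun N => X @^-1` (C `\` G N)) mXG _ _ _ e2.
- move=> n w /= [Cw Gw]; split => // Gm; apply: Gw.
  by rewrite /G big_ord_recr /=; left.
- apply/seteqP; split => w //= h.
  have [[k _ Fk] _] := h 0%N I.
  have [_] := h k.+1 I; apply; rewrite /G big_ord_recr /=; by right.
move=> N /(_ N (leqnn N)) hN; set V := C `\` G N in hN.
have mV : measurable V by exact: measurableD.
have V01 x : 0 <= (\1_V x : R) <= 1 by rewrite indicE; case: (_ \in _); rewrite ?lexx ?ler01.
have V0 := slln_x S (@measurable_indic _ _ R setT _ mV) V01.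
have EV : Ex (fun w => \1_V (X w)) <= e / 2 by exact: hN.
exists (fun n w => osc (ind (G N)) n w + 2 * `|(\sum_(i < n) \1_V (xs i w)) / n%:R - Ex (fun w => \1_V (X w))|).
  apply: as0D => //; apply: as0Z; apply: as0_le V0 => n w; by rewrite normr_id.
move=> n w; rewrite ger0_norm ?osc_ge0 // ger0_norm; last first.
  by rewrite addr_ge0 ?osc_ge0 // mulr_ge0.
set s := \sum_(i < n) \1_V (xs i w).
have h : osc (ind C) n w <= osc (ind (G N)) n w + 2 * (s / n%:R).
  rewrite /osc mulrA -mulrDl ler_wpM2r ?invr_ge0 //.
  have gs : \sum_(i <- ranks n w) \1_V (xs i w) = s by exact: sum_rank_seq.
  have V1 i : `|\1_V (xs i w) : R| <= 1 by have /andP[? ?] := V01 (xs i w); rewrite ger0_norm.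
  apply: (@le_trans _ _ (adj (fun i j => `|ind (G N) i w - ind (G N) j w| +
      (\1_V (xs i w) + \1_V (xs j w))) (ranks n w))).
    apply: le_adj => i j; rewrite /ind /V !indicE !in_setD.
    by apply: bool_setD; rewrite !inE; exact: GC.
  rewrite !adjD lerD2l mulr_natl mulr2n -gs; apply: lerD; rewrite sum_seq_nth /adj.
    case: (size _) => [|m]; first by rewrite !big_ord0.
    by rewrite [leRHS]big_ord_recr /= lerDl; have /andP[] := V01 (xs (nth 0%N (ranks n w) m) w).
  case: (size _) => [|m]; first by rewrite !big_ord0.
  by rewrite [leRHS]big_ord_recl /= lerDr; have /andP[] := V01 (xs (nth 0%N (ranks n w) 0) w).
have := ler_norm (s / n%:R - Ex (fun w => \1_V (X w))).
by move: h EV; lra.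
Qed.

(* The half-lines of [phi] generate the sigma-algebra of [TX]. *)
Lemma osc_ind C : measurable C -> as0 (osc (ind C)).
Proof.
move=> mC; have [_ iphi _ oC] := isophi.
pose good := [set B : set R | measurable B /\ as0 (osc (ind (phi @^-1` B)))].
suff : (@measurable _ R : set (set R)) `<=` good.
  move=> /(_ (phi @` C)) [|_]; first exact: oC.
  rewrite (_ : phi @^-1` _ = C) //; apply/seteqP; split => x /=.
    by move=> [x' Cx' /iphi <-].
  by move=> Cx; exists x.
have -> : (@measurable _ R : set (set R)) = <<s (@RGenOInfty.G R) >>.
  exact: RGenOInfty.measurableE.
apply: smallest_sub; last first.
  move=> _ [c ->]; split; first exact: measurable_itv.
  have -> : phi @^-1` `]c, +oo[ = ~` [set x | phi x <= c].
    by apply/seteqP; split => x /=; rewrite in_itv /= andbT ltNge => /negP.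
  apply: osc_setC; apply: as0_le (as0_inv P 1) => n w.
  rewrite ger0_norm ?osc_ge0 // ger0_norm ?divr_ge0 // /osc ler_wpM2r ?invr_ge0 //.
  apply: le_trans (@adj_half_line R (fun i => phi (xs i w)) (us ^~ w) n c).
  apply: le_adj => i j; rewrite /ind !indicE.
  have inb x : (x \in [set x | phi x <= c]) = (phi x <= c).
    by apply/idP/idP; rewrite inE.
  by rewrite !inb.
split.
- split; first exact: measurable0.
  rewrite preimage_set0; apply: as0_le (as0_cst0 P) => n w; rewrite /osc.
  rewrite (eq_adj (f' := fun _ _ => 0)) => [|i j]; last by rewrite /ind !indic0 subrr normr0.
  by rewrite /adj big1 // mul0r.
- move=> B [mB oB]; rewrite setTD; split; first exact: measurableC.
  by rewrite preimage_setC; exact: osc_setC.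
- move=> B gB; split; first by apply: bigcup_measurable => k _; exact: (gB k).1.
  rewrite preimage_bigcup; apply: osc_bigcup => k; last exact: (gB k).2.
  exact: (measurable_preim mphi (gB k).1).
Qed.

Lemma osc_fun (g : TX -> R) : measurable_fun setT g -> (forall x, 0 <= g x <= 1) ->
  as0 (osc (fun i w => g (xs i w))).
Proof.
move=> mg g01; apply: as0_approx => e e0.
(* Half of [e] for each end of a pair, both being rounded by [level]. *)
have [K /ltW hK] := ltr_add_invr (y:=0) (x:=e / 2) ltac:(by rewrite divr_gt0).
rewrite add0r in hK.
pose C (j : 'I_K.+1) := [set x | j.+1%:R / K.+1%:R <= g x].
have mC j : measurable (C j).
  rewrite (_ : C j = g @^-1` `[j.+1%:R / K.+1%:R, +oo[).
    by rewrite -[X in measurable X]setTI; exact: mg.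
  by apply/seteqP; split => w /=; rewrite in_itv /= andbT.
exists (fun n w => K.+1%:R^-1 * \sum_(j < K.+1) osc (ind (C j)) n w).
  by apply: as0Z; apply: as0_sum => j; exact: osc_ind.
move=> n w; rewrite ger0_norm ?osc_ge0 // ger0_norm; last first.
  by rewrite mulr_ge0 ?invr_ge0 // sumr_ge0 // => j _; exact: osc_ge0.
have -> : K.+1%:R^-1 * (\sum_(j < K.+1) osc (ind (C j)) n w) =
  adj (fun i j => K.+1%:R^-1 * \sum_(k < K.+1) `|ind (C k) i w - ind (C k) j w|) (ranks n w) / n%:R.
  by rewrite adjZ adj_sum -mulrA; congr (_ * _); rewrite mulr_suml.
have eE : adj (fun _ _ => e) (ranks n w) / n%:R <= e.
  case: n => [|n]; first by rewrite invr0 mulr0 ltW.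
  rewrite ler_pdivrMr ?ltr0n //; have := @adj_cst R e (ranks n.+1 w) (ltW e0).
  by rewrite size_rank_seq.
apply: le_trans (lerD (lexx _) eE); rewrite /osc -mulrDl -adjD.
rewrite ler_wpM2r ?invr_ge0 //; apply: le_adj => i j.
have l1 := level_approx K (g01 (xs i w)); have l2 := level_approx K (g01 (xs j w)).
have l3 : `|level K (g (xs i w)) - level K (g (xs j w))| <=
    K.+1%:R^-1 * \sum_(k < K.+1) `|ind (C k) i w - ind (C k) j w|.
  rewrite /level -mulrBr normrM ger0_norm ?invr_ge0 // ler_wpM2l ?invr_ge0 // -sumrB.
  apply: le_trans (ler_norm_sum _ _ _) _; apply: ler_sum => k _; rewrite /ind !indicE.
  have inb x : (x \in C k) = (k.+1%:R / K.+1%:R <= g x)%R.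
    by apply/idP/idP; rewrite inE.
  by rewrite !inb.
apply: (@le_trans _ _ (`|level K (g (xs i w)) - level K (g (xs j w))| + e)); last first.
  by rewrite lerD2r.
move: l1 l2 {l3} hK; set A := level K _; set A' := level K (g (xs j w)).
set B := K.+1%:R^-1; rewrite !ler_norml => /andP[? ?] /andP[? ?] ?.
have := ler_norm (A - A'); have := ler_norm (- (A - A')); rewrite normrN.
by move=> ? ?; apply/andP; split; lra.
Qed.

(* Write [b = m + eps] with [m] the conditional mean; then
   [|b_i - b_j| = b_i + b_j - 2 b_i b_j] and [b_i b_j] equals
   [eps_i eps_j + m_j ^ 2 + m_j eps_j + m_i eps_i] up to [3 |m_i - m_j|]. *)
Lemma osc_event (H : set R) (p : TX -> R) : measurable H ->
  is_ver P X (y @^-1` H) p ->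
  as0 (fun n w => osc (fun i w => \1_(ys i @^-1` H) w) n w - 2 * cvar P X (y @^-1` H) p).
Proof.
move=> mH vp; have [mp p01 _] := vp.
have mE := measurable_preim my mH.
rewrite (cvarE mX mE vp).
pose b i w : R := \1_(ys i @^-1` H) w; pose m i w := p (xs i w).
pose eps := resid xs ys H p.
have b_m i w : b i w = m i w + eps i w by rewrite /eps /resid addrC subrK.
pose v1 n w := (\sum_(i < n) b i w) / n%:R - Ex \1_(y @^-1` H).
pose v2 n w := (\sum_(i < n) m i w ^+ 2) / n%:R - Ex (fun w => p (X w) ^+ 2).
pose v3 n w := (\sum_(i < n) m i w * eps i w) / n%:R.
pose v4 n w := adj (fun i j => eps i w * eps j w) (ranks n w) / n%:R.
pose v5 n w := osc m n w.
have a1 : as0 v1 by exact: (slln_y S mH).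
have a2 : as0 v2.
  apply: (slln_x S (g := fun x => p x ^+ 2)); first exact: measurable_funX.
  by move=> x; have /andP[p0 p1] := p01 x; rewrite sqr_ge0 /= expr_le1.
have a3 : as0 v3 by exact: (as0_mean_resid S mH vp).
have a4 : as0 v4 by exact: (as0_resid_adj S isophi mH vp).
have a5 : as0 v5 by exact: osc_fun.
have a6 := as0_inv P 8.
have norm0 u : as0 u -> as0 (fun n w => `|u n w|).
  by apply: as0_le => n w; rewrite normr_id.
(* Summing [r] and [q] below over the ranking gives the coefficients 2 for [b], 2 for [m ^ 2] and 4
   for [m eps]; the product of residuals carries 2 and the oscillation of [m] carries 6. The two end
   terms are bounded by [3 + 5 = 8]. *)
pose bd n w := 2 * `|v1 n w| + (2 * `|v2 n w| + (4 * `|v3 n w| + (2 * `|v4 n w| + (6 * `|v5 n w| + 8 / n%:R)))).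
have abd : as0 bd by do 5 (apply: as0D; first by apply: as0Z; exact: norm0).
apply: as0_le abd => n w; rewrite [leRHS]ger0_norm; last first.
  by rewrite /bd !addr_ge0 ?mulr_ge0 ?divr_ge0.
(* Each term is attached to one end of the pair, [r] to the left and [q] to the right, so that
   [adj_left] and [adj_right] turn it into a plain average. This takes three replacements of [m i]
   by [m j] or conversely, each doubled, whence the 6 in [bnd]. *)
pose q j := b j w - 2 * (m j w ^+ 2) - 2 * (m j w * eps j w).
pose r i := b i w - 2 * (m i w * eps i w).
have m01 i : 0 <= m i w <= 1 by exact: p01.
have b01 i : b i w = 0 \/ b i w = 1.
  by rewrite /b indicE; case: (_ \in _); [right|left].
have e1 i : `|eps i w| <= 1 by exact: (resid_le1 xs ys vp).
have bnd i j : `| `|b i w - b j w| - (r i + q j - 2 * (eps i w * eps j w)) | <=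
    6 * `|m i w - m j w|.
  rewrite /r /q.
  have ei : eps i w = b i w - m i w by rewrite b_m addrC addKr.
  have ej : eps j w = b j w - m j w by rewrite b_m addrC addKr.
  have m0 := m01 i; have m0' := m01 j.
  rewrite ei ej; move: m0 m0'; move: (m i w) (m j w) => x z /andP[x0 x1] /andP[z0 z1].
  have nd := ler_norm (x - z); have nd' := ler_norm (z - x); rewrite distrC in nd'.
  move: nd nd'; set D := `|x - z| => nd nd'.
  by case: (b01 i) => ->; case: (b01 j) => ->;
    rewrite ?(subrr, subr0, sub0r, normrN, normr0, normr1); rewrite ler_norml;
    apply/andP; split; nra.
have inv0 : 0 <= n%:R^-1 :> R by rewrite invr_ge0.
have v1E : (\sum_(i < n) b i w) / n%:R = v1 n w + Ex \1_(y @^-1` H) by rewrite subrK.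
have v2E : (\sum_(i < n) m i w ^+ 2) / n%:R = v2 n w + Ex (fun w => p (X w) ^+ 2).
  by rewrite subrK.
have A1 : `|adj (fun i j => `|b i w - b j w|) (ranks n w) -
    adj (fun i j => r i + q j - 2 * (eps i w * eps j w)) (ranks n w)| <=
    6 * adj (fun i j => `|m i w - m j w|) (ranks n w).
  rewrite -adjZ /adj -sumrB; apply: le_trans (ler_norm_sum _ _ _) _.
  by apply: ler_sum => k _; exact: bnd.
have rb i : `|r i| <= 3.
  rewrite /r; have := e1 i; have [m0 m1] := andP (m01 i).
  rewrite ler_norml => /andP[? ?]; rewrite ler_norml.
  by case: (b01 i) => ->; apply/andP; split; nra.
have qb i : `|q i| <= 5.
  rewrite /q; have := e1 i; have [m0 m1] := andP (m01 i).
  rewrite ler_norml => /andP[? ?]; rewrite ler_norml expr2.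
  by case: (b01 i) => ->; apply/andP; split; nra.
have A2 := @adj_left R r 3 (ranks n w) rb.
have A3 := @adj_right R q 5 (ranks n w) qb.
have rE : \sum_(i <- ranks n w) r i = (\sum_(i < n) b i w) - 2 * (\sum_(i < n) m i w * eps i w).
  by rewrite sum_rank_seq /r sumrB mulr_sumr.
have qE : \sum_(i <- ranks n w) q i = (\sum_(i < n) b i w) - 2 * (\sum_(i < n) m i w ^+ 2)
   - 2 * (\sum_(i < n) m i w * eps i w).
  by rewrite sum_rank_seq /q !sumrB !mulr_sumr.
rewrite rE in A2; rewrite qE in A3.
have A4 : adj (fun i j => r i + q j - 2 * (eps i w * eps j w)) (ranks n w) =
   adj (fun i _ => r i) (ranks n w) + adj (fun _ j => q j) (ranks n w) -
   2 * adj (fun i j => eps i w * eps j w) (ranks n w).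
  by rewrite -!adjD -adjZ /adj -sumrB.
rewrite A4 in A1.
have scale (a c : R) : `|a| <= c -> `|a / n%:R| <= c / n%:R.
  by move=> ac; rewrite normrM [X in _ * X]ger0_norm // ler_wpM2r.
have {A1} := scale _ _ A1; have {A2} := scale _ _ A2; have {A3} := scale _ _ A3.
have v3E : (\sum_(i < n) m i w * eps i w) / n%:R = v3 n w by [].
have v4E : adj (fun i j => eps i w * eps j w) (ranks n w) / n%:R = v4 n w by [].
have v5E : adj (fun i j => `|m i w - m j w|) (ranks n w) / n%:R = v5 n w by [].
rewrite /bd /osc -/(b _ _).
have bE : adj (fun i j => `|\1_(ys i @^-1` H) w - \1_(ys j @^-1` H) w|) (ranks n w) =
  adj (fun i j => `|b i w - b j w|) (ranks n w) by [].
rewrite bE {bE}.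
have h1 := ler_norm (v1 n w); have h1' := ler_norm (- v1 n w); rewrite normrN in h1'.
have h2 := ler_norm (v2 n w); have h2' := ler_norm (- v2 n w); rewrite normrN in h2'.
have h3 := ler_norm (v3 n w); have h3' := ler_norm (- v3 n w); rewrite normrN in h3'.
have h4 := ler_norm (v4 n w); have h4' := ler_norm (- v4 n w); rewrite normrN in h4'.
have h5 := ler_norm (v5 n w).
move: (v1 n w) (v2 n w) (v3 n w) (v4 n w) (v5 n w) v1E v2E v3E v4E v5E h1 h1' h2 h2' h3 h3' h4 h4' h5
  => u1 u2 u3 u4 u5.
move: (adj _ _) (adj _ _) (adj _ _) (adj _ _) (adj _ _) => t1 t2 t3 t4 t5.
move: (\sum_(_ < _) _) (\sum_(_ < _) _) (\sum_(_ < _) _) (Ex _) (Ex _) => s1 s2 s3 E1 E2.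
move: (n%:R^-1) inv0 => nI inv0.
move=> ? ? ? ? ? ? ? ? ? ? ? ? ? ? /ler_normlP[? ?] /ler_normlP[? ?] /ler_normlP[? ?].
apply/ler_normlP; split; lra.
Qed.

End IndicatorLimit.

(** * Uniform convergence of the empirical distribution function *)

Section Cdf.
Context (R : realType) (d : measure_display) (Om : measurableType d).
Variable P : probability Om R.
Local Notation Ex := (Ex P).

Lemma Ex_subset (A B : set Om) : measurable A -> measurable B -> A `<=` B ->
  Ex \1_A <= Ex \1_B.
Proof.
move=> mA mB AB; apply: Ex_le => [||w]; [exact: bm_ind|exact: bm_ind|].
rewrite !indicE ler_nat; case: (boolP (w \in A)) => // wA.
by rewrite (_ : w \in B) // inE; apply: AB; rewrite inE in wA.
Qed.

Lemma Ex_ind01 (A : set Om) : measurable A -> 0 <= Ex \1_A <= 1.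
Proof.
move=> mA; rewrite Ex_ge0 /=; last by move=> w; rewrite indicE.
rewrite -(Ex_cst P 1); apply: Ex_le => [||w]; [exact: bm_ind|exact: bm_cst|].
by rewrite indicE; case: (_ \in _).
Qed.

Lemma Ex_setD_subset (A B : set Om) : measurable A -> measurable B -> A `<=` B ->
  Ex \1_(B `\` A) = Ex \1_B - Ex \1_A.
Proof.
move=> mA mB AB; rewrite -ExB; [|exact: bm_ind|exact: bm_ind].
congr Ex; apply/funext => w; rewrite !indicE in_setD.
case: (boolP (w \in A)) => [wA|_] /=; last by rewrite andbT subr0.
by rewrite (_ : w \in B) ?subrr // inE; apply: AB; rewrite inE in wA.
Qed.

Definition lrcdf (y : Om -> R) (t : R) : R := Ex \1_[set w | y w <= t].

Section OneVariable.
Variable y : Om -> R.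
Hypothesis my : measurable_fun setT y.

Lemma measurable_le t : measurable [set w | y w <= t].
Proof.
rewrite (_ : [set _ | _] = y @^-1` `]-oo, t]).
  exact: (measurable_preim my).
by apply/seteqP; split => w /=; rewrite in_itv.
Qed.

Lemma measurable_ge t : measurable [set w | t <= y w].
Proof.
rewrite (_ : [set _ | _] = y @^-1` `[t, +oo[).
  exact: (measurable_preim my).
by apply/seteqP; split => w /=; rewrite in_itv /= andbT.
Qed.

Lemma lrcdf01 t : 0 <= lrcdf y t <= 1.
Proof. exact/Ex_ind01/measurable_le. Qed.

Lemma lrcdf_homo t t' : t <= t' -> lrcdf y t <= lrcdf y t'.
Proof.
move=> tt'; apply: Ex_subset; [exact: measurable_le|exact: measurable_le|].
by move=> w /= /le_trans; apply.
Qed.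

Lemma measurable_lrcdf : measurable_fun setT (lrcdf y).
Proof. by apply: nondecreasing_measurable => // t t'; exact: lrcdf_homo. Qed.

(** Enumeration of the rationals inside [R]; a number that codes no rational gives 0, itself
    rational. *)
Definition ratn (k : nat) : R := if unpickle k is Some q then ratr (q : rat) else 0.

Lemma ratnP (a b : R) : a < b -> exists k, a < ratn k < b.
Proof.
move=> /rat_in_itvoo[q]; rewrite in_itv /= => qab.
by exists (pickle q); rewrite /ratn pickleK.
Qed.

Lemma measurable_lrcdf_lt v : measurable [set t | lrcdf y t < v].
Proof.
rewrite (_ : [set _ | _] = lrcdf y @^-1` `]-oo, v[).
  exact: (measurable_preim measurable_lrcdf).
by apply/seteqP; split => w /=; rewrite in_itv.
Qed.

(* The down-set [F < v] is, up to its maximum, a countable increasing union of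
   half-lines [<= q]. *)
Lemma lrcdf_level v : 0 <= v -> Ex \1_[set w | lrcdf y (y w) < v] <= v.
Proof.
move=> v0; pose D := [set t | lrcdf y t < v].
have [[t [Dt tmax]]|nomax] := pselect (exists t, D t /\ forall t', D t' -> t' <= t).
  apply: le_trans (ltW Dt); apply: Ex_subset.
  - exact: (measurable_preim my (measurable_lrcdf_lt v)).
  - exact: measurable_le.
  - by move=> w Dw; exact: tmax.
(* Half-lines ended by those of the first [N] rationals that lie in [D]: their union is empty or the
   longest of them, whose probability is below [v] by definition of [D]. Since [D] has no maximum,
   these unions exhaust the event that [y] is in [D]. *)
pose U N := \bigcup_(k in [set k | (k < N)%N /\ D (ratn k)]) [set w | y w <= ratn k].
have mU N : measurable (U N).
  by apply: bigcup_measurable => k _; exact: measurable_le.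
have UN N : Ex \1_(U N) <= v.
  have [->|[q [Dq ->]]] : U N = set0 \/ exists q, D q /\ U N = [set w | y w <= q].
    elim: N => [|N [IH|[q [Dq IH]]]].
    - by left; apply/seteqP; split => w //= [k []].
    - have [DN|DN] := pselect (D (ratn N)).
        right; exists (ratn N); split => //; apply/seteqP; split => w /=.
          move=> [k [/= +] Dk] yk; rewrite ltnS leq_eqVlt => /predU1P[<- //|kN].
          by have : U N w by [exists k]; rewrite IH.
        by move=> yN; exists N => //=.
      left; apply/seteqP; split => w //= [k [/= +] Dk] yk.
      rewrite ltnS leq_eqVlt => /predU1P[kN|kN]; first by rewrite kN in Dk.
      by have : U N w by [exists k]; rewrite IH.
    - have [DN|DN] := pselect (D (ratn N)).
        right; exists (Num.max q (ratn N)); split; first by case: leP.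
        apply/seteqP; split => w /=.
          move=> [k [/= +] Dk] yk; rewrite ltnS leq_eqVlt => /predU1P[kN|kN].
            by rewrite le_max -kN yk orbT.
          by have : U N w by [exists k]; rewrite IH /= => yq; rewrite le_max yq.
        rewrite le_max => /orP[yq|yN]; last by exists N => //=.
        have : U N w by rewrite IH.
        by move=> [k [kN Dk] yk]; exists k => //; split => //; exact: ltnW.
      right; exists q; split => //; rewrite -IH; apply/seteqP; split => w /=.
        move=> [k [/= +] Dk] yk; rewrite ltnS leq_eqVlt => /predU1P[kN|kN].
          by rewrite kN in Dk.
        by exists k.
      by move=> [k [kN Dk] yk]; exists k => //; split => //; exact: ltnW.
    by rewrite indic0 Ex_cst.
  exact: ltW.
have mD : measurable [set w | D (y w)].
  exact: (measurable_preim my (measurable_lrcdf_lt v)).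
have UD N : U N `<=` [set w | D (y w)].
  by move=> w [k [_ Dk] yk]; apply: le_lt_trans Dk; exact: lrcdf_homo.
apply/ler_addgt0Pr => e e0.
have [] := @Ex_cap0 _ _ _ P (fun N => [set w | D (y w)] `\` U N) _ _ _ e e0.
- by move=> N; exact: measurableD.
- move=> N w [Dw Uw]; split => // -[k [kN Dk] yk]; apply: Uw; exists k => //.
  by split => //; exact: ltnW.
- apply/seteqP; split => w //= h; have [Dw _] := h 0%N I.
  have [t' [Dt' tt']] : exists t', D t' /\ y w < t'.
    apply: contrapT => h'; apply: nomax; exists (y w); split => // t' Dt'.
    by rewrite leNgt; apply/negP => tt'; apply: h'; exists t'.
  have [k /andP[k1 k2]] := ratnP tt'.
  have [_] := h k.+1 I; apply; exists k => /=; last exact: ltW.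
  by split => //; apply: le_lt_trans Dt'; apply: lrcdf_homo; exact: ltW.
move=> N /(_ N (leqnn N)); rewrite Ex_setD_subset // => h.
by have := UN N; rewrite /D in h *; lra.
Qed.

End OneVariable.

Section GlivenkoCantelli.
Variables (y : Om -> R) (ys : nat -> Om -> R).
Hypothesis my : measurable_fun setT y.
Hypothesis lln : forall H : set R, measurable H ->
  as0 P (fun n w => (\sum_(i < n) \1_(ys i @^-1` H) w) / n%:R - Ex \1_(y @^-1` H)).

(* If [y_i] lies in the down-set [D] then [F (y_i) <= P (y \in D)], so the
   empirical frequency of [D] is at most that of a level set of [F], whose
   probability [lrcdf_level] controls. *)
Lemma empirical_down_set (e : R) : 0 < e ->
  {ae P, forall w, \forall n \near \oo, forall D : set R, measurable D ->
    (forall s t, s <= t -> D t -> D s) ->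
    (\sum_(i < n) \1_(ys i @^-1` D) w) / n%:R <= Ex \1_(y @^-1` D) + e}.
Proof.
move=> e0; have e2 : 0 < e / 2 by rewrite divr_gt0.
have [K hK] := ltr_add_invr (y:=0) (x:=e / 2) e2.
rewrite add0r in hK; set m := K.+1%:R in hK.
have m0 : 0 < m by rewrite ltr0n.
pose H j := [set t | lrcdf y t < j.+1%:R / m].
have mH j : measurable (H j) by exact: measurable_lrcdf_lt.
(* There are [K.+2] level sets because the index [j] below reaches [K.+1] when [D] has probability
   1. *)
pose u n w := \sum_(j < K.+2) `|(\sum_(i < n) \1_(ys i @^-1` (H j)) w) / n%:R - Ex \1_(y @^-1` (H j))|.
have u0 : as0 P u.
  apply: as0_sum => j; apply: as0_le (lln (mH j)) => n w; by rewrite normr_id.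
apply: filterS (u0 _ e2) => w; apply: filterS => n un D mD dD.
set pD := Ex \1_(y @^-1` D).
have /andP[p0 p1] : 0 <= pD <= 1 by apply: Ex_ind01; exact: measurable_preim.
have mp0 : 0 <= m * pD by rewrite mulr_ge0 // ltW.
have /andP[j1 j2] := truncn_itv mp0; set j := Num.truncn (m * pD) in j1 j2.
have jK : (j < K.+2)%N.
  rewrite ltnS -(ler_nat R) -/m; apply: le_trans j1 _.
  by rewrite ler_piMr // ltW.
have DH : \sum_(i < n) \1_(ys i @^-1` D) w <= \sum_(i < n) \1_(ys i @^-1` (H j)) w :> R.
  apply: ler_sum => i _; rewrite !indicE ler_nat.
  case: (boolP (w \in ys i @^-1` D)) => // wD.
  rewrite (_ : w \in _) // inE /H /=; rewrite inE /= in wD.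
  rewrite ltr_pdivlMr // mulrC; apply: le_lt_trans j2.
  rewrite ler_pM2l //; apply: Ex_subset.
  - exact: measurable_le.
  - exact: measurable_preim.
  - by move=> z /= zw; exact: dD wD.
have uj : `|(\sum_(i < n) \1_(ys i @^-1` (H j)) w) / n%:R - Ex \1_(y @^-1` (H j))| <= e / 2.
  apply: le_trans (le_trans (ler_norm _) un).
  rewrite /u (bigD1 (Ordinal jK)) //= lerDl; exact: sumr_ge0.
have Hj : Ex \1_(y @^-1` (H j)) <= j.+1%:R / m.
  by apply: lrcdf_level => //; rewrite divr_ge0 // ltW.
have jm : j.+1%:R / m <= pD + e / 2.
  rewrite ler_pdivrMr // -natr1.
  have : m^-1 * m <= e / 2 * m by rewrite ler_pM2r // ltW.
  by rewrite mulVf ?gt_eqF // => ?; rewrite mulrDl [pD * m]mulrC; lra.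
have n0 : 0 <= n%:R^-1 :> R by rewrite invr_ge0.
apply: (le_trans (ler_wpM2r n0 DH)).
rewrite -[leLHS](subrK (Ex \1_(y @^-1` (H j)))).
apply: le_trans (lerD (le_trans (ler_norm _) uj) (le_trans Hj jm)) _.
by rewrite addrCA -splitr.
Qed.

End GlivenkoCantelli.

(** The upper bound is [empirical_down_set] for the half-line [s <= t]; the lower bound is the same
    lemma for [- y] and the down-set [s < - t], which corresponds to [y > t]. Uniformity in [t]
    comes from treating all down-sets on one event. *)
Lemma Glivenko_Cantelli (y : Om -> R) (ys : nat -> Om -> R) :
  measurable_fun setT y ->
  (forall H : set R, measurable H ->
    as0 P (fun n w => (\sum_(i < n) \1_(ys i @^-1` H) w) / n%:R - Ex \1_(y @^-1` H))) ->
  forall e : R, 0 < e ->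
  {ae P, forall w, \forall n \near \oo, forall t,
    `|(\sum_(i < n) (ys i w <= t)%R%:R) / n%:R - lrcdf y t| <= e}.
Proof.
move=> my lln e e0.
have mN : measurable_fun setT (fun w => - y w) by exact: measurable_funN.
have llnN H : measurable H ->
    as0 P (fun n w => (\sum_(i < n) \1_((fun w => - ys i w) @^-1` H) w) / n%:R - Ex \1_((fun w => - y w) @^-1` H)).
  move=> mH; have mH' : measurable [set t | H (- t)].
    have := @oppr_measurable R setT measurableT H mH; rewrite setTI; exact.
  exact: (lln _ mH').
have A1 := empirical_down_set my lln e0.
have A2 := empirical_down_set (ys := fun i w => - ys i w) mN llnN e0.
apply: filterS2 A1 A2 => w a1 a2.
have pos : \forall n \near \oo, (0 < n)%N by exists 1%N.
apply: filterS3 pos a1 a2 => n n0 h1 h2 t.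
have nR : n%:R != 0 :> R by rewrite pnatr_eq0 -lt0n.
have := h1 [set s | s <= t]; have := h2 [set s | s < - t].
have E1 : \sum_(i < n) \1_(ys i @^-1` [set s | s <= t]) w = \sum_(i < n) (ys i w <= t)%R%:R :> R.
  apply: eq_bigr => i _; rewrite indicE; congr (nat_of_bool _)%:R.
  by apply/idP/idP; rewrite inE.
have E2 : \sum_(i < n) \1_((fun w => - ys i w) @^-1` [set s | s < - t]) w =
    n%:R - \sum_(i < n) (ys i w <= t)%R%:R :> R.
  apply/eqP; rewrite -[X in X%:R - _]card_ord -sumr_const -sumrB; apply/eqP.
  apply: eq_bigr => i _; rewrite indicE.
  have -> : (w \in (fun w => - ys i w) @^-1` [set s | s < - t]) = ~~ (ys i w <= t).
    by rewrite -ltNge -ltrN2; apply/idP/idP; rewrite inE.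
  by case: (_ <= _) => /=; rewrite ?subrr ?subr0.
have E3 : Ex \1_((fun w => - y w) @^-1` [set s | s < - t]) = 1 - lrcdf y t.
  rewrite /lrcdf -(Ex_cst P 1) -ExB; [|exact: bm_cst|exact/bm_ind/measurable_le].
  congr Ex; apply/funext => z; rewrite !indicE.
  have -> : (z \in (fun w => - y w) @^-1` [set s | s < - t]) = ~~ (y z <= t).
    by rewrite -ltNge -ltrN2; apply/idP/idP; rewrite inE.
  have -> : (z \in [set w | y w <= t]) = (y z <= t) by apply/idP/idP; rewrite inE.
  by case: (_ <= _) => /=; rewrite ?subrr ?subr0.
rewrite E1 E2 E3 mulrBl divff //.
have m1 : measurable [set s : R | s <= t].
  by have := @measurable_itv R `]-oo, t]%R; rewrite set_itvE.
have m2 : measurable [set s : R | s < - t].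
  by have := @measurable_itv R `]-oo, (- t)[%R; rewrite set_itvE.
move=> /(_ m2 (fun _ _ => @le_lt_trans _ _ _ _ _)) g2 /(_ m1 (fun _ _ => @le_trans _ _ _ _ _)).
rewrite -/(lrcdf y t) => g1; rewrite ler_norml; apply/andP; split; lra.
Qed.

End Cdf.

(** * Convergence of the normalised rank variation *)

Section RankVariation.
Variable R : realType.
Implicit Types x u y : nat -> R.

Definition rank y n i : nat := count (fun j => y j <= y i) (iota 0 n).

Definition rank_var x u y n : R :=
  adj (fun i j => `|(rank y n i)%:R - (rank y n j)%:R|) (rank_seq x u n).

Lemma natr_count (a : pred nat) n :
  (count a (iota 0 n))%:R = \sum_(j < n) (a j)%:R :> R.
Proof.
rewrite -(big_mkord xpredT (fun j => (a j)%:R : R)) /index_iota subn0.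
elim: (iota 0 n) => [|i s IH]; first by rewrite big_nil.
by rewrite big_cons /= natrD IH.
Qed.

Definition l_sum y n : R :=
  \sum_(i < n) (count (fun j => (y j >= y i)%R) (iota 0 n) *
                (n - count (fun j => (y j >= y i)%R) (iota 0 n)))%N%:R.

Lemma xi_nE x u y n :
  xi_n n x u y = 1 - n%:R * rank_var x u y n / (2 * l_sum y n).
Proof.
rewrite /xi_n /rank_var /adj size_rank_seq; congr (1 - _ * _ / _).
by apply: eq_bigr => k _; rewrite distrC.
Qed.

(** Each [l_i] counts [i] itself, so a zero sum forces [l_i = n] for all [i]; then [y] is constant
    on the sample and all ranks agree. *)
Lemma l_sum_neq0 x u y n : rank_var x u y n != 0 -> l_sum y n != 0.
Proof.
apply: contraNneq => l0; rewrite /rank_var /adj size_rank_seq big1 // => k _.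
have all_le i j : (i < n)%N -> (j < n)%N -> y i <= y j.
  move=> iN jN; have /eqP := l0; rewrite /l_sum psumr_eq0 => [|i' _]; last exact: ler0n.
  move=> /allP /(_ (Ordinal iN) (mem_index_enum _)) /=.
  rewrite pnatr_eq0 muln_eq0 => /orP[|h].
    rewrite -leqn0 leqNgt -has_count => /hasPn /(_ i).
    by rewrite mem_iota add0n iN lexx => /(_ isT).
  have : all (fun j => y i <= y j) (iota 0 n).
    rewrite subn_eq0 in h; rewrite all_count size_iota eqn_leq h andbT.
    by rewrite -[leqRHS](size_iota 0 n) count_size.
  by move=> /allP /(_ j); rewrite mem_iota add0n jN => /(_ isT).
have kn : (k < n)%N by have := ltn_ord k; lia.
have k1n : (k.+1 < n)%N by have := ltn_ord k; lia.
rewrite (_ : rank y n _ = rank y n (nth 0%N (rank_seq x u n) k.+1)) ?subrr ?normr0 //.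
apply: eq_in_count => j; rewrite mem_iota add0n => /andP[_ jn].
by rewrite !all_le ?rank_seq_nth_lt.
Qed.

Lemma xi_ratio x u x' u' y n : rank_var x u y n != 0 ->
  1 - xi_n n x u y != 0 /\
  (xi_n n x' u' y - xi_n n x u y) / (1 - xi_n n x u y) =
  1 - rank_var x' u' y n / rank_var x u y n.
Proof.
move=> V0; have L0 := l_sum_neq0 V0.
have n0 : n%:R != 0 :> R.
  rewrite pnatr_eq0; apply: contraNneq V0 => ->.
  by rewrite /rank_var /adj /rank_seq big_ord0.
rewrite !xi_nE; split; first by rewrite opprB addrC subrK !mulf_neq0 ?invr_neq0 ?mulf_neq0.
field; rewrite V0 L0 /= (_ : _ - _ = n%:R * rank_var x u y n); last by ring.
exact: mulf_neq0.
Qed.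

End RankVariation.

Definition mesh (R : realType) (K : nat) : R := K.+1%:R^-1.

Section Convergence.
Context (R : realType) (d : measure_display) (Om : measurableType d).
Variable P : probability Om R.
Context (dX : measure_display) (TX : measurableType dX).
Variables (X : Om -> TX) (y : Om -> R).
Variables (xs : nat -> Om -> TX) (ys us : nat -> Om -> R).
Hypothesis S : sampling P X y xs ys us.
Let my := sampling_my S.
Variable phi : TX -> R.
Hypothesis isophi : borel_iso phi.
Local Notation Ex := (Ex P).
Local Notation as0 := (as0 P).
Local Notation ranks := (ranks xs us phi).
Local Notation osc := (osc xs us phi).
Local Notation F := (lrcdf P y).

Definition level_event (v : R) : set Om := y @^-1` [set t | v <= F t].

Lemma measurable_level_set v : measurable [set t | v <= F t].
Proof.
rewrite (_ : [set _ | _] = F @^-1` `[v, +oo[).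
  exact: (measurable_preim (measurable_lrcdf P my)).
by apply/seteqP; split => w /=; rewrite in_itv /= andbT.
Qed.

Variable p : R -> TX -> R.
Hypothesis vp : forall v, is_ver P X (level_event v) (p v).

(** Riemann sum over [0, 1] of twice the mean conditional variance at level [v]. The sums are
    compared with one another, without forming the integral. *)
Definition grid_cvar K : R :=
  K.+1%:R^-1 * \sum_(j < K.+1) 2 * cvar P X (level_event (j.+1%:R / K.+1%:R)) (p (j.+1%:R / K.+1%:R)).

Definition rank_var_n n w : R :=
  rank_var (fun i => phi (xs i w)) (us ^~ w) (ys ^~ w) n / n%:R ^+ 2.

(** Turns an almost sure statement into a deterministic one when the conclusion does not mention the
    sample point. *)
Lemma ae_ex (Q : Om -> Prop) : {ae P, forall w, Q w} -> exists w, Q w.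
Proof.
move=> [N [mN PN NQ]]; apply: contrapT => h.
have : N = setT by apply/seteqP; split => // w _; apply: NQ => /= Qw; apply: h; exists w.
move=> NT; have := probT P; rewrite -NT PN => /eqP.
by rewrite eq_sym onee_eq0.
Qed.

Lemma osc_bound (g f : nat -> Om -> R) (e : R) n w : 0 <= e ->
  (forall i, (i < n)%N -> `|g i w - f i w| <= e) ->
  `|osc g n w - osc f n w| <= 2 * e.
Proof.
move=> e0 gf; rewrite /osc -mulrBl normrM [X in _ * X]ger0_norm ?invr_ge0 //.
case: n gf => [|n] gf; first by rewrite invr0 mulr0 mulr_ge0.
rewrite ler_pdivrMr ?ltr0n // /adj -sumrB.
apply: le_trans (ler_norm_sum _ _ _) _.
apply: (@le_trans _ _ (\sum_(k < (size (ranks n.+1 w)).-1) 2 * e)).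
  apply: ler_sum => k _; have kn : (k < n)%N by apply: leq_trans (ltn_ord k) _; rewrite size_rank_seq.
  have := gf _ (rank_seq_nth_lt (fun i => phi (xs i w)) (us ^~ w) (ltnW kn : (k < n.+1)%N)).
  have := gf _ (rank_seq_nth_lt (fun i => phi (xs i w)) (us ^~ w) (kn : (k.+1 < n.+1)%N)).
  rewrite -/(ranks n.+1 w); set a := nth _ _ _; set b := nth _ _ _ => h1 h2.
  apply: le_trans (ler_dist_dist _ _) _.
  rewrite (_ : _ - _ = (g b w - f b w) - (g a w - f a w)); last by ring.
  by apply: le_trans (ler_normB _ _) _; lra.
rewrite sumr_const card_ord size_rank_seq /= -[leLHS]mulr_natr.
by rewrite ler_wpM2l ?mulr_ge0 // ler_nat.
Qed.

Lemma rank_var_nE n w : rank_var_n n w =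
  osc (fun i w => (\sum_(j < n) (ys j w <= ys i w)%R%:R) / n%:R) n w.
Proof.
rewrite /rank_var_n /rank_var /osc -/(ranks n w) expr2 invfM mulrA; congr (_ / _).
rewrite mulrC -adjZ; apply: eq_adj => i j.
rewrite -mulrBl normrM [X in _ = _ * X]ger0_norm ?invr_ge0 // mulrC.
by rewrite /rank !natr_count.
Qed.

Lemma as0_rank_var_osc :
  as0 (fun n w => rank_var_n n w - osc (fun i w => F (ys i w)) n w).
Proof.
move=> e e0; have e2 : 0 < e / 2 by rewrite divr_gt0.
have := Glivenko_Cantelli my (fun H mH => slln_y S mH) e2.
apply: filterS => w; apply: filterS => n h.
rewrite rank_var_nE; have := osc_bound (g := fun i w => (\sum_(j < n) (ys j w <= ys i w)%R%:R) / n%:R)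
   (f := fun i w => F (ys i w)) (ltW e2) (fun i _ => h (ys i w)).
by rewrite mulrCA divff ?mulr1 //.
Qed.

Lemma osc_grid K n w :
  `|osc (fun i w => F (ys i w)) n w -
    K.+1%:R^-1 * \sum_(j < K.+1) osc (fun i w => \1_(ys i @^-1` [set t | j.+1%:R / K.+1%:R <= F t]) w) n w|
  <= 2 * K.+1%:R^-1.
Proof.
have -> : K.+1%:R^-1 * (\sum_(j < K.+1) osc (fun i w => \1_(ys i @^-1` [set t | j.+1%:R / K.+1%:R <= F t]) w) n w)
   = osc (fun i w => level K (F (ys i w))) n w.
  rewrite /osc -mulr_suml -adj_sum mulrA -adjZ; congr (_ / _); apply: eq_adj => i j.
  have inb a k : (w \in ys a @^-1` [set t | k.+1%:R / K.+1%:R <= F t]) =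
    (k.+1%:R / K.+1%:R <= F (ys a w))%R by apply/idP/idP; rewrite inE.
  rewrite /level -mulrBr normrM [X in _ = X * _]ger0_norm ?invr_ge0 //; congr (_ * _).
  (* Once the two values are ordered, all threshold differences have the same sign, so the absolute
     value of their sum is the sum of their absolute values. *)
  rewrite -sumrB; wlog ij : i j / F (ys j w) <= F (ys i w).
    move=> h; case: (leP (F (ys j w)) (F (ys i w))) => [/h //|/ltW /h].
    rewrite -normrN -sumrN; under [in RHS]eq_bigr do rewrite opprB.
    by move=> <-; apply: eq_bigr => k _; rewrite distrC.
  rewrite ger0_norm.
    apply: eq_bigr => k _; rewrite !indicE !inb ger0_norm // subr_ge0 ler_nat.
    by case: (leP _ (F (ys j w))) => // h; rewrite (le_trans h ij).
  apply: sumr_ge0 => k _; rewrite subr_ge0 ler_nat.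
  by case: (leP _ (F (ys j w))) => // h; rewrite (le_trans h ij).
apply: osc_bound; first by rewrite invr_ge0.
by move=> i _; apply: level_approx; exact: lrcdf01.
Qed.

Lemma as0_grid K : as0 (fun n w =>
  K.+1%:R^-1 * (\sum_(j < K.+1) osc (fun i w => \1_(ys i @^-1` [set t | j.+1%:R / K.+1%:R <= F t]) w) n w)
  - grid_cvar K).
Proof.
have h (j : 'I_K.+1) := osc_event S isophi (measurable_level_set (j.+1%:R / K.+1%:R)) (vp _).
apply: as0_le (as0Z K.+1%:R^-1 (as0_sum _ h)) => n w.
by rewrite /grid_cvar -mulrBr -sumrB.
Qed.

Theorem rank_var_cvg : exists c : R,
  as0 (fun n w => rank_var_n n w - c) /\
  forall K, `|c - grid_cvar K| <= 2 * mesh R K.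
Proof.
pose b K : R := 2 * K.+1%:R^-1.
have near_grid K e : 0 < e -> {ae P, forall w, \forall n \near \oo,
    `|osc (fun i w => F (ys i w)) n w - grid_cvar K| <= b K + e}.
  move=> e0; apply: filterS (as0_grid K e0) => w; apply: filterS => n.
  have := osc_grid K n w; rewrite -/(b K).
  set o := osc _ n w; set g := _ * _ => h1 h2.
  rewrite -(subrK g o) -addrA; apply: le_trans (ler_normD _ _) _.
  exact: lerD.
(* Both grid sums approximate the same oscillation at one sample point and a common large [n], which
   gives an inequality between constants. *)
have cc K K' : `|grid_cvar K - grid_cvar K'| <= b K + b K'.
  apply/ler_addgt0Pr => e e0; have e2 : 0 < e / 2 by rewrite divr_gt0.
  have /ae_ex[w []] : {ae P, forall w,
      (\forall n \near \oo, `|osc (fun i w => F (ys i w)) n w - grid_cvar K| <= b K + e / 2) /\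
      (\forall n \near \oo, `|osc (fun i w => F (ys i w)) n w - grid_cvar K'| <= b K' + e / 2)}.
    by apply: filterS2 (near_grid K _ e2) (near_grid K' _ e2) => w.
  move=> [N _ h1] [N' _ h2]; have := h1 (maxn N N') (leq_maxl _ _).
  have := h2 (maxn N N') (leq_maxr _ _); rewrite /=.
  set o := osc _ _ _ => g1 g2.
  rewrite (_ : _ - _ = (o - grid_cvar K') - (o - grid_cvar K)); last by ring.
  by apply: le_trans (ler_normB _ _) _; rewrite [e]splitr; lra.
(* The intervals of radius [b K] about [grid_cvar K] meet pairwise, so the supremum of their left
   ends lies in all of them. *)
pose A := [set z | exists K, z = grid_cvar K - b K].
have ubA K : ubound A (grid_cvar K + b K).
  by move=> _ [K' ->]; have /ler_normlP[] := cc K K'; lra.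
have supA : has_sup A by split; [exists (grid_cvar 0 - b 0); exists 0%N|exists (grid_cvar 0 + b 0)].
have cK K : `|sup A - grid_cvar K| <= b K.
  have h1 : sup A <= grid_cvar K + b K by apply: ge_sup => //; exact: supA.1.
  have h2 : grid_cvar K - b K <= sup A by apply: ub_le_sup; [exact: supA.2|exists K].
  by apply/ler_normlP; split; lra.
exists (sup A); split => //.
have -> : (fun n w => rank_var_n n w - sup A) = (fun n w =>
   (rank_var_n n w - osc (fun i w => F (ys i w)) n w) + (osc (fun i w => F (ys i w)) n w - sup A)).
  by apply/funext => n; apply/funext => w; ring.
apply: as0D; first exact: as0_rank_var_osc.
(* Five parts: two for each of the two uses of [b K], one for [near_grid]. *)
move=> e e0; have e5 : 0 < e / 5 by rewrite divr_gt0.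
have [K hK] := ltr_add_invr (y:=0) (x:=e / 5) e5; rewrite add0r in hK.
have bK : b K <= 2 * (e / 5) by rewrite /b ler_pM2l // ltW.
apply: filterS (near_grid K _ e5) => w; apply: filterS => n h.
have := cK K; rewrite distrC => h'.
rewrite (_ : _ - _ = (osc (fun i w => F (ys i w)) n w - grid_cvar K) + (grid_cvar K - sup A)); last by ring.
apply: le_trans (ler_normD _ _) _.
by lra.
Qed.

End Convergence.

(** * Vanishing of the limit *)

Section ConditionalVariance.
Context (R : realType) (d : measure_display) (Om : measurableType d).
Variable P : probability Om R.
Context (dX : measure_display) (TX : measurableType dX).
Variable X : Om -> TX.
Hypothesis mX : measurable_fun setT X.
Local Notation Ex := (Ex P).
Local Notation bm := (@bm R d Om).

Lemma cvar_ge0 E (p : TX -> R) : 0 <= cvar P X E p.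
Proof. by apply: Ex_ge0 => w; exact: sqr_ge0. Qed.

Lemma cvar_eq0 E (p : TX -> R) : measurable E -> is_ver P X E p ->
  cvar P X E p = 0 -> {ae P, forall w, \1_E w = p (X w)}.
Proof.
move=> mE vp c0; have b := bmX 2 (bmB (bm_ind mE) (ver_bm mX vp)).
apply: filterS (Ex_eq0 b (fun w => sqr_ge0 _) c0) => w /eqP.
by rewrite sqrf_eq0 subr_eq0 => /eqP.
Qed.

(** [q] is then itself a version, with zero residual, and [cvar] does not depend on the version. *)
Lemma ae_cvar0 E (p q : TX -> R) : measurable E -> is_ver P X E p ->
  measurable_fun setT q -> (forall x, 0 <= q x <= 1) ->
  {ae P, forall w, \1_E w = q (X w)} -> cvar P X E p = 0.
Proof.
move=> mE vp mq q01 Eq.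
have bq : bm (fun w => q (X w)) by apply: bm_comp => //; exact: ver_bdd.
have bE := @bm_ind R _ _ _ mE.
have vq : is_ver P X E q.
  split => // C mC; rewrite -[RHS](Ex_cst P 0); apply: Ex_ae; last 2 first.
  - exact: bm_cst.
  - by apply: filterS Eq => w ->; rewrite subrr mul0r.
  - apply: bmM; [exact: bmB|apply: bm_ind; exact: measurable_preim].
rewrite (cvar_uniq mX mE vp vq) -[RHS](Ex_cst P 0); apply: Ex_ae.
- by apply: bmX; exact: bmB.
- exact: bm_cst.
- by apply: filterS Eq => w ->; rewrite subrr expr0n.
Qed.

(** Let [T] be the mean of [(\1_A' - \1_A) (p + p')]. The difference is [T] minus the probability of
    the set difference; as [p + p'] lies in [0, 2], [T] lies between 0 and twice that probability,
    hence the constant 1. *)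
Lemma cvar_cont A A' (p p' : TX -> R) : measurable A -> measurable A' -> A `<=` A' ->
  is_ver P X A p -> is_ver P X A' p' ->
  `|cvar P X A p - cvar P X A' p'| <= Ex \1_(A' `\` A).
Proof.
move=> mA mA' AA' vp vp'.
have [mp p01 _] := vp; have [mp' p01' _] := vp'.
have bp := ver_bm mX vp; have bp' := ver_bm mX vp'.
have bA := @bm_ind R _ _ _ mA; have bA' := @bm_ind R _ _ _ mA'.
have mg : measurable_fun setT (fun x => p x + p' x) by exact: measurable_funD.
have g2 x : 0 <= p x + p' x <= 2.
  by move: (p01 x) (p01' x) => /andP[? ?] /andP[? ?]; apply/andP; split; lra.
have Mg : exists M, forall x, `|p x + p' x| <= M.
  by exists 2 => x; have /andP[? ?] := g2 x; rewrite ger0_norm.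
have bg : bm (fun w => p (X w) + p' (X w)) by exact: bmD.
have e1 := ver_orthoE mX mA vp mg Mg; have e2 := ver_orthoE mX mA' vp' mg Mg.
rewrite !cvarE // Ex_setD_subset //.
have -> : Ex (fun w => p (X w) ^+ 2) = Ex (fun w => p' (X w) ^+ 2) -
   Ex (fun w => (\1_A' w - \1_A w) * (p (X w) + p' (X w))).
  have -> : (fun w => (\1_A' w - \1_A w) * (p (X w) + p' (X w))) =
    (fun w => \1_A' w * (p (X w) + p' (X w)) - \1_A w * (p (X w) + p' (X w))).
    by apply/funext => w; rewrite mulrBl.
  rewrite (ExB P (bmM bA' bg) (bmM bA bg)) e1 e2 -(ExB P (bmM bp' bg) (bmM bp bg)).
  have b3 := bmB (bmM bp' bg) (bmM bp bg).
  rewrite -(ExB P (bmX 2 bp') b3); congr Ex; apply/funext => w; ring.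
have b4 : bm (fun w => (\1_A' w - \1_A w) * (p (X w) + p' (X w))).
  by apply: bmM => //; exact: bmB.
have AA w : \1_A w <= \1_A' w :> R.
  rewrite !indicE ler_nat; case: (boolP (w \in A)) => // wA.
  by rewrite (_ : w \in A') // inE; apply: AA'; rewrite inE in wA.
have l1 : 0 <= Ex (fun w => (\1_A' w - \1_A w) * (p (X w) + p' (X w))).
  by apply: Ex_ge0 => w; rewrite mulr_ge0 ?subr_ge0 //; have /andP[] := g2 (X w).
have bAA := bmB bA' bA.
have l2 : Ex (fun w => (\1_A' w - \1_A w) * (p (X w) + p' (X w))) <= 2 * (Ex \1_A' - Ex \1_A).
  rewrite -ExB // -(ExZ P 2 bAA); apply: Ex_le => [//||w]; first exact: bmM (bm_cst _) bAA.
  by rewrite mulrC ler_wpM2r ?subr_ge0 //; have /andP[] := g2 (X w).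
by apply/ler_normlP; split; lra.
Qed.

End ConditionalVariance.

(** * Vanishing at every grid level *)

Section GridVanishing.
Context (R : realType) (d : measure_display) (Om : measurableType d).
Variable P : probability Om R.
Local Notation Ex := (Ex P).

(* If [D v] were positive at a grid point, left continuity would keep [D] above
   [D v / 2] on arbitrarily many points of a fine grid just below it. *)
Lemma grid_sum_bounded_eq0 (f : Om -> R) (D : R -> R) (B C : R) :
  measurable_fun setT f -> 0 <= B ->
  (forall v, 0 <= D v) ->
  (forall v v', v' <= v -> `|D v - D v'| <= B * Ex \1_[set w | v' <= f w < v]) ->
  (forall K, \sum_(j < K.+1) D (j.+1%:R / K.+1%:R) <= C) ->
  forall a b : nat, (a <= b)%N -> D (a.+1%:R / b.+1%:R) = 0.
Proof.
move=> mf B0 D0 Dc DC a b ab; set v := _ / _.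
apply/eqP; rewrite eq_le D0 andbT leNgt; apply/negP => Dv.
have mI (s t : R) : measurable [set w | s <= f w < t].
  rewrite (_ : [set _ | _] = f @^-1` `[s, t[).
    exact: (measurable_preim mf).
  by apply/seteqP; split => w /=; rewrite in_itv.
have B1 : 0 < B + 1 by rewrite ltr_wpDl.
(* Chosen so that [B] times it is at most [D v / 2]; [B + 1] avoids a zero denominator. *)
have e0 : 0 < D v / (2 * (B + 1)) by rewrite divr_gt0 // mulr_gt0.
have [] := @Ex_cap0 _ _ _ P (fun n => [set w | v - n.+1%:R^-1 <= f w < v]) (fun n => mI _ _) _ _ _ e0.
- move=> n w /= /andP[h1 ->]; rewrite andbT; apply: le_trans h1.
  by rewrite lerD2l lerN2 lef_pV2 ?posrE ?ltr0n // ler_nat.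
- apply/seteqP; split => w //= h; have /andP[_ fv] := h 0%N I.
  have vf0 : 0 < v - f w by rewrite subr_gt0.
  have [k hk] := ltr_add_invr (y:=0) (x:=v - f w) vf0.
  by have /andP[+ _] := h k I; rewrite add0r in hk; rewrite lerBlDr -lerBlDl leNgt hk.
move=> n0 /(_ n0 (leqnn n0)) hn0.
have [N hN] : exists N : nat, 2 * C / D v < N%:R.
  by exists (Num.truncn (2 * C / D v)).+1; rewrite truncnS_gt.
case: N hN => [|N hN].
  have C0 : 0 <= C by apply: le_trans (DC 0%N); apply: sumr_ge0 => j _.
  by rewrite ltNge divr_ge0 ?mulr_ge0 // ltW.
(* The grid of step [1 / b.+1] is refined so that [v] is still a grid point, [T / K.+1]. The [N.+1]
   grid points ending at [v] lie within [1 / n0.+1] of it, where [D] is at least [D v / 2]; as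
   [N.+1 > 2 C / D v], their sum exceeds [C]. *)
pose M := (N.+1 * n0.+1)%N.
have M0 : (0 < M)%N by [].
pose K := (b.+1 * M).-1.
have KE : K.+1 = (b.+1 * M)%N by rewrite prednK // muln_gt0.
have := DC K; apply/negP; rewrite -ltNge.
pose T := (a.+1 * M)%N.
have TK : (T <= K.+1)%N by rewrite KE leq_mul2r ltnS ab orbT.
have NT : (N.+1 <= T)%N.
  by rewrite /T /M mulnCA leq_pmulr // muln_gt0.
rewrite -(big_mkord xpredT (fun j => D (j.+1%:R / K.+1%:R))).
rewrite (big_cat_nat (n := T)) //= (big_cat_nat (n := (T - N.+1)%N)) ?leq_subr //=.
have S1 : 0 <= \sum_(0 <= i < T - N.+1) D (i.+1%:R / K.+1%:R) by exact: sumr_ge0.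
have S3 : 0 <= \sum_(T <= i < K.+1) D (i.+1%:R / K.+1%:R) by exact: sumr_ge0.
suff S2 : N.+1%:R * (D v / 2) <= \sum_(T - N.+1 <= i < T) D (i.+1%:R / K.+1%:R).
  have : C < N.+1%:R * (D v / 2).
    by move: hN; rewrite ltr_pdivrMr // mulrA ltr_pdivlMr // [C * 2]mulrC.
  by lra.
have -> : N.+1%:R * (D v / 2) = \sum_(T - N.+1 <= i < T) (D v / 2).
  by rewrite sumr_const_nat subKn // -[RHS]mulr_natl.
apply: ler_sum_nat => i /andP[i1 i2].
have K0 : 0 < K.+1%:R :> R by rewrite ltr0n.
have vE : v = T%:R / K.+1%:R.
  have M0R : M%:R != 0 :> R by rewrite pnatr_eq0 -lt0n.
  by rewrite /v /T KE [(a.+1 * M)%:R]natrM [(b.+1 * M)%:R]natrM -mulf_div divff // mulr1.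
have iv : i.+1%:R / K.+1%:R <= v by rewrite vE ler_pM2r ?invr_gt0 // ler_nat.
have vi : v - n0.+1%:R^-1 <= i.+1%:R / K.+1%:R.
  rewrite lerBlDr -lerBlDl vE -mulrBl -natrB //.
  rewrite ler_pdivrMr // ler_pdivlMl ?ltr0n // -natrM ler_nat KE /M.
  have : (T - i.+1 <= N.+1)%N.
    by rewrite leq_subLR addnC -leq_subLR; exact: leq_trans i1 (leqnSn i).
  by move=> h; apply: leq_trans (leq_mul (leqnn _) h) _; rewrite [(n0.+1 * _)%N]mulnC leq_pmull.
have := Dc _ _ iv.
have sub : Ex \1_[set w | i.+1%:R / K.+1%:R <= f w < v] <= D v / (2 * (B + 1)).
  apply: le_trans hn0; apply: Ex_subset; [exact: mI|exact: mI|].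
  by move=> w /= /andP[h ->]; rewrite (le_trans vi h).
have : B * Ex \1_[set w | i.+1%:R / K.+1%:R <= f w < v] <= D v / 2.
  apply: le_trans (ler_wpM2l B0 sub) _.
  have -> : B * (D v / (2 * (B + 1))) = (D v / 2) * (B / (B + 1)).
    by field; rewrite gt_eqF.
  by rewrite ler_piMr ?divr_ge0 // ler_pdivrMr // mul1r lerDl.
move=> h1 /ler_normlP[_ h2].
by have := le_trans h2 h1; lra.
Qed.

End GridVanishing.

(** With [a <= b] these are the rationals of (0, 1], a countable set of levels over which almost
    sure statements can be collected. *)
Definition grid_pt (R : realType) (a b : nat) : R := a.+1%:R / b.+1%:R.

(** * Recovering the response from its level events *)

Section LevelEvents.
Context (R : realType) (d : measure_display) (Om : measurableType d).
Variable P : probability Om R.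
Variable y : Om -> R.
Hypothesis my : measurable_fun setT y.
Local Notation Ex := (Ex P).
Local Notation bm := (@bm R d Om).
Local Notation F := (lrcdf P y).
Local Notation lev := (level_event P y).
Local Notation gr := (grid_pt R).

Lemma measurable_lev v : measurable (lev v).
Proof.
apply: (measurable_preim my); rewrite (_ : [set _ | _] = F @^-1` `[v, +oo[).
  exact: (measurable_preim (measurable_lrcdf P my)).
by apply/seteqP; split => w /=; rewrite in_itv /= andbT.
Qed.

(** The left limit at [t] of the distribution function. *)
Definition below (t : R) : R := Ex \1_[set w | y w < t].

Lemma measurable_lt t : measurable [set w | y w < t].
Proof.
rewrite (_ : [set _ | _] = y @^-1` `]-oo, t[).
  exact: (measurable_preim my).
by apply/seteqP; split => w /=; rewrite in_itv.
Qed.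

Lemma grid_between (s t : R) : 0 <= s -> s < t -> t <= 1 ->
  exists a b, [/\ (a <= b)%N, s < gr a b & gr a b <= t].
Proof.
move=> s0 st t1; have st0 : 0 < t - s by rewrite subr_gt0.
have [K hK] := ltr_add_invr (y:=0) (x:=t - s) st0; rewrite add0r in hK.
have K0 : 0 < K.+1%:R :> R by rewrite ltr0n.
have Kt0 : 0 <= K.+1%:R * t by rewrite mulr_ge0 ?ltW //; exact: le_lt_trans s0 st.
have /andP[j1 j2] := truncn_itv Kt0; set j := Num.truncn _ in j1 j2.
have sj : s < j%:R / K.+1%:R.
  have tj : t < j%:R / K.+1%:R + K.+1%:R^-1.
    by rewrite -[X in _ + X]mul1r -mulrDl natr1 ltr_pdivlMr // mulrC.
  by move: hK tj; move: (K.+1%:R^-1) (j%:R) => q' q; lra.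
case: j sj j1 j2 => [|a] sj j1 j2.
  by move: sj; rewrite mul0r ltNge s0.
exists a, K; split => //; last by rewrite ler_pdivrMr // mulrC.
have : a.+1%:R <= K.+1%:R :> R by apply: le_trans j1 _; rewrite ler_piMr // ltW.
by rewrite ler_nat.
Qed.

Lemma below01 t : 0 <= below t <= 1.
Proof. exact/Ex_ind01/measurable_lt. Qed.

(* [t <= y] and [P (y < t) < F y] differ by a null event, since
   [P (F y <= v) <= v]. *)
Lemma ge_ae_level t : {ae P, forall w, (t <= y w) = (below t < F (y w))}.
Proof.
have sub w : below t < F (y w) -> t <= y w.
  apply: contraTT; rewrite -ltNge -leNgt => yt; apply: Ex_subset.
  - exact: measurable_le.
  - exact: measurable_lt.
  - by move=> z /= zy; exact: le_lt_trans yt.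
pose N := [set w | F (y w) <= below t] `\` [set w | y w < t].
have mFb v : measurable [set w | F (y w) <= v].
  have -> : [set w | F (y w) <= v] = (F \o y) @^-1` `]-oo, v].
    by apply/seteqP; split => w /=; rewrite in_itv.
  exact: (measurable_preim (measurableT_comp (measurable_lrcdf P my) my)).
have mN : measurable N by apply: measurableD => //; exact: measurable_lt.
have ltFb w : y w < t -> F (y w) <= below t.
  move=> yt; apply: Ex_subset.
  - exact: measurable_le.
  - exact: measurable_lt.
  - by move=> z /= zy; exact: le_lt_trans yt.
have ub : Ex \1_[set w | F (y w) <= below t] <= below t.
  apply/ler_addgt0Pr => e e0; have b0 : 0 <= below t + e.
    by apply: addr_ge0; [have /andP[] := below01 t|exact: ltW].
  apply: le_trans (lrcdf_level P my b0); apply: Ex_subset => //.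
    exact: (measurable_preim my (measurable_lrcdf_lt P my _)).
  by move=> w /= /le_lt_trans; apply; rewrite ltrDl.
have EN : Ex \1_N = 0.
  apply/eqP; rewrite eq_le; apply/andP; split; last by apply: Ex_ge0 => w; rewrite indicE.
  by rewrite Ex_setD_subset ?subr_le0 //; exact: measurable_lt.
exists N; split => //; first by rewrite Ex_indE // EN.
move=> w /= h; have [yt|ty] := ltP (y w) t.
  exfalso; apply: h; rewrite leNgt yt /=; apply/esym/negbTE.
  by rewrite -leNgt; exact: ltFb.
split; last by apply/negP; rewrite -leNgt.
by rewrite /= leNgt; apply/negP => bF; apply: h; rewrite ty bF.
Qed.

Section Recover.
Context (dX : measure_display) (TX : measurableType dX).
Variables (X : Om -> TX) (q : R -> TX -> R).
Hypothesis mq : forall v, measurable_fun setT (q v).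
Hypothesis hq : forall a b, (a <= b)%N ->
  {ae P, forall w, \1_(lev (gr a b)) w = q (gr a b) (X w)}.

(** For a rational [r], the event [r <= y] is almost surely the union of the level events at grid
    points above [below r], and each of these is read off [X] as [q = 1]. Then [y] is the supremum
    of the rationals not exceeding it. *)
Lemma recover_real : exists g : TX -> R, measurable_fun setT g /\
  {ae P, forall w, y w = g (X w)}.
Proof.
pose Ct k := \bigcup_a \bigcup_(b in [set b | (a <= b)%N /\ below (ratn R k) < gr a b])
  [set x | q (gr a b) x = 1].
have mCt k : measurable (Ct k).
  apply: bigcup_measurable => a _; apply: bigcup_measurable => b _.
  rewrite (_ : [set _ | _] = q (gr a b) @^-1` [set 1]) //.
  exact: (measurable_preim (mq _) (measurable_set1 _)).
pose h k x : \bar R := if x \in Ct k then (ratn R k)%:E else -oo%E.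
have mh k : measurable_fun setT (h k).
  apply: measurable_fun_ifT; [|exact: measurable_cst|exact: measurable_cst].
  apply: (measurable_fun_bool true); rewrite setTI.
  rewrite (_ : _ @^-1` _ = Ct k) //.
  by apply/seteqP; split => x /=; [exact: set_mem|exact: mem_set].
(* The supremum lives in the extended reals; where it is infinite, which happens only on a null
   event, [fine] returns 0. *)
exists (fun x => fine (esups (h ^~ x) 0%N)); split.
  apply: measurableT_comp => //; exact: measurable_fun_esups.
have A1 : {ae P, forall w, forall a b, (a <= b)%N ->
    \1_(lev (gr a b)) w = q (gr a b) (X w)}.
  apply: ae_foralln => a; apply: ae_foralln => b.
  have [ab|ab] := leqP a b; last by apply: aeW.
  by apply: filterS (hq ab) => w.
have A2 : {ae P, forall w, forall k, (ratn R k <= y w) = (below (ratn R k) < F (y w))}.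
  by apply: ae_foralln => k; exact: ge_ae_level.
apply: filterS2 A1 A2 => w h1 h2.
have Ck k : (X w \in Ct k) = (ratn R k <= y w).
  rewrite h2; apply/idP/idP.
    rewrite inE => -[a _ [b [ab bl]]] /=; rewrite -h1 // indicE.
    have [+ _|_] := boolP (w \in _); last by move=> /eqP; rewrite eq_sym oner_eq0.
    by rewrite inE /level_event /=; exact: lt_le_trans.
  move=> bF; have /andP[b0 _] := below01 (ratn R k).
  have /andP[_ F1] := lrcdf01 P my (y w).
  have [a [b [ab g1 g2]]] := grid_between b0 bF F1.
  rewrite inE; exists a => //; exists b => //=; rewrite -h1 // indicE.
  by rewrite (_ : _ \in _) // inE.
have -> : esups (h ^~ (X w)) 0%N = (y w)%:E; last by [].
apply/eqP; rewrite eq_le; apply/andP; split.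
  apply: ge_ereal_sup => _ [k _ <-]; rewrite /h Ck.
  by case: (leP (ratn R k) (y w)) => // ky; rewrite ?leNye ?lee_fin.
rewrite leNgt; apply/negP => lt.
have : exists s : R, (esups (h ^~ (X w)) 0%N < s%:E)%E /\ s < y w.
  move: lt; case: (esups _ _) => [r| |] //=.
    rewrite lte_fin => rw; exists ((r + y w) / 2); rewrite lte_fin; split; lra.
  by move=> _; exists (y w - 1); rewrite ltNyr; split => //; lra.
move=> [s [s1 s2]]; have [k /andP[k1 k2]] := ratnP s2.
have : ((ratn R k)%:E <= esups (h ^~ (X w)) 0%N)%E.
  apply: ereal_sup_ubound; exists k => //=; by rewrite /h Ck (ltW k2).
by move=> /le_lt_trans /(_ s1); rewrite lte_fin ltNge (ltW k1).
Qed.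

End Recover.
End LevelEvents.

(** * Level events as a determining class for the response *)

Section LevelOrtho.
Context (R : realType) (d : measure_display) (Om : measurableType d).
Variable P : probability Om R.
Variable y : Om -> R.
Hypothesis my : measurable_fun setT y.
Local Notation Ex := (Ex P).
Local Notation bm := (@bm R d Om).
Local Notation F := (lrcdf P y).
Local Notation lev := (level_event P y).
Local Notation gr := (grid_pt R).

(** Level events are nested, hence a pi-system. Up to null events they yield every ray [t <= y], and
    the rays form a second pi-system, which generates the sigma-algebra of [y]. *)
Lemma level_ortho (e : Om -> R) : bm e -> Ex e = 0 ->
  (forall a b, (a <= b)%N -> Ex (fun w => e w * \1_(lev (gr a b)) w) = 0) ->
  forall D : set R, measurable D -> Ex (fun w => e w * \1_(y @^-1` D) w) = 0.
Proof.
move=> be e0 elev.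
have eT : Ex (fun w => e w * \1_setT w) = 0.
  by rewrite -[RHS]e0; congr Ex; apply/funext => w; rewrite indicT mulr1.
pose G := [set A : set Om | A = setT \/ exists a b, (a <= b)%N /\ A = lev (gr a b)].
have GI : setI_closed G.
  move=> _ _ [->|[a [b [ab ->]]]] [->|[a' [b' [ab' ->]]]].
  - by left; rewrite setTI.
  - by right; exists a', b'; rewrite setTI.
  - by right; exists a, b; rewrite setIT.
  have [h|h] := leP (gr a b) (gr a' b'); right.
    exists a', b'; split => //; apply/seteqP; split => w /=; first by move=> [].
    by move=> h'; split => //; rewrite /level_event /=; exact: le_trans h'.
  exists a, b; split => //; apply/seteqP; split => w /=; first by move=> [].
  by move=> h'; split => //; rewrite /level_event /=; exact: le_trans (ltW h) h'.
have mG : G `<=` measurable.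
  by move=> _ [->|[a [b [ab ->]]]]; [exact: measurableT|exact: measurable_lev].
have eG A : G A -> Ex (fun w => e w * \1_A w) = 0.
  by move=> [->|[a [b [ab ->]]]] //; exact: elev.
have GT : G setT by left.
have eS := ortho_set be mG GI GT eG.
have ray t : Ex (fun w => e w * \1_[set w | t <= y w] w) = 0.
  (* Equal to the ray [t <= y] up to a null event, by [ge_ae_level] and [grid_between]. *)
  pose E := \bigcup_a \bigcup_b
    (if (a <= b)%N && (below P y t < gr a b) then lev (gr a b) else set0).
  have sE : <<s G >> E.
    apply: sigma_algebra_bigcup => a; apply: sigma_algebra_bigcup => b.
    case: ifPn => [/andP[ab _]|_]; last exact: sigma_algebra0.
    by apply: sub_sigma_algebra; right; exists a, b.
  have [mE EE] := eS _ sE; rewrite -[RHS]EE; apply: Ex_ae.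
  - by apply: bmM => //; apply: bm_ind; exact: measurable_ge.
  - by apply: bmM => //; exact: bm_ind.
  apply: filterS (ge_ae_level P my t) => w tw; congr (_ * _); rewrite !indicE.
  congr (nat_of_bool _)%:R; apply/idP/idP; rewrite !inE /= tw.
    move=> bF; have /andP[b0 _] := below01 P my t; have /andP[_ F1] := lrcdf01 P my (y w).
    have [a [b [ab g1 g2]]] := grid_between b0 bF F1.
    by exists a => //; exists b => //; rewrite ab g1.
  move=> [a _ [b _]]; case: ifP => // /andP[ab g1] /= g2.
  exact: lt_le_trans g1 g2.
pose G2 := [set A : set Om | A = setT \/ exists t, A = [set w | t <= y w]].
have G2I : setI_closed G2.
  move=> _ _ [->|[t ->]] [->|[t' ->]].
  - by left; rewrite setTI.
  - by right; exists t'; rewrite setTI.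
  - by right; exists t; rewrite setIT.
  right; exists (Num.max t t'); apply/seteqP; split => w /=.
    by move=> [t1 t2]; rewrite ge_max t1.
  by rewrite ge_max => /andP[].
have mG2 : G2 `<=` measurable.
  by move=> _ [->|[t ->]]; [exact: measurableT|exact: measurable_ge].
have eG2 A : G2 A -> Ex (fun w => e w * \1_A w) = 0.
  by move=> [->|[t ->]] //; exact: ray.
have G2T : G2 setT by left.
have eS2 := ortho_set be mG2 G2I G2T eG2.
have yG : measurable_fun setT (y : g_sigma_algebraType G2 -> R).
  apply: (measurability _ (RGenCInfty.measurableE R)) => //.
  move=> _ [_ [t ->] <-]; rewrite setTI; apply: sub_sigma_algebra; right; exists t.
  by apply/seteqP; split => w /=; rewrite in_itv /= andbT.
move=> D mD; have [|_ //] := eS2 (y @^-1` D).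
by have := yG measurableT D mD; rewrite setTI.
Qed.

End LevelOrtho.

(** * Transfer through a Borel isomorphism *)

Section BorelIso.
Context (R : realType) (dY : measure_display) (TY : measurableType dY).
Variable psi : TY -> R.
Hypothesis isopsi : borel_iso psi.

(** [g] is [g0] followed by the inverse of [psi], with default [point] off the range. The preimage
    of a set thus splits into the part reached through its image under [psi] and, if the set
    contains [point], the preimage of the complement of the range. *)
Lemma borel_iso_factor (dX : measure_display) (TX : measurableType dX) (g0 : TX -> R) :
  measurable_fun setT g0 -> exists2 g : TX -> TY, measurable_fun setT g &
  forall x t, g0 x = psi t -> g x = t.
Proof.
have [mpsi ipsi rpsi opsi] := isopsi; move=> mg0.
pose inv r : TY := if pselect (exists t, psi t = r) is left e then projT1 (cid e) else point.
have invK t : inv (psi t) = t.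
  rewrite /inv; case: pselect => [e|h]; last by exfalso; apply: h; exists t.
  by case: cid => t' /= /ipsi.
exists (inv \o g0); last by move=> x t /= ->.
move=> _ A mA; rewrite setTI.
have -> : (inv \o g0) @^-1` A =
    g0 @^-1` (psi @` A) `|` (if `[< A point >] then g0 @^-1` (~` range psi) else set0).
  apply/seteqP; split => x /=.
    move=> Ax; have [[t tx]|h] := pselect (exists t, psi t = g0 x).
      by left; exists t => //; rewrite -tx invK in Ax.
    right; move: Ax; rewrite /inv; case: pselect => // _ Ap.
    rewrite (asboolT Ap) => -[t _ tx]; by apply: h; exists t.
  move=> [[t At tx]|]; first by rewrite -tx invK.
  case: asboolP => // Ap /= h; rewrite /inv; case: pselect => // e.
  by exfalso; apply: h; case: e => t tx; exists t.
apply: measurableU; first exact: (measurable_preim mg0 (opsi _ mA)).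
case: ifP => _; last exact: measurable0.
exact: (measurable_preim mg0 (measurableC rpsi)).
Qed.

Lemma borel_iso_preim (Om : Type) (Y : Om -> TY) (A : set TY) :
  Y @^-1` A = (psi \o Y) @^-1` (psi @` A).
Proof.
have [_ ipsi _ _] := isopsi; apply/seteqP; split => w /=; first by move=> Aw; exists (Y w).
by move=> [t At /ipsi <-].
Qed.

End BorelIso.

Section Refinement.
Context (R : realType) (d : measure_display) (Om : measurableType d).
Variable P : probability Om R.
Context (dX : measure_display) (TX : measurableType dX).
Context (dW : measure_display) (TW : measurableType dW).
Variables (W : Om -> TW) (f : TW -> TX).
Hypothesis mW : measurable_fun setT W.
Hypothesis mf : measurable_fun setT f.
Local Notation Ex := (Ex P).
Let mX : measurable_fun setT (f \o W). Proof. exact: measurableT_comp. Qed.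

(** [p (f (W))] is the orthogonal projection of both [\1_E] and [q (W)] on functions of [f (W)], so
    the loss of variance under finer conditioning is a squared distance. This makes its vanishing
    informative. *)
Lemma cvar_pythagoras E p q : measurable E -> is_ver P (f \o W) E p -> is_ver P W E q ->
  cvar P (f \o W) E p - cvar P W E q = Ex (fun w => (q (W w) - p (f (W w))) ^+ 2).
Proof.
move=> mE vp vq; have [mp p01 _] := vp.
have bp := ver_bm mX vp; have bq := ver_bm mW vq.
have mpf : measurable_fun setT (fun z => p (f z)) by exact: measurableT_comp.
have Mpf : exists M, forall z, `|p (f z)| <= M by have [M hM] := ver_bdd p01; exists M.
have e1 := ver_orthoE mW mE vq mpf Mpf.
have e2 := ver_orthoE mX mE vp mp (ver_bdd p01).
have swap (a b c : R) : a - b - (a - c) = c - b by ring.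
rewrite !cvarE // swap.
have -> : (fun w => (q (W w) - p (f (W w))) ^+ 2) = (fun w =>
   (q (W w) ^+ 2 - q (W w) * p (f (W w))) - (q (W w) * p (f (W w)) - p (f (W w)) * p (f (W w)))).
  by apply/funext => w; ring.
have bpp : bm (fun w => p (f (W w))) by exact: bp.
have b1 := bmB (bmX 2 bq) (bmM bq bpp).
have b2 := bmB (bmM bq bpp) (bmM bpp bpp).
rewrite (ExB P b1 b2) (ExB P (bmX 2 bq) (bmM bq bpp)) (ExB P (bmM bq bpp) (bmM bpp bpp)).
rewrite -e1; have -> : Ex (fun w => \1_E w * p (f (W w))) = Ex (fun w => p (f (W w)) * p (f (W w))).
  exact: e2.
by rewrite subrr subr0; congr (_ - _).
Qed.

End Refinement.

(** * Conditional independence *)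

Section CondIndep.
Context (R : realType) (d : measure_display) (Om : measurableType d).
Variable P : probability Om R.
Context (dX : measure_display) (TX : measurableType dX)
  (dY : measure_display) (TY : measurableType dY)
  (dZ : measure_display) (TZ : measurableType dZ).
Variables (X : Om -> TX) (Y : Om -> TY) (Z : Om -> TZ) (psi : TY -> R).
Hypothesis mX : measurable_fun setT X.
Hypothesis mY : measurable_fun setT Y.
Hypothesis mZ : measurable_fun setT Z.
Hypothesis isopsi : borel_iso psi.
Local Notation Ex := (Ex P).
Local Notation bm := (@bm R d Om).
Local Notation y := (psi \o Y).
Local Notation W := (fun w => (X w, Z w)).
Local Notation lev := (level_event P y).
Local Notation gr := (grid_pt R).

Let mpsi : measurable_fun setT psi. Proof. by case: isopsi. Qed.
Let my : measurable_fun setT y. Proof. exact: measurableT_comp. Qed.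
Let mW : measurable_fun setT W. Proof. exact: measurable_fun_pair. Qed.
Let mlev v : measurable (lev v). Proof. exact: measurable_lev. Qed.

Variables (p : R -> TX -> R) (q : R -> TX * TZ -> R).
Hypothesis vp : forall v, is_ver P X (lev v) (p v).
Hypothesis vq : forall v, is_ver P W (lev v) (q v).

Let ind_bdd (T : Type) (C : set T) : exists M, forall x, `|\1_C x : R| <= M.
Proof. by exists 1 => x; rewrite indicE; case: (_ \in _); rewrite ?normr0 ?normr1. Qed.

Let indM_bdd (T : Type) (g : T -> R) (C : set T) : (forall x, 0 <= g x <= 1) ->
  exists M, forall x, `|g x * \1_C x| <= M.
Proof.
move=> g01; exists 1 => x; rewrite normrM indicE; have /andP[? ?] := g01 x.
by rewrite ger0_norm //; case: (_ \in _); rewrite ?normr0 ?normr1 ?mulr0 ?mulr1.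
Qed.

Let mind (dT : measure_display) (T : measurableType dT) (C : set T) :
  measurable C -> measurable_fun setT (\1_C : T -> R).
Proof. by move=> mC; exact: measurable_indic. Qed.

(** Given [W], a level event has probability [q = p], a function of [X] alone; it is thus orthogonal
    to what [Z] adds to [X], and [level_ortho] carries this over to every event of [Y]. *)
Lemma cond_indep_of_versions : (forall a b, (a <= b)%N ->
    {ae P, forall w, q (gr a b) (W w) = p (gr a b) (X w)}) ->
  cond_indep P X Y Z.
Proof.
move=> pq A B mA mB.
have mYA := measurable_preim mY mA; have mZB := measurable_preim mZ mB.
have [pA vA] := ver_exists P mX mYA; have [rB vB] := ver_exists P mX mZB.
have [mpA pA01 _] := vA; have [mrB rB01 _] := vB.
have bA := @bm_ind R _ _ _ mYA; have bB := @bm_ind R _ _ _ mZB.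
have brB := ver_bm mX vB; have bpA := ver_bm mX vA.
have key (C : set TX) : measurable C ->
  Ex (fun w => \1_(Y @^-1` A) w * (\1_(Z @^-1` B) w * \1_(X @^-1` C) w)) =
  Ex (fun w => \1_(Y @^-1` A) w * (rB (X w) * \1_C (X w))).
  move=> mC; have mXC := measurable_preim mX mC; have bC := @bm_ind R _ _ _ mXC.
  (* The part of the event of [Z] in [B] that [X] does not explain, localised to [X] in [C]; [key]
     amounts to its orthogonality to the event of [Y] in [A]. *)
  pose e w := (\1_(Z @^-1` B) w - rB (X w)) * \1_C (X w).
  have be : bm e by apply: bmM => //; exact: bmB.
  have e0 : Ex e = 0 by apply: (ver_ortho mX mZB vB); [exact: mind|exact: ind_bdd].
  have : Ex (fun w => e w * \1_(y @^-1` (psi @` A)) w) = 0.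
    have oA : measurable (psi @` A) by case: isopsi => _ _ _; apply.
    apply: (level_ortho my be e0) oA => a b ab; set v := gr a b.
    have blv := @bm_ind R _ _ _ (mlev v).
    have [mp p01 _] := vp v.
    have h1 : Ex (fun w => \1_(lev v) w * \1_(C `*` B) (W w)) =
              Ex (fun w => q v (W w) * \1_(C `*` B) (W w)).
      apply: (ver_orthoE mW (mlev v) (vq v)); last exact: ind_bdd.
      by apply: mind; exact: measurableX.
    have h2 : Ex (fun w => q v (W w) * \1_(C `*` B) (W w)) =
              Ex (fun w => p v (X w) * \1_(C `*` B) (W w)).
      have bCB : bm (fun w => \1_(C `*` B) (W w)).
        by apply: (bm_comp mW); [apply: mind; exact: measurableX|exact: ind_bdd].
      apply: Ex_ae; [exact: bmM (ver_bm mW (vq v)) bCB|exact: bmM (ver_bm mX (vp v)) bCB|].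
      by apply: filterS (pq a b ab) => w ->.
    have CB w : \1_(C `*` B) (W w) = \1_C (X w) * \1_(Z @^-1` B) w :> R.
      rewrite !indicE; have -> : (W w \in C `*` B) = (X w \in C) && (w \in Z @^-1` B).
        by apply/idP/andP; rewrite !inE => -[].
      by rewrite -natrM mulnb.
    have h3 : Ex (fun w => \1_(Z @^-1` B) w * (p v (X w) * \1_C (X w))) =
              Ex (fun w => rB (X w) * (p v (X w) * \1_C (X w))).
      apply: (ver_orthoE mX mZB vB (g := fun x => p v x * \1_C x)).
        by apply: measurable_funM => //; exact: mind.
      exact: indM_bdd.
    have h4 : Ex (fun w => \1_(lev v) w * (rB (X w) * \1_C (X w))) =
              Ex (fun w => p v (X w) * (rB (X w) * \1_C (X w))).
      apply: (ver_orthoE mX (mlev v) (vp v) (g := fun x => rB x * \1_C x)).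
        by apply: measurable_funM => //; exact: mind.
      exact: indM_bdd.
    have b1 : bm (fun w => \1_(lev v) w * \1_(C `*` B) (W w)).
      by apply: bmM => //; apply: (bm_comp mW); [apply: mind; exact: measurableX|exact: ind_bdd].
    have b2 : bm (fun w => \1_(lev v) w * (rB (X w) * \1_C (X w))) by do 2 apply: bmM => //.
    transitivity (Ex (fun w => \1_(lev v) w * \1_(C `*` B) (W w) -
                               \1_(lev v) w * (rB (X w) * \1_C (X w)))).
      by congr Ex; apply/funext => w; rewrite /e CB; ring.
    rewrite (ExB P b1 b2) h1 h2 h4.
    apply/eqP; rewrite subr_eq0; apply/eqP.
    transitivity (Ex (fun w => \1_(Z @^-1` B) w * (p v (X w) * \1_C (X w)))).
      by congr Ex; apply/funext => w; rewrite CB; ring.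
    by rewrite h3; congr Ex; apply/funext => w; ring.
  rewrite -(borel_iso_preim isopsi) => h.
  have b1 : bm (fun w => \1_(Y @^-1` A) w * (\1_(Z @^-1` B) w * \1_(X @^-1` C) w)).
    by do 2 apply: bmM => //.
  have b2 : bm (fun w => \1_(Y @^-1` A) w * (rB (X w) * \1_C (X w))) by do 2 apply: bmM => //.
  apply/eqP; rewrite -subr_eq0 -(ExB P b1 b2) -[X in _ == X]h; apply/eqP.
  by congr Ex; apply/funext => w; rewrite /e; ring.
exists pA, rB; split; [exact/is_verE|exact/is_verE|].
have mI : measurable (Y @^-1` A `&` Z @^-1` B) by exact: measurableI.
apply/is_verE => //; split; first exact: measurable_funM.
  move=> x; have /andP[a0 a1] := pA01 x; have /andP[r0 r1] := rB01 x.
  by rewrite mulr_ge0 //= mulr_ile1.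
move=> C mC; have mXC := measurable_preim mX mC; have bC := @bm_ind R _ _ _ mXC.
have h5 : Ex (fun w => \1_(Y @^-1` A) w * (rB (X w) * \1_C (X w))) =
          Ex (fun w => pA (X w) * (rB (X w) * \1_C (X w))).
  apply: (ver_orthoE mX mYA vA (g := fun x => rB x * \1_C x)).
    by apply: measurable_funM => //; exact: mind.
  exact: indM_bdd.
have b1 : bm (fun w => \1_(Y @^-1` A) w * (\1_(Z @^-1` B) w * \1_(X @^-1` C) w)).
  by do 2 apply: bmM => //.
have b2 : bm (fun w => pA (X w) * (rB (X w) * \1_C (X w))) by do 2 apply: bmM => //.
transitivity (Ex (fun w => \1_(Y @^-1` A) w * (\1_(Z @^-1` B) w * \1_(X @^-1` C) w) -
                           pA (X w) * (rB (X w) * \1_C (X w)))).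
  by congr Ex; apply/funext => w; rewrite indicI /=; ring.
by rewrite (ExB P b1 b2) (key C mC) h5 subrr.
Qed.

(** Under conditional independence [p v], read through the first coordinate, is a version given
    [(X, Z)] too: its residual is orthogonal to rectangles, which generate the sigma-algebra of
    [(X, Z)]. All versions share one [cvar]. *)
Lemma cond_indep_cvar v : cond_indep P X Y Z ->
  cvar P X (lev v) (p v) = cvar P W (lev v) (q v).
Proof.
move=> ci; have [mp p01 _] := vp v; have blv := @bm_ind R _ _ _ (mlev v).
have bp := ver_bm mX (vp v).
pose A := [set t | v <= lrcdf P y (psi t)].
have mA : measurable A.
  rewrite (_ : A = (lrcdf P y \o psi) @^-1` `[v, +oo[).
    exact: (measurable_preim (measurableT_comp (measurable_lrcdf P my) mpsi)).
  by apply/seteqP; split => w /=; rewrite in_itv /= andbT.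
have levA : lev v = Y @^-1` A by [].
pose e w := \1_(lev v) w - p v (X w).
have be : bm e by exact: bmB.
pose G := [set E | exists (C : set TX) (B : set TZ),
  [/\ measurable C, measurable B & E = X @^-1` C `&` Z @^-1` B]].
have mG : G `<=` measurable.
  by move=> _ [C [B [mC mB ->]]]; apply: measurableI; exact: measurable_preim.
have GI : setI_closed G.
  move=> _ _ [C [B [mC mB ->]]] [C' [B' [mC' mB' ->]]].
  exists (C `&` C'), (B `&` B'); split; [exact: measurableI|exact: measurableI|].
  by rewrite !preimage_setI setIACA.
have GT : G setT.
  by exists setT, setT; split => //; rewrite !preimage_setT setIT.
have eG E : G E -> Ex (fun w => e w * \1_E w) = 0.
  move=> [C [B [mC mB ->]]].
  (* The version [fA] supplied here may vary with [B] and need not be [p v]; the two are exchanged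
     inside integrals against functions of [X]. *)
  have [fA [fB [/(is_verE P mX _ (mlev v)) vA cB cAB]]] := ci A B mA mB.
  have mZB := measurable_preim mZ mB; have mXC := measurable_preim mX mC.
  have vB := (is_verE P mX fB mZB).1 cB.
  have mI : measurable (lev v `&` Z @^-1` B) by exact: measurableI.
  have vAB := (is_verE P mX (fun x => fA x * fB x) mI).1 cAB.
  have [mfA fA01 _] := vA; have [mfB fB01 _] := vB.
  have bB := @bm_ind R _ _ _ mZB; have bC := @bm_ind R _ _ _ mXC.
  have h1 : Ex (fun w => \1_(lev v `&` Z @^-1` B) w * \1_C (X w)) =
            Ex (fun w => fA (X w) * fB (X w) * \1_C (X w)).
    by apply: (ver_orthoE mX mI vAB); [exact: mind|exact: ind_bdd].
  have mfBC : measurable_fun setT (fun x => fB x * \1_C x).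
    by apply: measurable_funM => //; exact: mind.
  have h2 := ver_orthoE mX (mlev v) vA mfBC (indM_bdd _ fB01).
  have h3 := ver_orthoE mX (mlev v) (vp v) mfBC (indM_bdd _ fB01).
  have mpC : measurable_fun setT (fun x => p v x * \1_C x).
    by apply: measurable_funM => //; exact: mind.
  have h4 := ver_orthoE mX mZB vB mpC (indM_bdd _ p01).
  have b1 : bm (fun w => \1_(lev v `&` Z @^-1` B) w * \1_C (X w)).
    by apply: bmM => //; exact: bm_ind.
  have b2 : bm (fun w => \1_(Z @^-1` B) w * (p v (X w) * \1_C (X w))) by do 2 apply: bmM => //.
  transitivity (Ex (fun w => \1_(lev v `&` Z @^-1` B) w * \1_C (X w) -
                             \1_(Z @^-1` B) w * (p v (X w) * \1_C (X w)))).
    by congr Ex; apply/funext => w; rewrite /e !indicI /=; ring.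
  rewrite (ExB P b1 b2) h1 h4; apply/eqP; rewrite subr_eq0; apply/eqP.
  transitivity (Ex (fun w => fA (X w) * (fB (X w) * \1_C (X w)))).
    by congr Ex; apply/funext => w; rewrite mulrA.
  by rewrite -h2 h3; congr Ex; apply/funext => w; ring.
have WG : measurable_fun setT (W : g_sigma_algebraType G -> TX * TZ).
  apply: measurable_fun_pair => _ C mC; rewrite setTI; apply: sub_sigma_algebra.
    by exists C, setT; split => //; rewrite preimage_setT setIT.
  by exists setT, C; split => //; rewrite preimage_setT setTI.
have vW : is_ver P W (lev v) (fun z => p v z.1).
  split; [exact: (measurableT_comp mp measurable_fst)|by move=> z|].
  move=> D mD; apply: (ortho be mG GI GT eG (F := fun w => \1_D (W w))).
    exact: (measurableT_comp (mind mD) WG).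
  have [M hM] := ind_bdd D; by exists M.
exact: (cvar_uniq mW (mlev v) vW (vq v)).
Qed.

End CondIndep.

(** * The two samples *)

Section Samples.
Context (R : realType) (d : measure_display) (Om : measurableType d).
Variable P : probability Om R.

Lemma mutual_indep_comp (dT dT' : measure_display) (T : measurableType dT)
    (T' : measurableType dT') (F : nat -> Om -> T) (h : T -> T') :
  measurable_fun setT h -> mutual_indep P F -> mutual_indep P (fun i w => h (F i w)).
Proof.
move=> mh iF s A us mA; have mA' i : measurable (h @^-1` A i).
  exact: (measurable_preim mh (mA i)).
exact: (iF s (fun i => h @^-1` A i) us mA').
Qed.

(** Uniqueness of finite measures agreeing on the pi-system of rectangles, applied to two slice
    laws; in its use [k] is the probability of a key event. *)
Lemma law_on_product (dX dZ : measure_display) (TX : measurableType dX)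
    (TZ : measurableType dZ) (W W' : Om -> TX * TZ) (E E' : set Om) (k : {nonneg R}) :
  measurable_fun setT W -> measurable_fun setT W' -> measurable E -> measurable E' ->
  (forall A B, measurable A -> measurable B ->
    P (E' `&` W' @^-1` (A `*` B)) = (k%:num%:E * P (E `&` W @^-1` (A `*` B)))%E) ->
  forall C, measurable C -> P (E' `&` W' @^-1` C) = (k%:num%:E * P (E `&` W @^-1` C))%E.
Proof.
move=> mW mW' mE mE' h C mC.
pose G : set (set (TX * TZ)) := [set A `*` B | A in measurable & B in measurable].
have := @measure_unique _ _ _ G (fun=> setT) _ _ _ _ (slice_law P mW' mE') (mscale k (slice_law P mW mE)).
apply => //.
- exact: measurable_prod_measurableType.
- move=> _ _ [A mA [B mB <-]] [A' mA' [B' mB' <-]]; rewrite -setXI.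
  by exists (A `&` A'); [exact: measurableI|exists (B `&` B') => //; exact: measurableI].
- by move=> n; exists setT => //; exists setT => //; rewrite setXTT.
- by apply/seteqP; split => // z _; exists 0%N.
- by move=> _ [A mA [B mB <-]]; exact: h.
- move=> n; apply: le_lt_trans (ltry 1); apply: probability_le1.
  by apply: measurableI => //; exact: measurable_preim.
Qed.

Context (dX : measure_display) (TX : measurableType dX)
  (dY : measure_display) (TY : measurableType dY)
  (dZ : measure_display) (TZ : measurableType dZ).
Variables (X : Om -> TX) (Y : Om -> TY) (Z : Om -> TZ) (psi : TY -> R).
Variables (Xs : nat -> Om -> TX) (Ys : nat -> Om -> TY) (Zs : nat -> Om -> TZ)
  (U V : nat -> Om -> R).
Hypothesis mX : measurable_fun setT X.
Hypothesis mY : measurable_fun setT Y.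
Hypothesis mZ : measurable_fun setT Z.
Hypothesis mpsi : measurable_fun setT psi.
Hypothesis mXs : forall i, measurable_fun setT (Xs i).
Hypothesis mYs : forall i, measurable_fun setT (Ys i).
Hypothesis mZs : forall i, measurable_fun setT (Zs i).
Hypothesis mU : forall i, measurable_fun setT (U i).
Hypothesis mV : forall i, measurable_fun setT (V i).
Hypothesis indep :
  mutual_indep P (fun i w => (Xs i w, Ys i w, Zs i w, (U i w, V i w))).
Hypothesis law : forall i (A : set TX) (B : set TY) (C : set TZ) (D E : set R),
  measurable A -> measurable B -> measurable C -> measurable D -> measurable E ->
  P (Xs i @^-1` A `&` Ys i @^-1` B `&` Zs i @^-1` C `&` U i @^-1` D `&` V i @^-1` E) =
  (P (X @^-1` A `&` Y @^-1` B `&` Z @^-1` C)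
   * lebesgue_measure (D `&` `[0%R, 1%R]) * lebesgue_measure (E `&` `[0%R, 1%R]))%E.

Let unit_itv : lebesgue_measure (setT `&` `[0%R, 1%R] : set R) = 1%E.
Proof. by rewrite setTI lebesgue_measure_itv /= lte_fin ltr01 oppr0 adde0. Qed.

Let law_U i D : measurable D -> P (U i @^-1` D) = lebesgue_measure (D `&` `[0%R, 1%R]).
Proof.
move=> mD; have := law i measurableT measurableT measurableT mD measurableT.
by rewrite unit_itv !preimage_setT !setTI setIT probT mul1e mule1.
Qed.

Let law_V i E : measurable E -> P (V i @^-1` E) = lebesgue_measure (E `&` `[0%R, 1%R]).
Proof.
move=> mE; have := law i measurableT measurableT measurableT measurableT mE.
by rewrite unit_itv !preimage_setT !setTI probT !mul1e.
Qed.

Lemma sampling_XY : sampling P X (psi \o Y) Xs (fun i => psi \o Ys i) U.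
Proof.
split => //; first exact: measurableT_comp.
- by move=> i; exact: measurableT_comp.
- pose h (z : TX * TY * TZ * (R * R)) := (z.1.1.1, (psi z.1.1.2, z.2.1)).
  apply: (mutual_indep_comp (h := h) _ indep).
  have m11 : measurable_fun setT (fun z : TX * TY * TZ * (R * R) => z.1.1).
    exact: (measurableT_comp measurable_fst measurable_fst).
  apply: measurable_fun_pair; first exact: (measurableT_comp measurable_fst m11).
  apply: measurable_fun_pair.
    exact: (measurableT_comp mpsi (measurableT_comp measurable_snd m11)).
  exact: (measurableT_comp measurable_fst measurable_snd).
move=> i C B D mC mB mD; have mpB := measurable_preim mpsi mB.
have := law i mC mpB measurableT mD measurableT.
rewrite unit_itv mule1 law_U // !preimage_setT !setIT => <-.
by [].
Qed.

(** The hypothesis on laws concerns product sets in [X] and [Z], whereas [sampling] asks for every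
    measurable set of pairs; [law_on_product] bridges the gap. *)
Lemma sampling_WY : sampling P (fun w => (X w, Z w)) (psi \o Y)
  (fun i w => (Xs i w, Zs i w)) (fun i => psi \o Ys i) V.
Proof.
have mW : measurable_fun setT (fun w => (X w, Z w)) by exact: measurable_fun_pair.
have mWs i : measurable_fun setT (fun w => (Xs i w, Zs i w)) by exact: measurable_fun_pair.
split => //; first exact: measurableT_comp.
- by move=> i; exact: measurableT_comp.
- pose h (z : TX * TY * TZ * (R * R)) := ((z.1.1.1, z.1.2), (psi z.1.1.2, z.2.2)).
  apply: (mutual_indep_comp (h := h) _ indep).
  have m11 : measurable_fun setT (fun z : TX * TY * TZ * (R * R) => z.1.1).
    exact: (measurableT_comp measurable_fst measurable_fst).
  apply: measurable_fun_pair.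
    apply: measurable_fun_pair; first exact: (measurableT_comp measurable_fst m11).
    exact: (measurableT_comp measurable_snd measurable_fst).
  apply: measurable_fun_pair.
    exact: (measurableT_comp mpsi (measurableT_comp measurable_snd m11)).
  exact: (measurableT_comp measurable_snd measurable_snd).
move=> i C B D mC mB mD; have mpB := measurable_preim mpsi mB.
have mYB := measurable_preim mY mpB; have mYsB := measurable_preim (mYs i) mpB.
have mVD := measurable_preim (mV i) mD.
have k0 : 0 <= fine (P (V i @^-1` D)) by rewrite fine_ge0.
pose k := NngNum k0.
have kE : P (V i @^-1` D) = (k%:num)%:E by rewrite /= fineK // fin_num_measure.
have := @law_on_product _ _ _ _ _ _ _ (Ys i @^-1` (psi @^-1` B) `&` V i @^-1` D) k
  mW (mWs i) mYB (measurableI _ _ mYsB mVD).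
move=> /(_ _ C mC); rewrite -kE => h.
have -> : (psi \o Ys i) @^-1` B = Ys i @^-1` (psi @^-1` B) by [].
have -> : (psi \o Y) @^-1` B = Y @^-1` (psi @^-1` B) by [].
rewrite -setIA setIC h; first by rewrite muleC setIC.
move=> A1 B1 mA1 mB1; have := law i mA1 mpB mB1 measurableT mD.
rewrite unit_itv mule1 -(law_V i) // preimage_setT setIT.
have -> : (fun w => (X w, Z w)) @^-1` (A1 `*` B1) = X @^-1` A1 `&` Z @^-1` B1 by [].
have -> : (fun w => (Xs i w, Zs i w)) @^-1` (A1 `*` B1) = Xs i @^-1` A1 `&` Zs i @^-1` B1 by [].
have -> : Y @^-1` (psi @^-1` B) `&` (X @^-1` A1 `&` Z @^-1` B1) =
          X @^-1` A1 `&` Y @^-1` (psi @^-1` B) `&` Z @^-1` B1 by rewrite setICA setIA.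
rewrite muleC => <-; congr (P _).
by apply/seteqP; split => w /=; tauto.
Qed.

End Samples.

(** * Sign and vanishing of the limit *)

Section LimitProperties.
Context (R : realType) (d : measure_display) (Om : measurableType d).
Variable P : probability Om R.
Context (dX : measure_display) (TX : measurableType dX).
Variables (X : Om -> TX) (y : Om -> R).
Hypothesis mX : measurable_fun setT X.
Hypothesis my : measurable_fun setT y.
Local Notation lev := (level_event P y).
Local Notation gr := (grid_pt R).

Lemma mesh_gt0 K : 0 < mesh R K. Proof. by rewrite invr_gt0 ltr0n. Qed.

Lemma eq0_of_grid (r C : R) : (forall K, `|r| <= C * mesh R K) -> r = 0.
Proof. exact: le_invS_eq0. Qed.

Lemma ge0_of_grid (r C : R) : (forall K, - (C * mesh R K) <= r) -> 0 <= r.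
Proof.
move=> h; rewrite leNgt; apply/negP => r0.
have : r = 0 by apply: (@eq0_of_grid _ C) => K; rewrite ltr0_norm // lerNl.
by move: r0 => /[swap] ->; rewrite ltxx.
Qed.

Variable p : R -> TX -> R.
Hypothesis vp : forall v, is_ver P X (lev v) (p v).

Lemma cvar_lev_cont v v' : v' <= v ->
  `|cvar P X (lev v) (p v) - cvar P X (lev v') (p v')| <=
  Ex P \1_[set w | v' <= lrcdf P y (y w) < v].
Proof.
move=> vv'; have -> : [set w | v' <= lrcdf P y (y w) < v] = lev v' `\` lev v.
  apply/seteqP; split => w /=; first by move=> /andP[h1 h2]; split => //; apply/negP; rewrite -ltNge.
  by move=> [h1 /negP h2]; rewrite -ltNge in h2; apply/andP.
apply: cvar_cont => //; [exact: measurable_lev|exact: measurable_lev|].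
by move=> w; exact: le_trans.
Qed.

Variable c : R.
Hypothesis cgrid : forall K, `|c - grid_cvar P X y p K| <= 2 * mesh R K.

Lemma limit_ge0 : 0 <= c.
Proof.
apply: (@ge0_of_grid _ 2) => K; have /ler_normlP[h _] := cgrid K.
have : 0 <= grid_cvar P X y p K.
  rewrite mulr_ge0 ?invr_ge0 //; apply: sumr_ge0 => j _; rewrite mulr_ge0 //.
  exact: cvar_ge0.
by lra.
Qed.

Lemma limit_eq0 : c = 0 -> exists g : TX -> R, measurable_fun setT g /\
  {ae P, forall w, y w = g (X w)}.
Proof.
move=> c0; have h a b : (a <= b)%N -> cvar P X (lev (gr a b)) (p (gr a b)) = 0.
  pose D v := cvar P X (lev v) (p v).
  have mFy : measurable_fun setT (fun w => lrcdf P y (y w)).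
    exact: (measurableT_comp (measurable_lrcdf P my) my).
  (* [C := 1]: for [c = 0], [grid_cvar K], which is the mesh times twice the sum, is at most twice
     the mesh. *)
  apply: (grid_sum_bounded_eq0 (P := P) (D := D) (B := 1) (C := 1) mFy ler01) => [v|v v' vv'|K].
  - exact: cvar_ge0.
  - by rewrite mul1r; exact: cvar_lev_cont.
  have := cgrid K; rewrite c0 sub0r normrN => /(le_trans (ler_norm _)).
  rewrite /grid_cvar -/(mesh R K) mulrC ler_pM2r ?mesh_gt0 // -mulr_sumr.
  by rewrite -[leRHS]mulr1 ler_pM2l //; exact.
apply: (recover_real my (q := p)) => [v|a b ab]; first by case: (vp v).
apply: cvar_eq0 => //; [exact: measurable_lev|exact: h].
Qed.

Lemma limit_of_fun (g : TX -> R) : measurable_fun setT g ->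
  {ae P, forall w, y w = g (X w)} -> c = 0.
Proof.
move=> mg yg; apply: (@eq0_of_grid _ 2) => K.
suff g0 : grid_cvar P X y p K = 0 by have := cgrid K; rewrite g0 subr0.
rewrite /grid_cvar big1 ?mulr0 // => j _; set v := _ / _.
have mH := measurable_preim (measurableT_comp (measurable_lrcdf P my) mg) (measurable_itv `[v, +oo[).
set H := _ @^-1` _ in mH.
rewrite (ae_cvar0 mX (measurable_lev P my v) (vp v) (q := \1_H)) ?mulr0 //.
- by move=> x; rewrite indicE; case: (_ \in _); rewrite ?lexx ?ler01.
apply: filterS yg => w yw; rewrite !indicE; congr (nat_of_bool _)%:R.
apply/idP/idP; rewrite !inE /level_event /H /= in_itv /= andbT yw //.
Qed.

End LimitProperties.

Theorem mainTheorem2 (R : realType) (d : measure_display)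
  (Om : measurableType d) (P : probability Om R)
  (dX : measure_display) (TX : measurableType dX)
  (dY : measure_display) (TY : measurableType dY)
  (dZ : measure_display) (TZ : measurableType dZ)
  (X : Om -> TX) (Y : Om -> TY) (Z : Om -> TZ)
  (phi : TX -> R) (psi : TY -> R) (delta : TX * TZ -> R)
  (Xs : nat -> Om -> TX) (Ys : nat -> Om -> TY) (Zs : nat -> Om -> TZ)
  (U V : nat -> Om -> R) :
  measurable_fun setT X -> measurable_fun setT Y -> measurable_fun setT Z ->
  borel_iso phi -> borel_iso psi -> borel_iso delta ->
  (forall i, measurable_fun setT (Xs i)) ->
  (forall i, measurable_fun setT (Ys i)) ->
  (forall i, measurable_fun setT (Zs i)) ->
  (forall i, measurable_fun setT (U i)) ->
  (forall i, measurable_fun setT (V i)) ->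
  (* the samples (X_i, Y_i, Z_i, U_i, V_i) are mutually independent *)
  mutual_indep P (fun i w => (Xs i w, Ys i w, Zs i w, (U i w, V i w))) ->
  (* each (X_i,Y_i,Z_i) has the law of (X,Y,Z); U_i, V_i are Uniform[0,1]
     tie-breaking variables, independent of each other and of (X_i,Y_i,Z_i) *)
  (forall i (A : set TX) (B : set TY) (C : set TZ) (D E : set R),
     measurable A -> measurable B -> measurable C ->
     measurable D -> measurable E ->
     P (Xs i @^-1` A `&` Ys i @^-1` B `&` Zs i @^-1` C
          `&` U i @^-1` D `&` V i @^-1` E) =
     (P (X @^-1` A `&` Y @^-1` B `&` Z @^-1` C)
      * lebesgue_measure (D `&` `[0%R, 1%R]) * lebesgue_measure (E `&` `[0%R, 1%R]))%E) ->
  (* Y is not a.s. equal to a measurable function of X *)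
  ~ (exists f : TX -> TY, measurable_fun setT f /\ {ae P, forall w, Y w = f (X w)}) ->
  let xiXY n w :=
    xi_n n (fun i => phi (Xs i w)) (fun i => U i w) (fun i => psi (Ys i w)) in
  let xiWY n w :=
    xi_n n (fun i => delta (Xs i w, Zs i w)) (fun i => V i w)
           (fun i => psi (Ys i w)) in
  exists L : R,
    [/\ 0 <= L <= 1,
        {ae P, forall w,
           (\forall n \near \oo, 1 - xiXY n w != 0) /\
           ((fun n => (xiWY n w - xiXY n w) / (1 - xiXY n w)) @ \oo --> L)},
        L = 0 <-> cond_indep P X Y Z
      & L = 1 <-> exists g : TX * TZ -> TY,
                    measurable_fun setT g /\
                    {ae P, forall w, Y w = g (X w, Z w)}].
Proof.
move=> mX mY mZ iphi ipsi idelta mXs mYs mZs mU mV indep law nofun xiXY xiWY.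
have [mpsi injpsi _ _] := ipsi.
pose W w := (X w, Z w); pose y := psi \o Y.
have mW : measurable_fun setT W by exact: measurable_fun_pair.
have my : measurable_fun setT y by exact: measurableT_comp.
have SX := sampling_XY mX mY mpsi mXs mYs mU indep law.
have SW := sampling_WY mX mY mZ mpsi mXs mYs mZs mV indep law.
pose lev := level_event P y.
have mlev v : measurable (lev v) by exact: measurable_lev.
(* Versions are chosen independently for each level; the regularity in [v] used later is that of
   [cvar], which does not depend on the choice. *)
have [p vp] := choice (fun v => ver_exists P mX (mlev v)).
have [q vq] := choice (fun v => ver_exists P mW (mlev v)).
have [cX [asX gridX]] := rank_var_cvg SX iphi vp.
have [cW [asW gridW]] := rank_var_cvg SW idelta vq.
have cX0 := limit_ge0 gridX; have cW0 := limit_ge0 gridW.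
have pyth v := cvar_pythagoras (f := fst) mW measurable_fst (mlev v) (vp v) (vq v).
pose D v := cvar P X (lev v) (p v) - cvar P W (lev v) (q v).
have D0 v : 0 <= D v by rewrite /D pyth; apply: Ex_ge0 => w; exact: sqr_ge0.
have gridD K : grid_cvar P X y p K - grid_cvar P W y q K =
    mesh R K * \sum_(j < K.+1) 2 * D (j.+1%:R / K.+1%:R).
  by rewrite /grid_cvar -mulrBr -sumrB; congr (_ * _); apply: eq_bigr => j _; rewrite -mulrBr.
have cWX : cW <= cX.
  rewrite -subr_ge0; apply: (@ge0_of_grid _ _ 4) => K.
  have /ler_normlP[h1 h1'] := gridX K; have /ler_normlP[h2 h2'] := gridW K.
  have : 0 <= grid_cvar P X y p K - grid_cvar P W y q K.
    rewrite gridD mulr_ge0 //; first exact: ltW (mesh_gt0 _ _).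
    by apply: sumr_ge0 => j _; exact: mulr_ge0.
  by lra.
have toTY (dT : measure_display) (T : measurableType dT) (X' : Om -> T) (g0 : T -> R) :
    measurable_fun setT g0 -> {ae P, forall w, y w = g0 (X' w)} ->
    exists g : T -> TY, measurable_fun setT g /\ {ae P, forall w, Y w = g (X' w)}.
  move=> mg0 yg0; have [g mg gE] := borel_iso_factor ipsi mg0.
  by exists g; split => //; apply: filterS yg0 => w /esym /gE.
(* The assumption that [Y] is not a function of [X] enters here: it makes the limiting denominator
   positive, hence the ratio eventually defined. *)
have cX_gt0 : 0 < cX.
  rewrite lt_neqAle cX0 andbT; apply/eqP => /esym cX_eq0; apply: nofun.
  have [g0 [mg0 yg0]] := limit_eq0 mX my vp gridX cX_eq0.
  exact: toTY mg0 yg0.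
exists (1 - cW / cX); split.
- rewrite subr_ge0 ler_pdivrMr // mul1r cWX /= lerBlDr lerDl.
  by rewrite divr_ge0.
- apply: filterS2 (as0_cvg asX) (as0_cvg asW) => w cvX cvW.
  have {}cvX : rank_var_n Xs (fun i => psi \o Ys i) U phi n w @[n --> \oo] --> cX.
    by apply/subr_cvg0.
  have {}cvW : rank_var_n (fun i w => (Xs i w, Zs i w)) (fun i => psi \o Ys i) V delta n w
      @[n --> \oo] --> cW.
    by apply/subr_cvg0.
  have nz : \forall n \near \oo, rank_var_n Xs (fun i => psi \o Ys i) U phi n w != 0.
    have : \forall n \near \oo, 0 < rank_var_n Xs (fun i => psi \o Ys i) U phi n w.
      exact: (cvgr_gt cX cvX).
    by apply: filterS => n; rewrite lt0r => /andP[].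
  have nz' : \forall n \near \oo,
      rank_var (fun i => phi (Xs i w)) (fun i => U i w) (fun i => psi (Ys i w)) n != 0.
    apply: filterS nz => n; apply: contraNneq => h.
    by rewrite /rank_var_n h mul0r.
  split.
    by apply: filterS nz' => n h; have [] := xi_ratio (fun i => delta (Xs i w, Zs i w)) (fun i => V i w) h.
  have lim : (fun n => 1 - rank_var_n (fun i w => (Xs i w, Zs i w)) (fun i => psi \o Ys i) V delta n w /
      rank_var_n Xs (fun i => psi \o Ys i) U phi n w) @ \oo --> 1 - cW / cX.
    apply: cvgB; first exact: cvg_cst.
    apply: cvgM => //; apply: cvgV => //; exact: lt0r_neq0.
  apply: cvg_trans lim; apply: near_eq_cvg.
  have pos : \forall n \near \oo, (0 < n)%N by exists 1%N.
  apply: filterS2 pos nz' => n n0 h.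
  have [_ ->] := xi_ratio (fun i => delta (Xs i w, Zs i w)) (fun i => V i w) h.
  rewrite /rank_var_n; congr (1 - _); set a := rank_var _ _ _ n; set b := rank_var _ _ _ n.
  have b0 : b != 0 by exact: h.
  have nn : n%:R != 0 :> R by rewrite pnatr_eq0 -lt0n.
  by field; rewrite b0 nn.
- have L0 : 1 - cW / cX = 0 <-> cX = cW.
    split => [/eqP|cE]; last by rewrite -cE divff ?subrr // gt_eqF.
    rewrite subr_eq0 => /eqP h; rewrite -[LHS]mul1r h mulrAC -mulrA divff ?mulr1 //.
    exact: lt0r_neq0.
  rewrite L0; split => [cE|ci].
    apply: (cond_indep_of_versions mX mY mZ ipsi vp vq) => a b ab.
    have mFy : measurable_fun setT (fun w => lrcdf P y (y w)).
      exact: (measurableT_comp (measurable_lrcdf P my) my).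
    have Dab : D (grid_pt R a b) = 0.
      (* [B := 2] adds the continuity bounds of the two conditional variances. [C := 2] because the
         two grid errors total four times the mesh and each grid term carries a factor 2. *)
      apply: (grid_sum_bounded_eq0 (P := P) (D := D) (B := 2) (C := 2) mFy) ab => //.
        move=> v v' vv'; have c1 := cvar_lev_cont mX my vp vv'.
        have c2 := cvar_lev_cont mW my vq vv'.
        rewrite (_ : D v - D v' = (cvar P X (lev v) (p v) - cvar P X (lev v') (p v')) -
          (cvar P W (lev v) (q v) - cvar P W (lev v') (q v'))); last by rewrite /D; ring.
        by apply: le_trans (ler_normB _ _) _; lra.
      move=> K; have /ler_normlP[h1 h1'] := gridX K; have /ler_normlP[h2 h2'] := gridW K.
      have := gridD K; rewrite -mulr_sumr => hK.
      have : mesh R K * (2 * \sum_(i < K.+1) D (i.+1%:R / K.+1%:R)) <= mesh R K * 4.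
        by rewrite -hK; lra.
      by rewrite ler_pM2l ?mesh_gt0 //; lra.
    move: Dab; rewrite /D pyth => E0.
    have bd : bm (fun w => (q (grid_pt R a b) (W w) - p (grid_pt R a b) (W w).1) ^+ 2).
      have b1 := ver_bm mW (vq (grid_pt R a b)).
      have b2 := ver_bm mX (vp (grid_pt R a b)).
      exact: (bmX 2 (bmB b1 b2)).
    apply: filterS (Ex_eq0 bd (fun w => sqr_ge0 _) E0) => w /eqP.
    by rewrite sqrf_eq0 subr_eq0 => /eqP.
  apply/eqP; rewrite -subr_eq0; apply/eqP; apply: (@eq0_of_grid _ _ 4) => K.
  have /ler_normlP[h1 h1'] := gridX K; have /ler_normlP[h2 h2'] := gridW K.
  have gE : grid_cvar P X y p K = grid_cvar P W y q K.
    rewrite /grid_cvar; congr (_ * _); apply: eq_bigr => j _; congr (_ * _).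
    exact: (cond_indep_cvar mX mY mZ ipsi vp vq).
  by apply/ler_normlP; split; lra.
have L1 : 1 - cW / cX = 1 <-> cW = 0.
  split => [h|->]; last by rewrite mul0r subr0.
  have /eqP : cW / cX = 0 by lra.
  by rewrite mulf_eq0 invr_eq0 (gt_eqF cX_gt0) orbF => /eqP.
rewrite L1; split => [c0|[g [mg Yg]]].
  have [g0 [mg0 yg0]] := limit_eq0 mW my vq gridW c0.
  exact: toTY mg0 yg0.
apply: (limit_of_fun mW my vq gridW (g := psi \o g)); first exact: measurableT_comp.
by apply: filterS Yg => w; rewrite /y /= => ->.
Qed.
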